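(* Let ${\boldsymbol{\nu}}$ be a tuple of skew shapes. The LLT graph $\mathcal{L}_{\boldsymbol{\nu}}$ is a dual equivalence graph if and only if $\mathrm{diam}({\boldsymbol{\nu}})\le 3$.
   Context: Diagrams are in French notation in $\mathbb Z^2$; a cell in column $j$, row $i$ has content $c=j-i$. For a $k$-tuple ${\boldsymbol{\nu}}=(\nu^{(0)},\dots,\nu^{(k-1)})$ of skew shapes with $n$ cells in total, a standard filling is a bijection from the cells to $[n]$ increasing along rows (left to right) and up columns in each $\nu^{(i)}$; $\mathrm{SYT}({\boldsymbol{\nu}})$ is their set. A cell $x$ of $\nu^{(i)}$ has shifted content $\tilde c(x)=k\,c(x)+i$. The shifted content word of a filling lists its entries by increasing shifted content, equal shifted contents read southwest to northeast. $\mathrm{diam}({\boldsymbol{\nu}})$ is the maximal size of a set $R$ of distinct shifted contents of cells with $|x-y|\le k$ for all $x,y\in R$. Number the cells $1,\dots,n$ in shifted content reading order, with $\tilde c_j$ the shifted content of cell $j$, and set $\tau_i=\max\{j\in[n]:\tilde c_j-\tilde c_i\le k\}$, $\tau({\boldsymbol{\nu}})=\tau_1\cdots\tau_n$. For $w\in S_n$, $\sigma(w)_i=+1$ if $i$ appears before $i+1$ in $w$, else $-1$. For $1<i<n$: $d_i$ fixes $w$ if the value $i$ lies positionally between $i-1$ and $i+1$, and otherwise interchanges $i$ with whichever of $i-1,i+1$ is not in the middle of the three positions. $\tilde d_i$ fixes $w$ if $i-1,i,i+1$ occur in increasing or decreasing order, and otherwise acts on the relative order of these three values by $(i,i-1,i+1)\leftrightarrow(i-1,i+1,i)$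 and $(i,i+1,i-1)\leftrightarrow(i+1,i-1,i)$ (the positions occupied are unchanged). Let $m(i)$ and $M(i)$ be the positions in $w$ of the first and last occurring of $i-1,i,i+1$; then $D_i^{(\tau)}(w)=d_i(w)$ if $\tau_{m(i)}<M(i)$ and $D_i^{(\tau)}(w)=\tilde d_i(w)$ if $\tau_{m(i)}\ge M(i)$. The LLT graph $\mathcal L_{\boldsymbol{\nu}}$ is the signed colored graph whose vertices are the shifted content words of the fillings in $\mathrm{SYT}({\boldsymbol{\nu}})$, with signature $\sigma(w)$, and with $i$-edges the nontrivial orbits $\{w,D_i^{(\tau({\boldsymbol{\nu}}))}(w)\}$ for $1<i<n$. Tableaux: the row reading word reads rows left to right starting from the top row; a tableau's signature is that of its row reading word; $d_i$ acts on tableaux via row reading words. $\mathcal G_\lambda$ ($\lambda\vdash n$) has vertices $\mathrm{SYT}(\lambda)$, tableau signatures, $i$-edges $\{T,d_i(T)\}$ with $d_i(T)\neq T$. A signed colored graph $(V,\sigma,E_{m+1}\cup\dots\cup E_{n-1})$ has finite $V$, sets $E_i$ ($m<i<n$) of unordered pairs of distinct vertices, and $\sigma\colon V\to\{\pm1\}^{N-1}$, $N\ge n$. Isomorphisms of edge colored graphs (no $\sigma$) are vertex bijections preserving $i$-edges both ways. $v$ admits an $i$-neighbor if $\sigma(v)_{i-1}=-\sigma(v)_i$. A dual equivalence graph is a signed colored graph satisfying: (Ax1) for $m<i<n$, $E_i$ is a complete matching on the vertices admitting an $i$-neighbor; (Ax2) if $\{v,w\}\in E_i$ then $\sigma(v)_i=-\sigma(w)_i$,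 $\sigma(v)_{i-1}=-\sigma(w)_{i-1}$, and $\sigma(v)_h=\sigma(w)_h$ for $h<i-2$ and $h>i+1$; (Ax3) for $\{v,w\}\in E_i$: if $\sigma_{i-2}$ is defined then $v$ or $w$ admits an $(i-1)$-neighbor; if $\sigma_{i+1}$ is defined then $v$ or $w$ admits an $(i+1)$-neighbor; (Ax4) for $m+1<i<n$, each connected component of the edge colored graph $(V,E_{i-2}\cup E_{i-1}\cup E_i)$ is isomorphic to a component of $(V',E'_{i-2}\cup E'_{i-1}\cup E'_i)$ for some $\mathcal G_\lambda=(V',\sigma',E')$ ($E_{i-2}$ omitted if $i=m+2$); (Ax5) if $|i-j|>2$, $\{v,w\}\in E_i$, $\{w,x\}\in E_j$, then some $y$ has $\{v,y\}\in E_j$ and $\{x,y\}\in E_i$; (Ax6) for $m<i<n$, any two vertices in one connected component of $(V,\sigma,E_{m+1}\cup\dots\cup E_i)$ are joined by a path using at most one edge of $E_i$. *)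

(* Defs.v *)
From mathcomp Require Import all_boot all_order all_algebra.

Set Implicit Arguments.
Unset Strict Implicit.
Unset Printing Implicit Defensive.

(* Words are sequences of natural numbers with entries 1, ..., n. All indices
   (entries, positions, colors, signature coordinates) are 1-based. *)

Definition pos (w : seq nat) (x : nat) : nat := (index x w).+1.

(* The sign +1 is encoded by [true] and -1 by [false]. *)
Definition word_sign (w : seq nat) (i : nat) : bool := pos w i < pos w i.+1.

Definition between (a b c : nat) : bool := (a < b < c) || (c < b < a).

Definition swap_values (a b : nat) (w : seq nat) : seq nat :=
  [seq if x == a then b else if x == b then a else x | x <- w].

Definition d (i : nat) (w : seq nat) : seq nat :=
  if between (pos w i.-1) (pos w i) (pos w i.+1) then w
  else if between (pos w i) (pos w i.-1) (pos w i.+1)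
       then swap_values i i.+1 w
       else swap_values i i.-1 w.

(* The values i-1, i, i+1 in the order in which they occur in w. *)
Definition pattern (i : nat) (w : seq nat) : seq nat :=
  [seq x <- w | x \in [:: i.-1; i; i.+1]].

(* Replace the r-th term of p by the r-th term of q throughout w. *)
Definition replace_values (p q w : seq nat) : seq nat :=
  [seq if x \in p then nth 0 q (index x p) else x | x <- w].

Definition dt (i : nat) (w : seq nat) : seq nat :=
  let p := pattern i w in
  if p == [:: i; i.-1; i.+1] then replace_values p [:: i.-1; i.+1; i] w
  else if p == [:: i.-1; i.+1; i] then replace_values p [:: i; i.-1; i.+1] w
  else if p == [:: i; i.+1; i.-1] then replace_values p [:: i.+1; i.-1; i] w
  else if p == [:: i.+1; i.-1; i] then replace_values p [:: i; i.+1; i.-1] w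
  else w.

Definition first_pos (i : nat) (w : seq nat) : nat :=
  minn (pos w i.-1) (minn (pos w i) (pos w i.+1)).

Definition last_pos (i : nat) (w : seq nat) : nat :=
  maxn (pos w i.-1) (maxn (pos w i) (pos w i.+1)).

Definition D (tau : nat -> nat) (i : nat) (w : seq nat) : seq nat :=
  if tau (first_pos i w) < last_pos i w then d i w else dt i w.

Definition is_partition (p : seq nat) : bool := sorted geq p && (0 \notin p).

Record partition := Partition {
  parts :> seq nat;
  partsP : is_partition parts
}.

Record skew_shape := SkewShape {
  outer : partition;
  inner : partition;
  inner_sub_outer : forall r, nth 0 inner r <= nth 0 outer r
}.

Definition empty_partition : partition := @Partition [::] isT.

Fact empty_sub (la : partition) r : nth 0 empty_partition r <= nth 0 la r.
Proof. by rewrite /= nth_nil. Qed.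

Definition straight_shape (la : partition) : skew_shape :=
  SkewShape (empty_sub la).

(* A cell of a shape is a pair (row, column). Rows are numbered upwards and
   columns rightwards, both from 0, which does not affect contents. *)
Definition shape_cells (s : skew_shape) : seq (nat * nat) :=
  [seq (r, c) | r <- iota 0 (size (outer s)),
                c <- index_iota (nth 0 (inner s) r) (nth 0 (outer s) r)].

Section Fillings.

Variables (k : nat) (nu : k.-tuple skew_shape).

Definition cells : seq ('I_k * (nat * nat)) :=
  [seq (i, rc) | i <- enum 'I_k, rc <- shape_cells (tnth nu i)].

Definition cell : finType := seq_sub cells.

Definition ncells : nat := #|cell|.

Definition shape_index (x : cell) : 'I_k := (val x).1.
Definition cell_row (x : cell) : nat := (val x).2.1.
Definition cell_column (x : cell) : nat := (val x).2.2.

Definition content (x : cell) : int := ((cell_column x)%:Z - (cell_row x)%:Z)%R.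

Definition shifted_content (x : cell) : int :=
  (k%:Z * content x + (shape_index x : nat)%:Z)%R.

Definition content_le (x y : cell) : bool :=
  (shifted_content x < shifted_content y)%R
  || (shifted_content x == shifted_content y) && (cell_row x <= cell_row y).

(* The cells listed in shifted content reading order. *)
Definition content_order : seq cell := sort content_le (enum cell).

(* The entry v of [n] is encoded by the ordinal v - 1. *)
Definition filling : finType := {ffun cell -> 'I_ncells}.

Definition entry (T : filling) (x : cell) : nat := (T x).+1.

Definition bijectiveb (T : filling) : bool :=
  injectiveb T && [forall v, exists x, T x == v].

Definition rows_increase (T : filling) : bool :=
  [forall x, forall y,
    [&& shape_index x == shape_index y, cell_row x == cell_row y & cell_column x < cell_column y]
      ==> (entry T x < entry T y)].

Definition columns_increase (T : filling) : bool :=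
  [forall x, forall y,
    [&& shape_index x == shape_index y, cell_column x == cell_column y & cell_row x < cell_row y]
      ==> (entry T x < entry T y)].

Definition SYT : {set filling} :=
  [set T | [&& bijectiveb T, rows_increase T & columns_increase T]].

Definition content_word (T : filling) : seq nat :=
  [seq entry T x | x <- content_order].

Definition shifted_contents : seq int :=
  undup [seq shifted_content x | x <- enum cell].

Definition diam : nat :=
  \max_(R : {set seq_sub shifted_contents} |
        [forall x in R, forall y in R, (`|val x - val y| <= k%:Z)%R]) #|R|.

(* The shifted content of the j-th cell, 1 <= j <= n. *)
Definition nth_content (j : nat) : int :=
  nth 0%R [seq shifted_content x | x <- content_order] j.-1.

Definition tau (i : nat) : nat :=
  \max_(1 <= j < ncells.+1 | (nth_content j - nth_content i <= k%:Z)%R) j.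

End Fillings.

(* [edge i] is the set E_i of unordered pairs, as a symmetric irreflexive
   relation. Only its values for scg_m < i < scg_n are relevant. *)
Record signed_colored_graph := SignedColoredGraph {
  vertex : finType;
  scg_m : nat;
  scg_n : nat;
  scg_N : nat;
  signature : vertex -> scg_N.-1.-tuple bool;
  edge : nat -> rel vertex;
  scg_m_gt0 : 0 < scg_m;
  scg_n_leN : scg_n <= scg_N;
  edge_sym : forall i, symmetric (edge i);
  edge_irr : forall i, irreflexive (edge i)
}.

Section Conditions.

Variable G : signed_colored_graph.
Implicit Types (v w x y : vertex G) (i j h : nat) (J : seq nat).

(* sigma(v)_h, meaningful for 1 <= h <= N - 1. *)
Definition sg v h : bool := nth false (signature v) h.-1.

Definition sg_defined h : bool := 0 < h < scg_N G.

Definition is_color i : bool := scg_m G < i < scg_n G.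

Definition admits_neighbor i v : bool := sg v i.-1 == ~~ sg v i.

(* Adjacency in (V, union of the E_j for j in J). *)
Definition adjacent J : rel (vertex G) :=
  fun v w => has (fun j => edge j v w) J.

Definition component J v : {set vertex G} :=
  [set w | connect (adjacent J) v w].

(* p lists the successive (color, vertex) steps of a path from v to w. *)
Fixpoint colored_path J v (p : seq (nat * vertex G)) w : bool :=
  if p is (j, x) :: p' then [&& j \in J, edge j v x & colored_path J x p' w]
  else v == w.

Definition ax1 : Prop := forall i, is_color i ->
  (forall v w, edge i v w -> admits_neighbor i v && admits_neighbor i w) /\
  (forall v, admits_neighbor i v -> exists! w, edge i v w).

Definition ax2 : Prop := forall i v w, is_color i -> edge i v w ->
  [/\ sg v i = ~~ sg w i,
      sg v i.-1 = ~~ sg w i.-1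
    & forall h, sg_defined h -> (h < i - 2) || (i + 1 < h) -> sg v h = sg w h].

Definition ax3 : Prop := forall i v w, is_color i -> edge i v w ->
  (sg_defined (i - 2) -> admits_neighbor i.-1 v || admits_neighbor i.-1 w) /\
  (sg_defined i.+1 -> admits_neighbor i.+1 v || admits_neighbor i.+1 w).

Definition ax5 : Prop := forall i j v w x, is_color i -> is_color j ->
  (i + 2 < j) || (j + 2 < i) -> edge i v w -> edge j w x ->
  exists y, edge j v y /\ edge i x y.

Definition ax6 : Prop := forall i v w, is_color i ->
  w \in component (iota (scg_m G).+1 (i - scg_m G)) v ->
  exists2 p, colored_path (iota (scg_m G).+1 (i - scg_m G)) v p w
           & count (fun s => s.1 == i) p <= 1.

End Conditions.

(* The edge colored graphs induced on A and B with colors in J are isomorphic. *)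
Definition colored_iso (G H : signed_colored_graph) (J : seq nat)
    (A : {set vertex G}) (B : {set vertex H}) : Prop :=
  exists f : vertex G -> vertex H,
    [/\ {in A &, injective f},
        f @: A = B
      & {in J, forall j, {in A &, forall v w,
          edge j v w = edge j (f v) (f w)}}].

(* The graph whose vertices carry words, with signatures read off the words and
   i-edges the pairs {w, op i w}, w <> op i w. *)
Section WordGraph.

Variables (V : finType) (n : nat) (word : V -> seq nat).
Variable op : nat -> seq nat -> seq nat.

Definition word_signature (v : V) : n.-1.-tuple bool :=
  [tuple word_sign (word v) (val h).+1 | h < n.-1].

Definition word_edge (i : nat) : rel V := fun v w =>
  (v != w) && ((word w == op i (word v)) || (word v == op i (word w))).

Fact word_edge_sym i : symmetric (word_edge i).
Proof. by move=> v w; rewrite /word_edge eq_sym orbC. Qed.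

Fact word_edge_irr i : irreflexive (word_edge i).
Proof. by move=> v; rewrite /word_edge eqxx. Qed.

Definition word_graph : signed_colored_graph :=
  @SignedColoredGraph V 1 n n word_signature word_edge
    (ltnSn 0) (leqnn n) word_edge_sym word_edge_irr.

End WordGraph.

Section TableauGraph.

Variable la : partition.

Definition one_shape : 1.-tuple skew_shape := [tuple straight_shape la].

Definition tableau : finType := {T : filling one_shape | T \in SYT one_shape}.

Definition row_reading_le (x y : cell one_shape) : bool :=
  (cell_row y < cell_row x) || (cell_row x == cell_row y) && (cell_column x <= cell_column y).

Definition row_reading_word (T : tableau) : seq nat :=
  [seq entry (val T) x | x <- sort row_reading_le (enum (cell one_shape))].

Definition tableau_graph : signed_colored_graph :=
  word_graph (ncells one_shape) row_reading_word d.

End TableauGraph.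

(* The condition i < scg_n makes E'_i part of the data of the tableau graph. *)
Definition ax4 (G : signed_colored_graph) : Prop :=
  forall i, (scg_m G).+1 < i < scg_n G -> forall v : vertex G,
  let J := [seq j <- [:: i - 2; i - 1; i] | scg_m G < j] in
  exists (la : partition) (u : vertex (tableau_graph la)),
    i < scg_n (tableau_graph la) /\
    colored_iso J (component J v) (component J u).

Definition dual_equivalence_graph (G : signed_colored_graph) : Prop :=
  [/\ ax1 G, ax2 G & ax3 G] /\ [/\ ax4 G, ax5 G & ax6 G].

Section LLTGraph.

Variables (k : nat) (nu : k.-tuple skew_shape).

Definition LLT_words : seq (seq nat) :=
  [seq content_word T | T <- enum (SYT nu)].

Definition LLT_vertex : finType := seq_sub LLT_words.

Definition LLT_graph : signed_colored_graph :=
  word_graph (ncells nu) (val : LLT_vertex -> seq nat) (D (tau nu)).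

End LLTGraph.

(* Main.v *)
(* Read a filling as the word whose v-th letter is the rank, among the distinct
   shifted contents, of the cell with entry v. The operators D_i then act on three
   consecutive letters, and if diam <= 3 a rotation occurs exactly when these
   letters are a, a+1, a+2 in some order with all three contents within distance k.
   A standard tableau is likewise read as a Yamanouchi word (the v-th letter is the
   row of v), on which d_i acts on three consecutive letters as well. A map phi from
   the first kind of words to the second is built one letter at a time: the row of
   a new letter c is one more than the largest row in which the last entry of phi
   can lie for a word of the same component ending in a letter >= c. By induction
   on the length, phi preserves signatures, commutes with the moves and is injective
   on components; the induction step only involves the last six letters and reduces
   to finitely many cases. Hence every component of the LLT graph is a copy of some
   G_lambda, and the axioms follow from the connectedness of Yamanouchi words of a
   given content.

   Conversely, take four distinct shifted contents in a window of length k and a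
   filling with four consecutive entries on cells with these contents, in the
   relative order 2143 or 3412. All moves among these entries are rotations, and
   they give a path of four distinct vertices whose edges alternate between E_{i-1}
   and E_i. In G_lambda such a path has at most three vertices. *)
Require Import Defs.
From mathcomp Require Import all_boot all_order all_algebra.
From mathcomp Require Import zify.
From mathcomp Require boolp.
(* finset has another [partition]. *)
Import Defs.

Set Implicit Arguments.
Unset Strict Implicit.
Unset Printing Implicit Defensive.

(** * Moves on words *)

(** The signature forces the row of a new letter [c]: for every word [w] of the component, that row
    must be at most the last row of [phi w] exactly when the last letter of [w] is less than [c].
    The maximum is the least row allowed by the words ending in a letter [>= c]; that it suits the
    remaining words is a local form of (Ax3). Commutation with a move of the last three letters is
    delicate because the rows before and after the move are built independently and are not known to
    form the same multiset. They are pinned down by test rows placed in front of the three letters.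
    Injectivity is the global obstacle: a component could cover a component of tableaux several
    times. Words with a fixed last row inherit injectivity from shorter words, so what has to be
    excluded is that walking from one last row to others and back ends in a different piece. A
    closed walk through three pieces excludes it. Three removable corners and the three auxiliary
    rows that let them be exchanged occupy six letters, hence the bound six in the finite checks. *)

Section Moves.
Variable f : nat -> nat -> nat -> nat * nat * nat.

(* The positions j, j+1, j+2 are counted from 0, so this is a move of color j+2. *)
Fixpoint mv (j : nat) (u : seq nat) {struct u} : seq nat :=
  match u with
  | [::] => [::]
  | x :: t =>
    if j is j'.+1 then x :: mv j' t
    else if t is y :: z :: t' then
           [:: (f x y z).1.1, (f x y z).1.2, (f x y z).2 & t']
         else u
  end.

Definition run (cs u : seq nat) : seq nat := foldl (fun w c => mv c w) u cs.

Lemma size_mv j u : size (mv j u) = size u.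
Proof.
elim: u j => [|x u IH] [|j] //=; first by case: u {IH} => [|y [|z t]].
by rewrite IH.
Qed.

Lemma mv_out j u : size u <= j.+2 -> mv j u = u.
Proof.
elim: u j => [|x u IH] [|j] //=; first by case: u {IH} => [|y [|z t]].
by rewrite ltnS => /IH ->.
Qed.

Lemma mv_catl j u t : j.+2 < size u -> mv j (u ++ t) = mv j u ++ t.
Proof.
elim: u j => [|x u IH] [|j] //=; first by case: u {IH} => [|y [|z s]].
by rewrite ltnS => /IH ->.
Qed.

Lemma mv_catr p j u : mv (size p + j) (p ++ u) = p ++ mv j u.
Proof. by elim: p => //= x p ->. Qed.

Lemma mv_comm i j u : i.+2 < j -> mv i (mv j u) = mv j (mv i u).
Proof.
elim: u i j => [|x u IH] [|i] [|j] //= ij; last by rewrite IH.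
case: u {IH} => [|y [|z t]]; case: j ij => [|[|j]] //= _.
Qed.

Lemma size_run cs u : size (run cs u) = size u.
Proof. by elim: cs u => //= c cs IH u; rewrite IH size_mv. Qed.

Lemma run_cat cs cs' u : run (cs ++ cs') u = run cs' (run cs u).
Proof. exact: foldl_cat. Qed.

Lemma run_rcons cs c u : run (rcons cs c) u = mv c (run cs u).
Proof. by rewrite -cats1 run_cat. Qed.

Lemma run_catl cs u t : all (fun c => c.+2 < size u) cs ->
  run cs (u ++ t) = run cs u ++ t.
Proof.
elim: cs u => //= c cs IH u /andP[cu csu].
by rewrite mv_catl // IH // size_mv.
Qed.

Lemma run_catr cs p u : run (map (addn (size p)) cs) (p ++ u) = p ++ run cs u.
Proof. by elim: cs u => //= c cs IH u; rewrite mv_catr IH. Qed.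

Lemma run_filter cs u : run [seq c <- cs | c.+2 < size u] u = run cs u.
Proof.
elim: cs u => //= c cs IH u; case: ifP => cu /=.
  by rewrite -IH size_mv.
by rewrite mv_out ?IH // leqNgt cu.
Qed.

End Moves.

(** The relation is [ltn] for content ranks and [geq] for rows: upper rows are read first, so [i]
    precedes [i+1] in the row reading word exactly when the row of [i+1] is at most that of [i]. *)
Definition sigw (s : rel nat) (u : seq nat) : seq bool :=
  if u is x :: t then pairmap s x t else [::].

Lemma nth_sigw s u j : j.+1 < size u ->
  nth false (sigw s u) j = s (nth 0 u j) (nth 0 u j.+1).
Proof. by case: u => // x t; rewrite ltnS => jt; rewrite (nth_pairmap 0). Qed.

Lemma drop_sigw s k u : drop k (sigw s u) = sigw s (drop k u).
Proof. by elim: k u => [|k IH] [|x [|y u]] //=; rewrite ?drop0 // -IH. Qed.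

Lemma sigw_suffix s s' p p' u u' : size p = size p' ->
  sigw s (p ++ u) = sigw s' (p' ++ u') -> sigw s u = sigw s' u'.
Proof.
move=> e /(congr1 (drop (size p))); rewrite !drop_sigw drop_size_cat //.
by rewrite e drop_size_cat.
Qed.

Lemma sigw_rcons2 s u x y : sigw s (rcons (rcons u x) y) = rcons (sigw s (rcons u x)) (s x y).
Proof. by case: u => //= z t; elim: t z => //= w t IH z; rewrite IH. Qed.

Lemma sigw_map s s' (g : nat -> nat) u :
  {in u &, forall x y, s' (g x) (g y) = s x y} -> sigw s' (map g u) = sigw s u.
Proof.
case: u => //= x t; elim: t x => //= y t IH x H.
rewrite H ?inE ?eqxx ?orbT //; congr (_ :: _); apply: IH.
by move=> a b ha hb; apply: H; rewrite inE ?ha ?hb orbT.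
Qed.

(* The effect of D_i on the ranks of the contents of i-1, i, i+1: if diam <= 3, three
   cells within distance k have ranks a, a+1, a+2; [T a] tells whether such ranks are that close. *)
Definition triD (T : pred nat) (p q r : nat) : nat * nat * nat :=
  if between p q r then (p, q, r)
  else if (maxn p (maxn q r) == (minn p (minn q r)).+2) && T (minn p (minn q r))
  then if between q p r then (q, r, p) else (r, p, q)
  else if between q p r then (p, r, q) else (q, p, r).

(* Two entries on one diagonal differ by at least 3. *)
Fixpoint ok (u : seq nat) : bool :=
  if u is x :: t then (x \notin take 2 t) && ok t else true.

Lemma ok_cat u v : ok (u ++ v) -> ok u && ok v.
Proof.
elim: u => //= x u IH /andP[xu /IH /andP[-> ->]]; rewrite !andbT.
by apply: contra xu; case: u {IH} => [|y [|z u]] //=; rewrite ?take0 !inE ?orbF // => ->.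
Qed.

Lemma perm_triD T p q r : perm_eq [:: (triD T p q r).1.1; (triD T p q r).1.2; (triD T p q r).2] [:: p; q; r].
Proof.
rewrite /triD; do 4?case: ifP => _ //=; apply/permP => a /=; lia.
Qed.

Lemma perm_mvD T j u : perm_eq (mv (triD T) j u) u.
Proof.
elim: u j => [|x u IH] [|j] //=; last by rewrite perm_cons.
case: u {IH} => [|y [|z t]] //.
rewrite -[[:: _, _, _ & t]]/([:: _; _; _] ++ t) -[[:: x, y, z & t]]/([:: x; y; z] ++ t).
by rewrite perm_cat2r perm_triD.
Qed.

Lemma triDK T p q r : [&& p != q, q != r & p != r] ->
  triD T (triD T p q r).1.1 (triD T p q r).1.2 (triD T p q r).2 = (p, q, r).
Proof.
move=> H; have [e1 | e1] := boolP (between p q r); first by rewrite {2 3 4}/triD e1 /= /triD e1.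
set a := minn p (minn q r); set c := maxn p (maxn q r).
have [tw | tw] := boolP ((c == a.+2) && T a).
- have [e2 | e2] := boolP (between q p r).
    rewrite {2 3 4}/triD (negPf e1) e2 -/a -/c tw /= /triD.
    have -> : minn q (minn r p) = a by lia.
    have -> : maxn q (maxn r p) = c by lia.
    rewrite tw; move: e1 e2 H; rewrite /between.
    by do 2?case: ifP; try lia.
  rewrite {2 3 4}/triD (negPf e1) (negPf e2) -/a -/c tw /= /triD.
  have -> : minn r (minn p q) = a by lia.
  have -> : maxn r (maxn p q) = c by lia.
  rewrite tw; move: e1 e2 H; rewrite /between.
  by do 2?case: ifP; try lia.
have [e2 | e2] := boolP (between q p r).
  rewrite {2 3 4}/triD (negPf e1) e2 -/a -/c (negPf tw) /= /triD.
  have -> : minn p (minn r q) = a by lia.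
  have -> : maxn p (maxn r q) = c by lia.
  rewrite (negPf tw); move: e1 e2 H; rewrite /between.
  by do 2?case: ifP; try lia.
rewrite {2 3 4}/triD (negPf e1) (negPf e2) -/a -/c (negPf tw) /= /triD.
have -> : minn q (minn p r) = a by lia.
have -> : maxn q (maxn p r) = c by lia.
rewrite (negPf tw); move: e1 e2 H; rewrite /between.
by do 2?case: ifP; try lia.
Qed.

Lemma mvDK T j u : ok u -> mv (triD T) j (mv (triD T) j u) = u.
Proof.
elim: u j => [|x u IH] [|j] //=; last by case/andP=> _ /IH ->.
case: u {IH} => [|y [|z t]] //=; rewrite !inE !negb_or.
move=> /andP[/andP[xy xz] /andP[yz _]]; rewrite triDK ?xy ?xz //=.
by case/andP: yz => ->; case/andP: xz => ->.
Qed.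

(* The closed walk of moves behind [cross_triangle], found by computer search. *)
Definition loop := [:: 3; 0; 2; 0; 1; 3; 1; 0; 2; 1; 3; 1; 0; 2].

(** Moves can destroy [ok] for an arbitrary word, for instance 0 2 1 0. Words of fillings stay [ok]
    because each move leads to another filling. *)
Definition good (T : pred nat) u := forall cs, ok (run (triD T) cs u).

(* Only the relative order of the letters and the values of T matter, so a word of
   length n may be replaced by one with letters < n; this makes the local facts finite. *)
Section Rank.
Variables (T : pred nat) (u : seq nat).

Definition rank (x : nat) : nat := count (fun y => y < x) (undup u).

(** Among at most six letters, [a] has rank at most 3 if [a.+1] and [a.+2] occur as well, so four
    bits hold all the information about [T] that the moves can use. *)
Definition rank_twist : pred nat :=
  nth false [seq has (fun a => [&& rank a == j, a.+1 \in u, a.+2 \in u & T a]) u | j <- iota 0 4].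

Lemma rankS a : rank a.+1 = rank a + (a \in u).
Proof.
rewrite /rank -(mem_undup u) -(count_uniq_mem _ (undup_uniq u)).
rewrite -[RHS]count_predUI [X in _ = _ + X](@eq_count _ _ pred0) ?count_pred0 ?addn0.
  by apply: eq_count => y /=; rewrite ltnS leq_eqVlt orbC.
by move=> y /=; lia.
Qed.

Lemma rank_mono x y : x <= y -> rank x <= rank y.
Proof. by move=> xy; apply: sub_count => z /= /leq_trans; apply. Qed.

Lemma rank_lt x y : x \in u -> (rank x < rank y) = (x < y).
Proof.
move=> xu; case: (ltnP x y) => xy.
  by apply: leq_trans (rank_mono xy); rewrite rankS xu addn1.
by rewrite ltnNge rank_mono.
Qed.

Lemma rank_eq x y : x \in u -> y \in u -> (rank x == rank y) = (x == y).
Proof.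
move=> xu yu; have := rank_lt y xu; have := rank_lt x yu.
by case: (ltngtP x y) => //; case: (ltngtP (rank x) (rank y)).
Qed.

Lemma rank_bound x : x \in u -> rank x < size u.
Proof.
move=> xu; apply: leq_trans (size_undup u).
by apply: leq_trans (count_size (fun y => y < x.+1) _); rewrite -/(rank _) rankS xu addn1.
Qed.

Hypothesis u6 : size u <= 6.

Lemma rank_triD (p q r : nat) : p \in u -> q \in u -> r \in u ->
  [&& p != q, q != r & p != r] ->
  triD rank_twist (rank p) (rank q) (rank r) =
  (rank (triD T p q r).1.1, rank (triD T p q r).1.2, rank (triD T p q r).2).
Proof.
move=> pu qu ru pqr.
have btw (a b c : nat) : a \in u -> b \in u -> c \in u -> between (rank a) (rank b) (rank c) = between a b c.
  by move=> au bu cu; rewrite /between !rank_lt.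
rewrite /triD !btw //; case: ifPn => // npqr.
have minr (a b : nat) : a \in u -> b \in u -> minn (rank a) (rank b) = rank (minn a b).
  by move=> au bu; rewrite /minn rank_lt //; case: ifP.
have maxr (a b : nat) : a \in u -> b \in u -> maxn (rank a) (rank b) = rank (maxn a b).
  by move=> au bu; rewrite /maxn rank_lt //; case: ifP.
have minu (a b : nat) : a \in u -> b \in u -> minn a b \in u by rewrite /minn; case: ifP.
have maxu (a b : nat) : a \in u -> b \in u -> maxn a b \in u by rewrite /maxn; case: ifP.
rewrite !(minr, maxr, minu, maxu) //.
set a := minn p _; set c := maxn p _.
have au : a \in u by rewrite !minu.
have cu : c \in u by rewrite !maxu.
suff -> : (rank c == (rank a).+2) && rank_twist (rank a) = (c == a.+2) && T a.
  by do 2!case: ifP.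
(* The median letter [b] occurs in [u]: if [c] is [a.+2], then [b] is [a.+1] and the ranks are
   consecutive too. Conversely [rank_twist] records that [a.+1] and [a.+2] occur, so consecutive
   ranks come from consecutive letters. *)
have [b bu /andP[ab bc]] : exists2 b, b \in u & a < b < c.
  move: npqr pqr; rewrite /a /c /between => npqr pqr.
  case: (boolP ((q < p < r) || (r < p < q))) => e; [exists p | exists r] => //; try lia.
have twE j : rank_twist j =
    (j < 4) && has (fun a => [&& rank a == j, a.+1 \in u, a.+2 \in u & T a]) u.
  rewrite /rank_twist; case: (ltnP j 4) => j4.
    by rewrite (nth_map 0) ?size_iota // nth_iota.
  by rewrite nth_default // size_map size_iota.
rewrite twE; apply/idP/idP.
  case/andP=> /eqP rc /andP[_ /hasP[a' a'u /and4P[]]].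
  rewrite rank_eq // => /eqP -> a1u a2u -> ; rewrite andbT -rank_eq //.
  by rewrite !rankS au a1u rc !addn1.
case/andP=> /eqP ca Ta; have bE : b = a.+1 by lia.
have rc : rank c = (rank a).+2 by rewrite ca !rankS au -bE bu !addn1.
rewrite rc eqxx /=; apply/andP; split.
  by have := rank_bound cu; rewrite rc => h; have := leq_trans h u6.
by apply/hasP; exists a => //; rewrite eqxx -ca cu -bE bu.
Qed.

Lemma ok_rank w : {subset w <= u} -> ok (map rank w) = ok w.
Proof.
elim: w => //= x w IH sub.
have xu : x \in u by apply: sub; rewrite mem_head.
have wu : {subset w <= u} by move=> y yw; apply: sub; rewrite inE yw orbT.
rewrite IH // -map_take; congr (~~ _ && _).
apply/mapP/idP => [[y yw /eqP]|xw]; last by exists x.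
have yu : y \in u by apply: wu; apply: mem_take yw.
by rewrite rank_eq // => /eqP ->.
Qed.

Lemma mv_rank j w : {subset w <= u} -> ok w ->
  mv (triD rank_twist) j (map rank w) = map rank (mv (triD T) j w).
Proof.
elim: w j => [|x w IH] [|j] //= sub /andP[xw okw]; last first.
  by rewrite IH // => y yw; apply: sub; rewrite inE yw orbT.
case: w {IH} sub xw okw => [|y [|z t]] //= sub xw /andP[yt _].
rewrite rank_triD //; try by apply: sub; rewrite !inE eqxx ?orbT.
move: xw yt; rewrite !inE !negb_or => /andP[-> /andP[-> _]].
by case/andP=> ->.
Qed.

Lemma run_rank cs w : {subset w <= u} -> good T w ->
  run (triD rank_twist) cs (map rank w) = map rank (run (triD T) cs w).
Proof.
elim: cs w => //= c cs IH w sub gw; rewrite mv_rank ?(gw [::]) // IH //.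
  by move=> y; rewrite (perm_mem (perm_mvD _ _ _)); apply: sub.
by move=> cs'; apply: (gw (c :: cs')).
Qed.

Lemma sigw_rank w : {subset w <= u} -> sigw ltn (map rank w) = sigw ltn w.
Proof. by move=> sub; apply: sigw_map => x y /sub xu _ /=; apply: rank_lt. Qed.

Lemma map_rank_inj w w' : {subset w <= u} -> {subset w' <= u} ->
  map rank w = map rank w' -> w = w'.
Proof.
elim: w w' => [|x w IH] [|y w'] //= sub sub' [/eqP].
have xu : x \in u by apply: sub; rewrite mem_head.
have yu : y \in u by apply: sub'; rewrite mem_head.
rewrite rank_eq // => /eqP -> e; congr (_ :: _).
by apply: IH => // z zw; [apply: sub|apply: sub']; rewrite inE zw orbT.
Qed.
End Rank.

(** * Local facts on four, five and six letters, by exhaustion *)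

Fixpoint all_words (m n : nat) (P : pred (seq nat)) : bool :=
  if n is n'.+1 then all (fun x => all_words m n' (fun t => P (x :: t))) (iota 0 m)
  else P [::].

Lemma all_wordsP m n P u : all_words m n P -> size u = n -> all (gtn m) u -> P u.
Proof.
elim: n P u => [|n IH] P [|x u] //= /allP H [su] /andP[xm um].
by apply: (IH (fun t => P (x :: t))) => //; apply: H; rewrite mem_iota.
Qed.

Definition bits4 : seq (seq bool) :=
  iter 4 (fun l => map (cons false) l ++ map (cons true) l) [:: [::]].

Notation sgl := (sigw ltn).

(* Nested [if]s, here and below, stop [vm_compute] from evaluating the second argument of [&&]. *)
Fixpoint follows (T : pred nat) (cs : seq nat) (ss : seq (seq bool)) (u : seq nat) : bool :=
  match cs, ss with
  | c :: cs', s :: ss' =>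
    let w := mv (triD T) c u in
    if ok w then if sgl w == s then follows T cs' ss' w else false else false
  | _, _ => true
  end.

(** These are the signatures of the Yamanouchi words met along [loop] in [cross_triangle]; closing
    of the walk is tested only for words that show exactly them. *)
Definition loop_start := [:: true; false; true; false; true].
Definition loop_sigs : seq (seq bool) :=
  [:: [:: true; false; true; true; false]; [:: false; true; false; true; false];
      [:: false; true; true; false; false]; [:: true; false; true; false; false];
      [:: true; true; false; true; false]; [:: true; true; false; false; true];
      [:: true; false; true; false; true]; [:: false; true; true; false; true];
      [:: false; true; false; true; false]; [:: false; false; true; true; false];
      [:: false; false; true; false; true]; [:: false; true; false; true; true];
      [:: true; false; false; true; true]; [:: true; false; true; false; true]].

(** Local form of (Ax3): one end of a nontrivial move 0 admits the move 1. The conditions [ok] here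
    and below are the instances of [good] that a finite check can state. *)
Definition edge_fact (T : pred nat) u : bool :=
  let A := run (triD T) [:: 0] u in let B := run (triD T) [:: 1] u in
  let s := nth false (sgl u) in let sA := nth false (sgl A) in let sB := nth false (sgl B) in
  [&& ok A, ok B, ok (run (triD T) [:: 1; 0] u) & s 0 != s 1] ==> ((s 1 != s 2) || (sA 1 != sA 2)).

(** Two consecutive colors should give a path of three vertices, or a double edge as for the shape
    (2,2). Only the starting signatures needed later are tested. *)
Definition square_fact (T : pred nat) u : bool :=
  let A := run (triD T) [:: 0] u in let B := run (triD T) [:: 1] u in
  let sB := nth false (sgl B) 0 in
  [&& ok A, ok B & ok (run (triD T) [:: 1; 0] u)] ==>
  match sgl u with
  | [:: true; true; false] => sB && (sgl (run (triD T) [:: 1; 0] u) == [:: false; true; true])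
  | [:: false; true; false] => if sB then A == B else sgl A == [:: true; false; false]
  | _ => true
  end.

(** In [top_slide] the two signs compare one auxiliary row with a row present before the move 2 and
    with a row present after it. *)
Definition slide_fact (T : pred nat) u : bool :=
  if (sgl u == [:: false; true; true; false]) || (sgl u == [:: true; false; false; true]) then
    [&& ok (run (triD T) [:: 0] u), ok (run (triD T) [:: 0; 1] u),
        ok (run (triD T) [:: 2] u) & ok (run (triD T) [:: 2; 1] u)] ==>
    (nth false (sgl (run (triD T) [:: 0; 1] u)) 3
       == nth false (sgl (run (triD T) [:: 2; 1] u)) 0)
  else true.

(** The moves 0 and 2 share the middle letter; the fact says that they commute if each flips its own
    two signs and leaves those of the other alone. *)
Definition swap_fact (T : pred nat) u : bool :=
  match sgl u with
  | [:: a; b; c; e] =>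
    let A := run (triD T) [:: 0] u in let C := run (triD T) [:: 2] u in
    let CA := run (triD T) [:: 0; 2] u in let AC := run (triD T) [:: 2; 0] u in
    [&& a != b, c != e, ok A, ok C, ok CA & ok AC] ==>
    [&& sgl A == [:: b; a; c; e], sgl C == [:: a; b; e; c],
        sgl CA == [:: b; a; e; c] & sgl AC == [:: b; a; e; c]] ==> (AC == CA)
  | _ => true
  end.

Definition loop_fact (T : pred nat) u : bool :=
  if sgl u == loop_start then
    if follows T loop loop_sigs u then run (triD T) loop u == u else true
  else true.

Definition holds_for (n : nat) (F : pred nat -> pred (seq nat)) : bool :=
  all_words n n (fun u => if ok u then all (fun bs => F (nth false bs) u) bits4 else true).

Lemma edge_check : holds_for 4 edge_fact. Proof. by vm_compute. Qed.
Lemma square_check : holds_for 4 square_fact. Proof. by vm_compute. Qed.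
Lemma slide_check : holds_for 5 slide_fact. Proof. by vm_compute. Qed.
Lemma swap_check : holds_for 5 swap_fact. Proof. by vm_compute. Qed.
Lemma loop_check : holds_for 6 loop_fact. Proof. by vm_compute. Qed.

Lemma holds_forP n F T u : holds_for n F -> size u = n -> good T u ->
  F (rank_twist T u) (map (rank u) u).
Proof.
move=> chk su gu.
have := all_wordsP chk; move/(_ (map (rank u) u)); rewrite size_map => /(_ su).
have -> : all (gtn n) (map (rank u) u).
  by apply/allP => _ /mapP[x xu ->]; rewrite -su; apply: rank_bound.
move=> /(_ isT); rewrite (ok_rank (u := u)) // (gu [::]) => /allP; apply.
by rewrite /rank_twist /=; do 4!case: (has _ _).
Qed.

Section Facts.
Variables (T : pred nat) (u : seq nat).
Hypothesis gu : good T u.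
Let run0 cs : size u <= 6 ->
  run (triD (rank_twist T u)) cs (map (rank u) u) = map (rank u) (run (triD T) cs u).
Proof. by move=> u6; apply: run_rank. Qed.
Let sub_run cs : {subset run (triD T) cs u <= u}.
Proof.
elim/last_ind: cs => // cs c IH x; rewrite run_rcons (perm_mem (perm_mvD _ _ _)); exact: IH.
Qed.
Let ok_run cs : ok (map (rank u) (run (triD T) cs u)).
Proof. by rewrite ok_rank //; apply: gu. Qed.
Let sig_run cs : sgl (map (rank u) (run (triD T) cs u)) = sgl (run (triD T) cs u).
Proof. by apply: sigw_rank. Qed.

Lemma edge_factP : size u = 4 -> nth false (sgl u) 0 != nth false (sgl u) 1 ->
  (nth false (sgl u) 1 != nth false (sgl u) 2) ||
  (nth false (sgl (run (triD T) [:: 0] u)) 1 != nth false (sgl (run (triD T) [:: 0] u)) 2).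
Proof.
move=> su; have := holds_forP edge_check su gu; rewrite /edge_fact.
have su6 : size u <= 6 by rewrite su.
rewrite !run0 //.
by rewrite !ok_run (sig_run [::]) !sig_run /= => /implyP.
Qed.

Lemma square_factP : size u = 4 ->
  match sgl u with
  | [:: true; true; false] =>
    nth false (sgl (run (triD T) [:: 1] u)) 0 &&
    (sgl (run (triD T) [:: 1; 0] u) == [:: false; true; true])
  | [:: false; true; false] =>
    if nth false (sgl (run (triD T) [:: 1] u)) 0 then run (triD T) [:: 0] u == run (triD T) [:: 1] u
    else sgl (run (triD T) [:: 0] u) == [:: true; false; false]
  | _ => true
  end.
Proof.
move=> su; have := holds_forP square_check su gu; rewrite /square_fact.
have su6 : size u <= 6 by rewrite su.
rewrite !run0 //.
rewrite !ok_run (sig_run [::]) !sig_run /=.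
case: sgl => [|[] [|[] [|[] [|]]]] //=; case: ifP => // _ /eqP e; apply/eqP.
by apply: (map_rank_inj _ _ e); apply: (@sub_run [:: _]).
Qed.

Lemma slide_factP : size u = 5 ->
  (sgl u == [:: false; true; true; false]) || (sgl u == [:: true; false; false; true]) ->
  nth false (sgl (run (triD T) [:: 0; 1] u)) 3 = nth false (sgl (run (triD T) [:: 2; 1] u)) 0.
Proof.
move=> su s; have := holds_forP slide_check su gu; rewrite /slide_fact.
have su6 : size u <= 6 by rewrite su.
by rewrite !run0 // !ok_run (sig_run [::]) !sig_run /= s => /eqP.
Qed.

Lemma swap_factP a b c e : size u = 5 -> sgl u = [:: a; b; c; e] -> a != b -> c != e ->
  sgl (run (triD T) [:: 0] u) = [:: b; a; c; e] ->
  sgl (run (triD T) [:: 2] u) = [:: a; b; e; c] ->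
  sgl (run (triD T) [:: 0; 2] u) = [:: b; a; e; c] ->
  sgl (run (triD T) [:: 2; 0] u) = [:: b; a; e; c] ->
  run (triD T) [:: 2; 0] u = run (triD T) [:: 0; 2] u.
Proof.
move=> su s ab ce s1 s2 s3 s4; have := holds_forP swap_check su gu; rewrite /swap_fact.
have su6 : size u <= 6 by rewrite su.
rewrite (sig_run [::]) [sgl (run _ [::] _)]s ab ce.
rewrite !run0 //.
rewrite !ok_run !sig_run s1 s2 s3 s4 !eqxx /= => /eqP e1.
by apply: (map_rank_inj _ _ e1); apply: (@sub_run [:: _; _]).
Qed.

Lemma loop_factP : size u = 6 -> sgl u = loop_start ->
  (forall k, k < size loop -> sgl (run (triD T) (take k.+1 loop) u) = nth [::] loop_sigs k) ->
  run (triD T) loop u = u.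
Proof.
move=> su s sk; have := holds_forP loop_check su gu; rewrite /loop_fact.
have su6 : size u <= 6 by rewrite su.
rewrite (sig_run [::]) [sgl (run _ [::] _)]s eqxx run0 //.
suff -> : follows (rank_twist T u) loop loop_sigs (map (rank u) u).
  by move=> /eqP e; apply: (map_rank_inj _ _ e) => //; apply: sub_run.
have : forall k, k < size loop -> nth [::] loop_sigs k =
    sgl (run (triD (rank_twist T u)) (take k.+1 loop) (map (rank u) u)).
  by move=> k kl; rewrite run0 // sig_run sk.
have : forall k, ok (run (triD (rank_twist T u)) (take k.+1 loop) (map (rank u) u)).
  by move=> k; rewrite run0.
have : size loop = size loop_sigs by [].
elim: loop loop_sigs (map _ _) => [|c cs IH] [|x ss] w //= [sz] okr sr.
have := okr 0; have := sr 0 isT; rewrite /= take0 /= => -> ->; rewrite eqxx.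
by apply: IH => // k; apply: (sr k.+1).
Qed.
End Facts.

Lemma triD_flip T p q r p' q' r' : [&& p != q, q != r & p != r] -> triD T p q r = (p', q', r') ->
  [/\ (p < q) = (q < r) -> (p', q', r') = (p, q, r),
      p < q -> r < q -> (q' < p') && (q' < r')
    & q < p -> q < r -> (p' < q') && (r' < q')].
Proof.
move=> H; rewrite /triD; case: ifP => [b1 [<- <- <-]|b1].
  by move: b1; rewrite /between => b1; split; clear -b1 H; [| lia..].
move: b1; rewrite /between; case: ifP => _; case: ifP => b2 b1 [<- <- <-]; split;
  clear -b1 b2 H; by [| lia | move=> *; exfalso; lia].
Qed.

Lemma mv_split f j y : j.+2 < size y -> exists p a b c t,
  [/\ y = p ++ [:: a, b, c & t], size p = j &
      mv f j y = p ++ [:: (f a b c).1.1, (f a b c).1.2, (f a b c).2 & t]].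
Proof.
move=> jy; exists (take j y), (nth 0 y j), (nth 0 y j.+1), (nth 0 y j.+2), (drop j.+3 y).
have e : y = take j y ++ [:: nth 0 y j, nth 0 y j.+1, nth 0 y j.+2 & drop j.+3 y].
  by rewrite -!drop_nth ?cat_take_drop //; lia.
have s : size (take j y) = j by rewrite size_takel //; lia.
split=> //; rewrite {1}e -{1}[in LHS]s -[size _]addn0 mv_catr //.
Qed.

Definition conn f u w := exists2 cs, all (fun c => c.+2 < size u) cs & w = run f cs u.

Lemma conn_run f cs u : conn f u (run f cs u).
Proof. by exists [seq c <- cs | c.+2 < size u]; rewrite ?run_filter // filter_all. Qed.

Lemma conn_refl f u : conn f u u.
Proof. exact: (conn_run f [::]). Qed.

Lemma conn_trans f u v w : conn f u v -> conn f v w -> conn f u w.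
Proof. by case=> cs _ -> [cs' _ ->]; rewrite -run_cat; apply: conn_run. Qed.

Lemma conn_mv f j u : conn f u (mv f j u).
Proof. exact: (conn_run f [:: j]). Qed.

Lemma conn_size f u w : conn f u w -> size w = size u.
Proof. by case=> cs _ ->; rewrite size_run. Qed.

Lemma conn_catl f u w t : conn f u w -> conn f (u ++ t) (w ++ t).
Proof. by case=> cs h ->; rewrite -run_catl //; apply: conn_run. Qed.

(** * Yamanouchi words *)

(* The effect of d_i on the rows of the entries i-1, i, i+1 of a tableau. *)
Definition trid (p q r : nat) : nat * nat * nat :=
  if minn q r <= p < maxn q r then (p, r, q)
  else if minn p q < r <= maxn p q then (q, p, r) else (p, q, r).

Notation sgd := (sigw geq).

Lemma trid_last p q r : (r <= p < q) || (q <= p < r) -> trid p q r = (p, r, q).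
Proof. by rewrite /trid => h; rewrite ifT //; lia. Qed.

Lemma trid_first p q r : (q < r <= p) || (p < r <= q) -> trid p q r = (q, p, r).
Proof. by rewrite /trid => h; rewrite ifF ?ifT //; lia. Qed.

Lemma tridK p q r : trid (trid p q r).1.1 (trid p q r).1.2 (trid p q r).2 = (p, q, r).
Proof.
rewrite [trid p q r]/trid; repeat (case: ifP => ? /=); rewrite /trid;
  by repeat (case: ifP => ? /=); try (exfalso; lia).
Qed.

Lemma mvdK j y : mv trid j (mv trid j y) = y.
Proof.
elim: y j => [|x u IH] [|j] //=; last by rewrite IH.
by case: u {IH} => [|y [|z t]] //=; rewrite tridK.
Qed.

Lemma perm_trid a b c : perm_eq [:: (trid a b c).1.1; (trid a b c).1.2; (trid a b c).2] [:: a; b; c].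
Proof. by rewrite /trid; do 2?case: ifP => _ //=; apply/permP => P /=; lia. Qed.

Lemma perm_mvd j u : perm_eq (mv trid j u) u.
Proof.
elim: u j => [|x u IH] [|j] //=; last by rewrite perm_cons.
case: u {IH} => [|y [|z t]] //.
rewrite -[[:: _, _, _ & t]]/([:: _; _; _] ++ t) -[[:: x, y, z & t]]/([:: x; y; z] ++ t).
by rewrite perm_cat2r perm_trid.
Qed.

Lemma perm_rund cs u : perm_eq (run trid cs u) u.
Proof.
elim/last_ind: cs => // cs c IH; rewrite run_rcons.
exact: perm_trans (perm_mvd _ _) IH.
Qed.

(** * Contents and corners of Yamanouchi words *)

Definition cnt (y : seq nat) (r : nat) : nat := count_mem r y.

Lemma cnt_nil r : cnt [::] r = 0. Proof. by []. Qed.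
Lemma cnt_cons x y r : cnt (x :: y) r = (x == r) + cnt y r. Proof. by []. Qed.
Lemma cnt_cat y z r : cnt (y ++ z) r = cnt y r + cnt z r. Proof. exact: count_cat. Qed.
Lemma cnt_rcons y x r : cnt (rcons y x) r = cnt y r + (x == r).
Proof. by rewrite -cats1 cnt_cat cnt_cons cnt_nil addn0. Qed.
Lemma perm_cnt y z r : perm_eq y z -> cnt y r = cnt z r.
Proof. by move/permP; apply. Qed.
Definition cntE := (cnt_cat, cnt_rcons, cnt_cons, cnt_nil).

Definition antitone (g : nat -> nat) := forall r, g r.+1 <= g r.
Definition yam (y : seq nat) := forall k, antitone (fun r => cnt (take k y) r).
(** Row [r] ends in a removable corner of the shape with row lengths [cnt y]. *)
Definition corner (y : seq nat) (r : nat) := cnt y r.+1 < cnt y r.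

Lemma yam_antitone y : yam y -> antitone (fun r => cnt y r).
Proof. by move=> /(_ (size y)); rewrite take_size. Qed.

Lemma yam_catl y z : yam (y ++ z) -> yam y.
Proof.
move=> H k; case: (leqP k (size y)) => ky; first by have := H k; rewrite takel_cat.
by have := H (size y); rewrite take_size_cat // take_oversize // ltnW.
Qed.

Lemma yam_rcons y r : yam y -> antitone (fun s => cnt (rcons y r) s) -> yam (rcons y r).
Proof.
move=> Hy Hr k; case: (leqP k (size y)) => ky; first by rewrite -cats1 takel_cat.
by rewrite take_oversize // size_rcons.
Qed.

Lemma yam_nil : yam [::].
Proof. by []. Qed.

Lemma yam_rcons_perm y y' r : perm_eq y y' -> yam y' -> yam (rcons y r) -> yam (rcons y' r).
Proof.
move=> e y'y /yam_antitone H; apply: yam_rcons => // s.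
by have := H s; rewrite !cntE !(perm_cnt _ e).
Qed.

Lemma yam_cat_perm y y' t : perm_eq y y' -> yam y' -> yam (y ++ t) -> yam (y' ++ t).
Proof.
elim/last_ind: t => [|t r IH]; rewrite ?cats0 // => e hy'.
rewrite -!rcons_cat => H; apply: yam_rcons_perm (H); first by rewrite perm_cat2r.
by apply: IH => //; move: H; rewrite -cats1; apply: yam_catl.
Qed.

Lemma yam_rcons_inv y r : yam (rcons y r) -> yam y /\ corner (rcons y r) r.
Proof.
move=> H; have Hy : yam y by move: H; rewrite -cats1; apply: yam_catl.
by split=> //; have := yam_antitone Hy r; rewrite /corner !cntE; lia.
Qed.

(** Only an exchange of adjacent rows [s] and [s+1] could break the lattice condition. The half-open
    bounds in [trid] then force the third letter to be an [s] in front of them or an [s+1] behind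
    them, and either leaves enough room in row [s]. *)
Lemma yam_mvd j y : yam y -> yam (mv trid j y).
Proof.
move=> Hy; case: (leqP (size y) j.+2) => [/mv_out -> // | /(@mv_split trid)].
case=> p [a [b [c [t [e _ ->]]]]]; move: Hy; rewrite e => Hy.
have P3 : perm_eq (p ++ [:: (trid a b c).1.1; (trid a b c).1.2; (trid a b c).2]) (p ++ [:: a; b; c]).
  by rewrite perm_cat2l perm_trid.
have H3 : yam (p ++ [:: a; b; c]) by move: Hy; rewrite -[[:: a, b, c & t]]/([:: a; b; c] ++ t) catA => /yam_catl.
suff H : yam (p ++ [:: (trid a b c).1.1; (trid a b c).1.2; (trid a b c).2]).
  have := yam_cat_perm (y := p ++ [:: a; b; c]) (t := t) _ H.
  by rewrite -!catA; apply => //; rewrite perm_sym.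
have H2 : yam (p ++ [:: a; b]).
  by move: H3; rewrite -[[:: a; b; c]]/([:: a; b] ++ [:: c]) catA => /yam_catl.
have H1 : yam (p ++ [:: a]).
  by move: H2; rewrite -[[:: a; b]]/([:: a] ++ [:: b]) catA => /yam_catl.
have H0 := yam_catl H1.
have A0 := yam_antitone H0; have A1 := yam_antitone H1.
have A2 := yam_antitone H2; have A3 := yam_antitone H3.
rewrite -[[:: _; _; (trid _ _ _).2]]/([:: _; _] ++ [:: _]) catA cats1.
apply: yam_rcons; last first.
  move=> r; have := A3 r; rewrite -cats1 -catA /=.
  by rewrite !(perm_cnt _ P3).
rewrite -[[:: _; _]]/([:: _] ++ [:: _]) catA cats1.
apply: yam_rcons; first (rewrite cats1; apply: yam_rcons => // r);
  try move=> r; move: (A0 r) (A1 r) (A2 r) (A3 r);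
  rewrite !cntE /trid; do 2?case: ifP; move=> /=; lia.
Qed.

(** The witness [e] is the last row that is as long as row [X]. *)
Lemma corner_between g X Y : antitone g -> X < Y -> g Y < g X ->
  exists e, [/\ X <= e < Y, g e = g X & g e.+1 < g e].
Proof.
move=> ag; move: {2}(Y - X) (leqnn (Y - X)) => n; elim: n X => [|n IH] X; first lia.
move=> XYn XY gYX; have := ag X; rewrite leq_eqVlt => /orP[/eqP e|lt]; last first.
  by exists X; split; rewrite ?leqnn.
have XY1 : X.+1 < Y by rewrite ltn_neqAle XY andbT; apply/eqP => e'; move: gYX; rewrite -e' e ltnn.
have [||z [h1 h2 h3]] := IH X.+1 _ XY1; [lia | by rewrite e|].
by exists z; split; rewrite ?h2 -?e //; lia.
Qed.

(** If the last letter [s] is not [r], then [r] is already a corner of the prefix. By induction the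
    prefix can be rearranged to end in [r], and this [r] can be moved behind [s]. *)
Lemma corner_last y r : yam y -> corner y r ->
  exists2 y1, yam (rcons y1 r) & perm_eq y (rcons y1 r).
Proof.
elim/last_ind: y r => [|y s IH] r Hy; first by rewrite /corner.
have [Hy0 _] := yam_rcons_inv Hy; have As := yam_antitone Hy.
case: (eqVneq s r) => [<- _|sr]; first by exists y.
rewrite /corner !cntE => cr.
have cy : corner y r by rewrite /corner; lia.
have [y1 H1 P1] := IH r Hy0 cy.
have [H2 _] := yam_rcons_inv H1; have A1 := yam_antitone H2.
exists (rcons y1 s); last first.
  by rewrite -!cats1 (perm_trans (perm_cat P1 (perm_refl _))) // -cats1 perm_catAC.
have As' q : cnt (rcons (rcons y1 r) s) q.+1 <= cnt (rcons (rcons y1 r) s) q.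
  by have := As q; rewrite !cntE !(perm_cnt _ P1) !cntE.
have cr' : cnt (rcons (rcons y1 r) s) r.+1 < cnt (rcons (rcons y1 r) s) r.
  by move: cr; rewrite !cntE !(perm_cnt _ P1) !cntE.
have Y1s : yam (rcons y1 s).
  apply: yam_rcons => // q; move: (As' q) (A1 q) cr'; rewrite !cntE.
  by case: (eqVneq r q) => [<-|] _; lia.
by apply: yam_rcons => // q; have := As' q; rewrite !cntE; lia.
Qed.

Lemma corner_rcons_neq y r s : r != s -> corner (rcons y s) r -> corner y r.
Proof. by rewrite /corner !cntE; lia. Qed.

Lemma antitone_le g i j : antitone g -> i <= j -> g j <= g i.
Proof.
move=> ag /subnKC <-; elim: (j - i) => [|k IH]; first by rewrite addn0.
by rewrite addnS; apply: leq_trans IH; apply: ag.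
Qed.

Lemma corner_lt y r s : yam y -> corner y r -> r < s -> cnt y s < cnt y r.
Proof. by move=> /yam_antitone ay cr rs; apply: leq_ltn_trans (antitone_le ay rs) cr. Qed.

Lemma corner_perm y z r : perm_eq y z -> corner y r = corner z r.
Proof. by move=> e; rewrite /corner !(perm_cnt _ e). Qed.

Lemma yam_peel y e t : yam (y ++ t) -> corner y e ->
  exists z, [/\ yam (z ++ e :: t), yam z, perm_eq y (rcons z e)
    & perm_eq (y ++ t) (z ++ e :: t)].
Proof.
move=> H ce; have [z Hz P] := corner_last (yam_catl H) ce.
have [Hz' _] := yam_rcons_inv Hz.
exists z; split=> //; last by rewrite -cat_rcons perm_cat2r.
by rewrite -cat_rcons; apply: yam_cat_perm P Hz H.
Qed.

(** With both corners removed, row [s] is still shorter than row [r], so a corner [e] lies between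
    them. It is the witness that allows a dual equivalence move to exchange [r] and [s] at the end
    of the word. *)
Lemma yam_two y r s : yam y -> corner y r -> corner y s -> r < s ->
  exists w e, [/\ r <= e < s, yam (w ++ [:: e; s; r]) & perm_eq y (w ++ [:: e; s; r])].
Proof.
move=> Hy cr cs rs; have lrs := corner_lt Hy cr rs.
have [esr ers] : (s == r) = false /\ (r == s) = false by rewrite gtn_eqF // ltn_eqF.
rewrite -{1}[y]cats0 in Hy.
have [y1 [H1 Hy1 P1 Q1]] := yam_peel Hy cr.
have cs1 : corner y1 s.
  by apply: (@corner_rcons_neq _ s r); rewrite ?neq_ltn ?rs ?orbT // -(corner_perm _ P1).
have [y2 [H2 Hy2 P2 Q2]] := yam_peel H1 cs1.
have A2 := yam_antitone Hy2.
have eqc q : cnt y q = cnt y2 q + (s == q) + (r == q).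
  by rewrite (perm_cnt _ P1) cnt_rcons (perm_cnt _ P2) cnt_rcons.
have lt : cnt y2 s < cnt y2 r.
  by move: lrs; rewrite !eqc !eqxx ers esr !addn0 !addn1 ltnS.
have [e [res _ ce]] := corner_between A2 rs lt.
have [w [Hw _ _ Q3]] := yam_peel H2 ce.
exists w, e; split=> //; rewrite -[y]cats0.
exact: perm_trans Q1 (perm_trans Q2 Q3).
Qed.

Lemma yam_two_sym y r r' : yam y -> corner y r -> corner y r' -> r != r' ->
  exists w e, [/\ minn r r' <= e < maxn r r', yam (w ++ [:: e; r'; r])
    & perm_eq y (w ++ [:: e; r'; r])].
Proof.
move=> Hy cr cr'; case: ltngtP => // lt _.
  by have [w [e [? ? ?]]] := yam_two Hy cr cr' lt; exists w, e; split.
have [w [e [h1 h2 h3]]] := yam_two Hy cr' cr lt; exists w, e; split=> //.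
  by have := yam_mvd (size w + 0) h2; rewrite mv_catr /= trid_last ?h1 ?orbT.
by apply: perm_trans h3 _; rewrite perm_cat2l; apply/permP => q /=; clear; lia.
Qed.

(** The rows [f], [h2], [h1] are what [trid] needs in order to exchange the three corners with each
    other; these six letters are the ones on which [loop] acts. *)
Lemma yam_three y r s t : yam y -> corner y r -> corner y s -> corner y t -> r < s < t ->
  exists w h1 h2 f, [/\ [&& r <= h2 < s, s <= f < t & h2 <= h1 < f],
    yam (w ++ [:: h1; h2; f; s; t; r]) & perm_eq y (w ++ [:: h1; h2; f; s; t; r])].
Proof.
move=> Hy cr cs ct /andP[rs st]; have rt := ltn_trans rs st.
have lrs := corner_lt Hy cr rs; have lst := corner_lt Hy cs st; have Ay := yam_antitone Hy.
have [[esr ers] [est ets] [ert etr]] : [/\ (s == r) = false /\ (r == s) = false,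
    (s == t) = false /\ (t == s) = false & (r == t) = false /\ (t == r) = false].
  by rewrite !(ltn_eqF rs, ltn_eqF st, ltn_eqF rt) !(gtn_eqF rs, gtn_eqF st, gtn_eqF rt).
rewrite -{1}[y]cats0 in Hy.
have [y1 [H1 Hy1 P1 Q1]] := yam_peel Hy cr.
have ct1 : corner y1 t.
  by apply: (@corner_rcons_neq _ t r); rewrite ?neq_ltn ?(ltn_trans rs) ?orbT // -(corner_perm _ P1).
have cs1 : corner y1 s.
  by apply: (@corner_rcons_neq _ s r); rewrite ?neq_ltn ?rs ?orbT // -(corner_perm _ P1).
have [y2 [H2 Hy2 P2 Q2]] := yam_peel H1 ct1.
have cs2 : corner y2 s.
  by apply: (@corner_rcons_neq _ s t); rewrite ?neq_ltn ?st // -(corner_perm _ P2).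
have [y3 [H3 Hy3 P3 Q3]] := yam_peel H2 cs2.
have A3 := yam_antitone Hy3.
have eqc q : cnt y q = cnt y3 q + (s == q) + (t == q) + (r == q).
  by rewrite (perm_cnt _ P1) cnt_rcons (perm_cnt _ P2) cnt_rcons (perm_cnt _ P3) cnt_rcons.
have l1 : cnt y3 t < cnt y3 s.
  by move: lst; rewrite !eqc !eqxx est ets ert ers !addn0 !addn1 ltnS.
have [f [sft _ cf]] := corner_between A3 st l1.
have [y4 [H4 Hy4 P4 Q4]] := yam_peel H3 cf.
have A4 := yam_antitone Hy4.
have eq4 q : cnt y3 q = cnt y4 q + (f == q) by rewrite (perm_cnt _ P4) cnt_rcons.
have l2 : cnt y4 s < cnt y4 r.
  have fr : (f == r) = false by apply: gtn_eqF; apply: leq_trans rs _; case/andP: sft.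
  move: lrs; rewrite !eqc !eq4 !eqxx esr ers etr ets fr !addn0 !addn1 ltnS.
  by apply: leq_ltn_trans; apply: leq_addr.
have [h2 [rhs eh ch]] := corner_between A4 rs l2.
have [y5 [H5 Hy5 P5 Q5]] := yam_peel H4 ch.
have A5 := yam_antitone Hy5.
have eq5 q : cnt y4 q = cnt y5 q + (h2 == q) by rewrite (perm_cnt _ P5) cnt_rcons.
have hf : h2 < f by case/andP: sft => sf _; apply: leq_trans sf; case/andP: rhs.
(* Row [h2] now has length [cnt y r - 2], while row [f] has length at most [cnt y s - 2], whether or
   not [f] is [s]. *)
have l3 : cnt y5 f < cnt y5 h2.
  have [rf ft] : r < f /\ f < t by case/andP: sft => sf ->; split=> //; apply: leq_trans sf.
  have e1 := eq5 f; have e2 := eq5 h2; have e3 := eq4 f; have e4 := eq4 r.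
  have e5 := eqc f; have e6 := eqc r.
  rewrite (ltn_eqF hf) addn0 in e1; rewrite eqxx addn1 in e2.
  rewrite eqxx addn1 in e3; rewrite (gtn_eqF rf) addn0 in e4.
  rewrite (gtn_eqF ft) (ltn_eqF rf) !addn0 in e5; rewrite eqxx esr etr !addn0 addn1 in e6.
  have sf : cnt y f <= cnt y s - (s != f).
    case: (eqVneq s f) => [->|fs]; first by rewrite subn0.
    have sf : s < f by rewrite ltn_neqAle fs; case/andP: sft.
    by have := antitone_le Ay sf; move: cs; rewrite /corner; clear; lia.
  have cs0 : 0 < cnt y s by apply: leq_ltn_trans cs.
  by move: e1 e2 e3 e4 e5 e6 eh lrs sf cs0; case: (eqVneq s f) => _; clear; lia.
have [h1 [hhf _ ch1]] := corner_between A5 hf l3.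
have [w [Hw _ _ Q6]] := yam_peel H5 ch1.
exists w, h1, h2, f; split=> //; first by rewrite rhs sft.
rewrite -[y]cats0; apply: perm_trans Q1 _; apply: perm_trans Q2 _.
apply: perm_trans Q3 _; apply: perm_trans Q4 _; exact: perm_trans Q5 _.
Qed.

(** If the last letters [r] and [r'] differ, the walk passes through words ending in [e, r', r] and
    [e, r, r'], which the top move exchanges. Everything else happens in prefixes, so the top move
    is used at most once; this bound becomes (Ax6). *)
Lemma conn_yam y y' : yam y -> yam y' -> perm_eq y y' ->
  exists2 cs, all (fun c => c.+2 < size y) cs && (count_mem (size y - 3) cs <= 1)
            & y' = run trid cs y.
Proof.
move: {2}(size y) (erefl (size y)) => n; elim: n y y' => [|n IH] y y' sy Hy Hy' P.
  by exists [::]; move/size0nil: sy P => -> // /perm_size /esym /size0nil.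
have sy' : size y' = n.+1 by rewrite -(perm_size P).
case/lastP: y sy Hy P => [//|z r]; rewrite size_rcons => -[sz] Hy P.
case/lastP: y' sy' Hy' P => [//|z' r']; rewrite size_rcons => -[sz'] Hy' P.
have [Hz cr] := yam_rcons_inv Hy; have [Hz' cr'] := yam_rcons_inv Hy'.
have IH' (u v : seq nat) t : size u = n -> yam u -> yam v -> perm_eq u v ->
    exists2 cs, all (fun c => c.+2 < (size z).+1) cs && (count_mem ((size z).+1 - 3) cs == 0)
              & v ++ t = run trid cs (u ++ t).
  move=> su Hu Hv Q; have [cs /andP[h _] ->] := IH u v su Hu Hv Q.
  exists cs; last by rewrite run_catl.
  apply/andP; split; first by apply: sub_all h => c; rewrite sz su => h; apply: ltn_trans h _.
  by apply/eqP/count_memPn/negP => /(allP h); rewrite sz su; clear; lia.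
case: (eqVneq r r') => [e|rr'].
  move: P; rewrite -e -!cats1 perm_cat2r => P.
  have [cs /andP[h /eqP h0] E] := IH' z z' [:: r] sz Hz Hz' P.
  by exists cs; rewrite ?size_rcons ?h ?h0 // -!cats1.
have c1 : corner (rcons z r) r' by rewrite (corner_perm _ P).
have [w [e [ree Hw Pw]]] := yam_two_sym Hy cr c1 rr'.
have step : mv trid (size w) (w ++ [:: e; r'; r]) = w ++ [:: e; r; r'].
  by rewrite -{1}[size w]addn0 mv_catr /= /trid minnC maxnC ree.
have Hw' : yam (w ++ [:: e; r; r']) by rewrite -step; apply: yam_mvd.
have Pw' : perm_eq (w ++ [:: e; r'; r]) (w ++ [:: e; r; r']).
  by rewrite perm_cat2l; apply/permP => q /=; clear; lia.
have E3 a x : w ++ [:: e; a; x] = (w ++ [:: e; a]) ++ [:: x] by rewrite -catA.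
have sw : (size w).+2 = n by have := perm_size Pw; rewrite size_rcons size_cat sz /=; lia.
have swe a : size (w ++ [:: e; a]) = n by rewrite size_cat addn2.
have P2 : perm_eq (w ++ [:: e; r]) z'.
  rewrite -(perm_cat2r [:: r']) -E3 !cats1 perm_sym -(permPl P).
  by apply: perm_trans Pw Pw'.
move: Pw Hw; rewrite E3 -cats1 perm_cat2r => Pw /yam_catl Hw.
have [cs1 /andP[h1 /eqP h10] e1] := IH' _ _ [:: r] sz Hz Hw Pw.
move: Hw'; rewrite E3 => /yam_catl Hw2.
have [cs2 /andP[h2 /eqP h20] e2] := IH' _ _ [:: r'] (swe _) Hw2 Hz' P2.
exists (cs1 ++ size w :: cs2); last first.
  by rewrite run_cat -cats1 -e1 /= -E3 step E3 -e2 cats1.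
move: h10 h20; rewrite all_cat /= h1 h2 count_cat /= => -> ->.
by rewrite sz sw ltnSn; clear; lia.
Qed.

(** * From words of content ranks to Yamanouchi words *)

Section Insertion.
Variables (T : pred nat) (V : seq nat -> Prop).
Notation mD := (mv (triD T)).
Notation md := (mv trid).
Notation rD := (run (triD T)).
Notation rd := (run trid).
Notation connD := (conn (triD T)).

(** [V] will be the set of prefixes of words of fillings ([valid]). These three closure properties
    are all that the induction knows about fillings. *)
Hypothesis V_cat : forall u t, V (u ++ t) -> V u.
Hypothesis V_mv : forall j u, V u -> V (mD j u).
Hypothesis V_ok : forall u, V u -> ok u.

Lemma V_run cs u : V u -> V (rD cs u).
Proof. by elim: cs u => //= c cs IH u /(V_mv c) /IH. Qed.

Lemma V_good p l : V (p ++ l) -> good T l.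
Proof.
move=> H cs; have := V_run (map (addn (size p)) cs) H.
by rewrite run_catr => /V_ok /ok_cat /andP[].
Qed.

Lemma V_conn u w : V u -> connD u w -> V w.
Proof. by move=> Hu [cs _ ->]; apply: V_run. Qed.

Lemma conn_sym u w : V u -> connD u w -> connD w u.
Proof.
move=> Hu [cs _ ->]; suff e : rD (rev cs) (rD cs u) = u by rewrite -[X in conn _ _ X]e; apply: conn_run.
elim: cs u Hu => //= c cs IH u Hu.
by rewrite rev_cons run_rcons IH ?mvDK //; [apply: V_ok|apply: V_mv].
Qed.

(** Restricting to [e < size u] loses nothing, since the rows in a Yamanouchi word are smaller than
    its length ([yam_bound]). *)
Definition new_row (ph : seq nat -> seq nat) (u : seq nat) (c : nat) : nat :=
  \max_(e < size u | boolp.asbool (exists w, [/\ connD u w, last 0 (ph w) = e & c <= last 0 w])) e.+1.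

(** The recursion is on the length and not on the word, because [new_row] evaluates the map at all
    words of the component of the prefix. *)
Fixpoint phin (n : nat) (u : seq nat) : seq nat :=
  if n is n'.+1 then
    let u' := take n' u in rcons (phin n' u') (new_row (phin n') u' (nth 0 u n'))
  else [::].

Definition phi u := phin (size u) u.

Lemma phi_rcons u c : phi (rcons u c) = rcons (phi u) (new_row phi u c).
Proof.
rewrite /phi size_rcons /= -[rcons u c]cats1 take_size_cat // nth_cat ltnn subnn /=; congr (rcons _ _).
apply: eq_bigl => e; apply: boolp.asbool_equiv_eq; split=> -[w [h1 h2 h3]]; exists w; split=> //.
  by move: h2; rewrite (conn_size h1).
by move: h2; rewrite (conn_size h1).
Qed.

Lemma size_phi u : size (phi u) = size u.
Proof. by elim/last_ind: u => // u c IH; rewrite phi_rcons !size_rcons IH. Qed.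

Lemma phi_take x l : take (size x) (phi (x ++ l)) = phi x.
Proof.
elim/last_ind: l => [|l c IH]; first by rewrite cats0 -size_phi take_size.
by rewrite -rcons_cat phi_rcons -cats1 takel_cat // size_phi size_cat leq_addr.
Qed.

Definition inv (n : nat) := forall u, V u -> size u = n ->
  [/\ yam (phi u), sgl u = sgd (phi u), forall j, phi (mD j u) = md j (phi u)
    & forall w, connD u w -> phi w = phi u -> w = u].

Lemma yam_bound y r : yam y -> r \in y -> r < size y.
Proof.
elim/last_ind: y r => // y s IH r Hy; have [Hy0 _] := yam_rcons_inv Hy.
rewrite mem_rcons inE size_rcons => /orP[/eqP ->|ry]; last exact: leqW (IH _ Hy0 ry).
case: s Hy => // s Hy; rewrite ltnS; apply: IH => //.
have := yam_antitone Hy s; rewrite !cntE eqxx (gtn_eqF (ltnSn s)) addn0 addn1 => h.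
by rewrite -has_pred1 has_count; apply: leq_ltn_trans h.
Qed.

Lemma corner_bound y r : yam y -> corner y r -> r < size y.
Proof.
move=> Hy cr; apply: yam_bound Hy _; rewrite -has_pred1 has_count.
by apply: leq_ltn_trans cr.
Qed.

Lemma yam_addable y r : yam (rcons y r) -> 0 < r -> corner y r.-1.
Proof.
case: r => // r /yam_antitone /(_ r); rewrite /corner !cntE eqxx (gtn_eqF (ltnSn r)).
by rewrite addn0 addn1.
Qed.

(** * The induction step: words with one more letter *)

Section Step.
Variable n : nat.
Hypothesis IH : forall m, m <= n -> inv m.

Lemma phi_run_le u cs : V u -> size u <= n -> phi (rD cs u) = rd cs (phi u).
Proof.
elim: cs u => //= c cs IHc u Hu su; have [_ _ e _] := IH su Hu erefl.
by rewrite IHc ?size_mv ?e //; apply: V_mv.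
Qed.

Lemma perm_conn u w : V u -> size u <= n -> connD u w -> perm_eq (phi u) (phi w).
Proof. by move=> Hu su [cs _ ->]; rewrite phi_run_le // perm_sym perm_rund. Qed.

Lemma conn_to u y : V u -> size u <= n -> yam y -> perm_eq (phi u) y ->
  exists2 cs, all (fun c => c.+2 < size u) cs & phi (rD cs u) = y.
Proof.
move=> Hu su Hy P; have [Yu _ _ _] := IH su Hu erefl.
have [cs /andP[h _] e] := conn_yam Yu Hy P; rewrite size_phi in h.
by exists cs; rewrite ?phi_run_le.
Qed.

(** The images of [w] and [w'] are Yamanouchi words of the same content, so moves carry one to the
    other. These moves leave the appended letter alone, and injectivity for the longer words
    identifies the result with [rcons w' a']. *)
Lemma same_piece w w' a a' : V (rcons w a) -> size w < n ->
  connD (rcons w a) (rcons w' a') -> last 0 (phi (rcons w a)) = last 0 (phi (rcons w' a')) ->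
  a = a' /\ connD w w'.
Proof.
move=> Vw sw cw l.
have Vw0 : V w by move: Vw; rewrite -cats1; apply: V_cat.
have sw1 : size (rcons w a) <= n by rewrite size_rcons.
have [Y1 _ _ U1] := IH sw1 Vw erefl.
have Vw' := V_conn Vw cw.
have sw' : size (rcons w' a') <= n by rewrite (conn_size cw).
have [Y2 _ _ _] := IH sw' Vw' erefl.
have P := perm_conn Vw sw1 cw.
move: l P Y2; rewrite !phi_rcons !last_rcons => l.
rewrite l -!cats1 perm_cat2r => P /yam_catl Y2.
have [cs h e] := conn_to Vw0 (ltnW sw) Y2 P.
have E : rD cs (rcons w a) = rcons (rD cs w) a by rewrite -!cats1 run_catl.
have : phi (rD cs (rcons w a)) = phi (rcons w' a').
  rewrite phi_run_le // !phi_rcons l -!cats1 run_catl ?size_phi // -phi_run_le ?e //.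
  exact: ltnW.
move=> Eq.
have [_ _ _ U2] := IH sw' Vw' erefl.
have : rD cs (rcons w a) = rcons w' a'.
  apply: U2 => //; apply: conn_trans (conn_sym Vw cw) (conn_run _ _ _).
rewrite E => /rcons_inj[e1 e2]; split=> //; rewrite -e1; exact: conn_run.
Qed.

Lemma new_row_conn u w c : V u -> connD u w -> new_row phi u c = new_row phi w c.
Proof.
move=> Hu uw; have wu := conn_sym Hu uw; rewrite /new_row (conn_size uw).
apply: eq_bigl => e; apply: boolp.asbool_equiv_eq; split=> -[v [h1 h2 h3]]; exists v; split=> //.
  exact: conn_trans h1.
exact: conn_trans h1.
Qed.

Lemma new_row_case u c : new_row phi u c = 0 \/ 0 < size u /\
  exists w e, [/\ connD u w, last 0 (phi w) = e, c <= last 0 w & new_row phi u c = e.+1].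
Proof.
rewrite /new_row; apply: (big_ind (fun m => m = 0 \/ 0 < size u /\
  exists w e, [/\ connD u w, last 0 (phi w) = e, c <= last 0 w & m = e.+1])); first by left.
  by move=> x y hx hy; rewrite /maxn; case: ifP.
move=> i /boolp.asboolP [w [h1 h2 h3]]; right; split; first by case: i {h2} => i; apply: leq_trans.
by exists w, i; split.
Qed.

Lemma last_corner u : V u -> 0 < size u <= n -> corner (phi u) (last 0 (phi u)).
Proof.
move=> Hu /andP[]; case/lastP: u Hu => // u a Hu _ su; have [Y _ _ _] := IH su Hu erefl.
by move: Y; rewrite phi_rcons last_rcons => /yam_rcons_inv[].
Qed.

Lemma V_conn_cat u w t : V (u ++ t) -> connD u w -> V (w ++ t).
Proof. by move=> H /(conn_catl t) /(V_conn H). Qed.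

Lemma split_suffix k (u : seq nat) : k <= size u ->
  exists p l, [/\ u = p ++ l, size l = k & size p = size u - k].
Proof.
move=> ku; exists (take (size u - k) u), (drop (size u - k) u).
by rewrite cat_take_drop size_drop size_takel ?leq_subr // subKn.
Qed.

Lemma sig_suffix p l y m : V (p ++ l) -> size (p ++ l) <= n -> phi (p ++ l) = y ++ m ->
  size p = size y -> sgl l = sgd m.
Proof.
move=> H s e sp; have [_ S _ _] := IH s H erefl.
by move: S; rewrite e; apply: sigw_suffix.
Qed.

Lemma suffix_run cs p l y m : V (p ++ l) -> size (p ++ l) <= n -> phi (p ++ l) = y ++ m ->
  size p = size y -> phi (p ++ rD cs l) = y ++ rd cs m /\ sgl (rD cs l) = sgd (rd cs m).
Proof.
move=> H s e sp.
have E : phi (p ++ rD cs l) = y ++ rd cs m by rewrite -run_catr phi_run_le // e sp run_catr.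
split=> //; apply: sig_suffix E sp; first by rewrite -run_catr; apply: V_run.
by rewrite size_cat size_run -size_cat.
Qed.

(** Equal last rows are excluded because they force equal last letters. In the opposite order
    [e < e'], the component of [u] contains a word with image ending in [g, e', e]; its last move
    brings [e'] to the end, and with [c] appended neither end of this move would admit the next
    color, against [edge_fact]. *)
Lemma new_row_lt u c w w' : V (rcons u c) -> size u <= n -> connD u w -> connD u w' ->
  0 < size u -> last 0 w < c -> c <= last 0 w' -> last 0 (phi w') < last 0 (phi w).
Proof.
move=> Vuc su uw uw' u0 wc cw'.
have Vu : V u by move: Vuc; rewrite -cats1; apply: V_cat.
have su0 : 0 < size u <= n by rewrite u0.
have piece v v' : connD u v -> connD u v' -> last 0 (phi v) = last 0 (phi v') -> last 0 v = last 0 v'.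
  move=> uv uv'; have Vv := V_conn Vu uv; have vv' := conn_trans (conn_sym Vu uv) uv'.
  have sv := conn_size uv; have sv' := conn_size uv'.
  case/lastP: v uv vv' sv Vv => [|v a] uv vv' sv Vv; first by rewrite -sv in u0.
  case/lastP: v' uv' vv' sv' => [|v' a'] uv' vv' sv'; first by rewrite -sv' in u0.
  have svn : size v < n by move: su; rewrite -sv size_rcons.
  by move=> /(same_piece Vv svn vv')[-> _]; rewrite !last_rcons.
have Vw := V_conn Vu uw; have Vw' := V_conn Vu uw'.
case: ltngtP => // [lt|e]; last by move: wc; rewrite (piece _ _ uw uw' (esym e)) ltnNge cw'.
set e := last 0 (phi w) in lt *; set e' := last 0 (phi w') in lt *.
have ce : corner (phi u) e.
  by rewrite (corner_perm _ (perm_conn Vu su uw)); apply: last_corner; rewrite ?(conn_size uw).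
have ce' : corner (phi u) e'.
  by rewrite (corner_perm _ (perm_conn Vu su uw')); apply: last_corner; rewrite ?(conn_size uw').
have [Yu _ _ _] := IH su Vu erefl.
have [z [g [eg Hz Pz]]] := yam_two Yu ce ce' lt.
have [cs csz ev] := conn_to Vu su Hz Pz.
set v := rD cs u in ev; have uv : connD u v by exact: conn_run.
have sv : size v = size z + 3 by rewrite -size_phi ev size_cat.
have [p [l [El sl sp]]] := @split_suffix 3 v ltac:(by rewrite sv leq_addl).
case: l El sl => [|l1 [|l2 [|l3 [|]]]] // El _.
have {}sp : size p = size z by rewrite sp sv addnK.
have Vvc : V (p ++ [:: l1; l2; l3; c]).
  have : V (v ++ [:: c]) by apply: V_conn_cat uv; rewrite cats1.
  by rewrite El -catA.
have gl := V_good Vvc.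
have Vv : V (p ++ [:: l1; l2; l3]) by rewrite -El; apply: V_run.
have sv' : size (p ++ [:: l1; l2; l3]) <= n by rewrite -El (conn_size uv).
rewrite El in ev.
have [_ S] := suffix_run [::] Vv sv' ev sp; have [E' S'] := suffix_run [:: 0] Vv sv' ev sp.
have uv1 : connD u (p ++ mD 0 [:: l1; l2; l3]).
  by apply: conn_trans uv _; rewrite El -mv_catr; apply: conn_mv.
have L3 : l3 < c.
  have <- : last 0 w = l3 by rewrite (piece _ _ uw uv) ?El ?ev ?last_cat.
  exact: wc.
have EE : trid g e' e = (g, e, e') by rewrite /trid minnC maxnC (minn_idPl (ltnW lt)) (maxn_idPr (ltnW lt)) eg.
rewrite /= EE /= in E' S'.
have L3' : c <= last 0 (mD 0 [:: l1; l2; l3]).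
  have <- : last 0 w' = last 0 (mD 0 [:: l1; l2; l3]); last exact: cw'.
  by rewrite (piece _ _ uw' uv1) ?E' ?last_cat.
have := edge_factP gl erefl.
move: S S' L3'; rewrite /= => -[-> ->] [_ ->] L3'.
have ge : g < e' by case/andP: eg.
rewrite L3 [_ < c]ltnNge L3' /geq /= (leqNgt e' g) ge (ltnW lt) (leqNgt e' e) lt /=.
by move=> /(_ isT).
Qed.

(** One direction is the maximality in [new_row]; the other is [new_row_lt] against a word that
    attains the maximum. *)
Lemma new_row_spec u c w : V (rcons u c) -> 0 < size u <= n -> connD u w ->
  (new_row phi u c <= last 0 (phi w)) = (last 0 w < c).
Proof.
move=> Vuc /andP[u0 su] uw; apply/idP/idP => [|wc].
  apply: contraTT; rewrite -leqNgt -ltnNge => cw.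
  have Vu : V u by move: Vuc; rewrite -cats1; apply: V_cat.
  have Vw := V_conn Vu uw.
  have b : last 0 (phi w) < size u.
    have sw := conn_size uw; have [Y _ _ _] := IH (leq_trans (eq_leq sw) su) Vw erefl.
    by rewrite -sw -size_phi; apply: (corner_bound Y); apply: last_corner; rewrite ?sw ?u0.
  rewrite /new_row; apply: (@leq_bigmax_cond _ _ (fun e : 'I_(size u) => e.+1) (Ordinal b)).
  by apply/boolp.asboolP; exists w; split.
have [-> //|[_ [w' [e [h1 <- h3 ->]]]]] := new_row_case u c.
exact: (new_row_lt Vuc).
Qed.

(** The row below the new cell is the last row of some tableau of the same shape, hence ends in a
    removable corner, so the new cell is addable. *)
Lemma yam_new_row u c : V (rcons u c) -> size u <= n -> yam (phi (rcons u c)).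
Proof.
move=> Vuc su; have Vu : V u by move: Vuc; rewrite -cats1; apply: V_cat.
have [Y _ _ _] := IH su Vu erefl; have A := yam_antitone Y.
rewrite phi_rcons; apply: yam_rcons => // r; have := A r.
have [->|[u0 [w [e [h1 h2 _ ->]]]]] := new_row_case u c; rewrite !cntE; first by clear; lia.
have : corner (phi u) e.
  rewrite (corner_perm _ (perm_conn Vu su h1)) -h2; apply: last_corner; first exact: V_conn h1.
  by rewrite (conn_size h1) u0.
by rewrite /corner; case: (eqVneq e r) => [->|]; clear; lia.
Qed.

Lemma sig_new_row u c : V (rcons u c) -> size u <= n -> sgl (rcons u c) = sgd (phi (rcons u c)).
Proof.
case/lastP: u => [|u a] // Vuc su; have Vu : V (rcons u a) by move: Vuc; rewrite -cats1; apply: V_cat.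
have [_ S _ _] := IH su Vu erefl.
have := new_row_spec Vuc (w := rcons u a); rewrite size_rcons in su *.
move=> /(_ su (conn_refl _ _)); rewrite sigw_rcons2 S [phi (rcons (rcons u a) c)]phi_rcons [phi (rcons u a)]phi_rcons.
by rewrite sigw_rcons2 /= !last_rcons => ->.
Qed.

Lemma phi_mv_low u j : V u -> size u <= n.+1 -> j.+2 < n -> phi (mD j u) = md j (phi u).
Proof.
move=> Vu; rewrite leq_eqVlt => /orP[/eqP su|su] jn; last by have [_ _ ->] := IH su Vu erefl.
case/lastP: u Vu su => // u c Vuc; rewrite size_rcons => -[su].
have Vu : V u by move: Vuc; rewrite -cats1; apply: V_cat.
have [_ _ e _] := IH (eq_leq su) Vu erefl.
rewrite -cats1 mv_catl ?su // !cats1 !phi_rcons -!cats1 mv_catl ?size_phi ?su // e.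
by rewrite (new_row_conn c Vu (conn_mv _ j _)).
Qed.

Lemma phi_run_low cs u : V u -> size u <= n.+1 -> all (fun c => c.+2 < n) cs ->
  phi (rD cs u) = rd cs (phi u).
Proof.
elim: cs u => //= c cs IHc u Vu su /andP[cn csn].
by rewrite IHc ?size_mv ?phi_mv_low //; apply: V_mv.
Qed.

(* The tableau of a prefix can be replaced by any other one of the same shape. *)
Lemma conn_prefix x y : V x -> size x <= n -> yam y -> perm_eq (phi x) y ->
  exists x', [/\ connD x x', phi x' = y & forall l m, V (x ++ l) -> size (x ++ l) <= n.+1 ->
    phi (x ++ l) = phi x ++ m -> V (x' ++ l) /\ phi (x' ++ l) = y ++ m].
Proof.
move=> Vx sx Hy P; have [cs csx e] := conn_to Vx sx Hy P.
exists (rD cs x); split=> [||l m Vxl sxl e']; rewrite ?e //; first exact: conn_run.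
split; first by rewrite -run_catl //; apply: V_run.
rewrite -run_catl // phi_run_low //; last first.
  by apply: sub_all csx => c h; apply: leq_trans h sx.
by rewrite e' run_catl ?size_phi // -phi_run_le // e.
Qed.

Lemma sig_all u : V u -> size u <= n.+1 -> sgl u = sgd (phi u).
Proof.
case/lastP: u => // u c Vuc; rewrite size_rcons ltnS => su; exact: sig_new_row.
Qed.

Lemma sig_suffix_all p l y m : V (p ++ l) -> size (p ++ l) <= n.+1 -> phi (p ++ l) = y ++ m ->
  size p = size y -> sgl l = sgd m.
Proof. by move=> H s e; have S := sig_all H s; move: S; rewrite e => + sp; apply: sigw_suffix. Qed.

Lemma yam_all u : V u -> size u <= n.+1 -> yam (phi u).
Proof.
case/lastP: u => [|u c]; first by move=> _ _; apply: yam_nil.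
by rewrite size_rcons ltnS => Vuc su; apply: yam_new_row.
Qed.

Lemma suffix_low cs p l y m : V (p ++ l) -> size (p ++ l) <= n.+1 -> phi (p ++ l) = y ++ m ->
  size p = size y -> all (fun c => size p + c.+2 < n) cs ->
  phi (p ++ rD cs l) = y ++ rd cs m /\ sgl (rD cs l) = sgd (rd cs m).
Proof.
move=> H s e sp lo.
have E : phi (p ++ rD cs l) = y ++ rd cs m.
  rewrite -run_catr phi_run_low ?e ?sp ?run_catr //; rewrite -sp all_map.
  by apply: sub_all lo => c /=; rewrite !addnS.
split=> //; apply: sig_suffix_all E sp; first by rewrite -run_catr; apply: V_run.
by rewrite size_cat size_run -size_cat.
Qed.

Lemma yam_mid_corner y a t : yam (y ++ a :: t) -> 0 < a -> corner y a.-1.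
Proof. by rewrite -cat_rcons => /yam_catl; apply: yam_addable. Qed.

(* Two words that differ by the move of the last three letters, and their images: the
   images agree outside their last three letters, which are shown to differ by [trid]. *)
Section Top.
Variables (x y : seq nat) (p q r p' q' r' a b c a' b' c' : nat).
Hypotheses (Vx : V (x ++ [:: p; q; r])) (sx : size x + 3 = n.+1).
Hypotheses (e1 : phi (x ++ [:: p; q; r]) = y ++ [:: a; b; c]).
Hypotheses (e2 : phi (x ++ [:: p'; q'; r']) = y ++ [:: a'; b'; c']).
Hypotheses (mv_pqr : triD T p q r = (p', q', r')) (pq : p < q) (rq : r < q).
Hypothesis sxy : size x = size y.

Let Vx' : V (x ++ [:: p'; q'; r']).
Proof. by have := V_mv (size x + 0) Vx; rewrite mv_catr /= mv_pqr. Qed.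
Let ex : phi x = y.
Proof. by rewrite -(phi_take x [:: p; q; r]) e1 sxy take_size_cat. Qed.
Let Y : yam (y ++ [:: a; b; c]).
Proof. by rewrite -e1; apply: yam_all; rewrite // size_cat sx. Qed.
Let Y' : yam (y ++ [:: a'; b'; c']).
Proof. by rewrite -e2; apply: yam_all; rewrite // size_cat sx. Qed.

Let pqr_neq : [&& p != q, q != r & p != r].
Proof.
have := V_ok Vx; move/ok_cat=> /andP[_] /=; rewrite !inE !negb_or !andbT.
by case/andP=> /andP[-> ->] ->.
Qed.

Lemma top_sig : [/\ b <= a, b < c, a' < b' & c' <= b'].
Proof.
have := sig_suffix_all Vx _ e1 sxy; rewrite size_cat sx => /(_ (leqnn _)) [].
rewrite pq [q < r]ltnNge (ltnW rq) => <- /esym/negbT; rewrite /geq /= -ltnNge => bc.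
have := sig_suffix_all Vx' _ e2 sxy; rewrite size_cat sx => /(_ (leqnn _)) [].
have [_ /(_ pq rq)/andP[qp' ->] _] := triD_flip pqr_neq mv_pqr.
by rewrite [p' < q']ltnNge (ltnW qp') => /esym/negbT; rewrite /geq /= -ltnNge => -> <-.
Qed.

(** Replacing the tableau of the prefix puts any admissible rows [m] in front of the three letters,
    without changing the rows of these letters before and after the move. *)
Lemma top_test z m : yam (z ++ m) -> perm_eq y (z ++ m) -> exists x0 k,
  [/\ size k = size m, size x0 = size z /\ size x0 + size m = size x,
      V (x0 ++ k ++ [:: p; q; r]) /\ V (x0 ++ k ++ [:: p'; q'; r']),
      phi (x0 ++ k ++ [:: p; q; r]) = z ++ m ++ [:: a; b; c]
    & phi (x0 ++ k ++ [:: p'; q'; r']) = z ++ m ++ [:: a'; b'; c']].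
Proof.
move=> Hz P; have Vx0 := V_cat Vx.
have sx0 : size x <= n by move: sx; clear; lia.
rewrite -ex in P; have [x' [h1 h2 h3]] := conn_prefix Vx0 sx0 Hz P.
have [k1 k2] := h3 _ [:: a; b; c] Vx ltac:(by rewrite size_cat sx) ltac:(by rewrite e1 ex).
have [k3 k4] := h3 _ [:: a'; b'; c'] Vx' ltac:(by rewrite size_cat sx) ltac:(by rewrite e2 ex).
have sx' : size x' = size z + size m by rewrite -size_phi h2 size_cat.
have mx : size m <= size x' by rewrite sx' leq_addl.
have [p0 [l [El sl sp]]] := split_suffix mx.
by exists p0, l; rewrite !catA -El; split=> //; rewrite sp sx' addnK // -(conn_size h1) sx'.
Qed.

Lemma top_corner g : corner y g -> exists x0 z l,
  [/\ size x0 = size z /\ size x0 + 1 = size x, V (x0 ++ [:: l; p; q; r]), V (x0 ++ [:: l; p'; q'; r']),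
      phi (x0 ++ [:: l; p; q; r]) = z ++ [:: g; a; b; c]
    & phi (x0 ++ [:: l; p'; q'; r']) = z ++ [:: g; a'; b'; c']].
Proof.
move=> cg; have [z Hz P] := corner_last (yam_catl Y) cg.
rewrite -cats1 in Hz P; have [x0 [k [sk sx0 [k1 k2] k3 k4]]] := top_test Hz P.
by case: k sk k1 k2 k3 k4 => [|l [|]] // _ k1 k2 k3 k4; exists x0, z, l; split.
Qed.

(** The test row [g] is the first of the four rows in [square_fact], whose move 1 is the move under
    study. *)
Lemma top_square g : corner y g ->
  [/\ a <= g -> a' <= g /\ c' <= (trid g a' b').2,
      g < a -> a' <= g -> trid g a b = (g, a', b') /\ c' = c
    & g < a -> g < a' -> (trid g a b).2 < c].
Proof.
move=> cg; have [x0 [z [l [[sx0 sz] V1 V2 f1 f2]]]] := top_corner cg.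
have [ba bc ab' cb'] := top_sig.
have s1 : size (x0 ++ [:: l; p; q; r]) <= n.+1 by rewrite size_cat -sx -sz -addnA.
have s2 : size (x0 ++ [:: l; p'; q'; r']) <= n.+1 by rewrite size_cat -sx -sz -addnA.
have lo : all (fun c => size x0 + c.+2 < n) [:: 0] by rewrite /= andbT; move: sx sz; clear; lia.
have [f3 S3] := suffix_low V1 s1 f1 sx0 lo; have [f4 S4] := suffix_low V2 s2 f2 sx0 lo.
have S1 := sig_suffix_all V1 s1 f1 sx0; have S2 := sig_suffix_all V2 s2 f2 sx0.
have := square_factP (V_good V1) erefl.
have EB : rD [:: 1] [:: l; p; q; r] = [:: l; p'; q'; r'] by rewrite /= mv_pqr.
have -> : rD [:: 1; 0] [:: l; p; q; r] = rD [:: 0] [:: l; p'; q'; r'] by rewrite -EB.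
rewrite EB S1 S2 S3 S4 [sgd [:: g; a; b; c]]/= /geq /= ba (leqNgt c) bc /=.
case: (leqP a g) => ag /=.
  by case/andP=> a'g /eqP[_ _ c'b]; split=> //; rewrite ltnNge ag.
case: (leqP a' g) => a'g; last by move=> /eqP[_ _ /negbT]; rewrite -ltnNge; split.
move=> /eqP e; split=> // _ _; move: f3; rewrite /= e f2 => /eqP.
rewrite eqseq_cat // eqxx /= => /eqP[t1 t2 t3 ->]; split=> //.
by case: (trid g a b) t1 t2 t3 => -[u1 u2] u3 /= <- <- <-.
Qed.

(** In the first part, the moves 0 and 1 carry [e] past [a] and [b], so the last sign compares it
    with [c]. After the move under study, the move 1 acts on [e, a, b'], and the first sign of the
    result tells whether [b' <= e]. The second part is the same with the two words exchanged. *)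
Lemma top_slide z h e : yam (z ++ [:: h; e]) -> perm_eq y (z ++ [:: h; e]) -> a' = a ->
  (a <= h < e -> a < c -> (c <= e) = (b' <= e))
  /\ (e <= h < a -> c' <= a -> (c' <= e) = (b <= e)).
Proof.
move=> Hz P aa'; have [ba bc ab' cb'] := top_sig.
have [x0 [k [sk [sx0 sz] [V1 V2] f1 f2]]] := top_test Hz P.
case: k sk V1 V2 f1 f2 => [|l1 [|l2 [|]]] // _ V1 V2 f1 f2.
rewrite /= in V1 V2 f1 f2.
have s1 : size (x0 ++ [:: l1; l2; p; q; r]) <= n.+1 by rewrite size_cat -sx -sz -addnA.
have s2 : size (x0 ++ [:: l1; l2; p'; q'; r']) <= n.+1 by rewrite size_cat -sx -sz -addnA.
have sx1 : size x0 + 5 = n.+1 by rewrite -sx -sz -addnA.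
have lo : all (fun c => size x0 + c.+2 < n) [:: 0; 1] by rewrite /= andbT; move: sx1; clear; lia.
have lo1 : all (fun c => size x0 + c.+2 < n) [:: 1] by rewrite /= andbT; move: sx1; clear; lia.
have [_ A1] := suffix_low V1 s1 f1 sx0 lo; have [_ A2] := suffix_low V2 s2 f2 sx0 lo.
have [_ B1] := suffix_low V1 s1 f1 sx0 lo1; have [_ B2] := suffix_low V2 s2 f2 sx0 lo1.
have S1 := sig_suffix_all V1 s1 f1 sx0; have S2 := sig_suffix_all V2 s2 f2 sx0.
have E1 : rD [:: 2; 1] [:: l1; l2; p; q; r] = rD [:: 1] [:: l1; l2; p'; q'; r'].
  by rewrite /= mv_pqr.
have E2 : rD [:: 2; 1] [:: l1; l2; p'; q'; r'] = rD [:: 1] [:: l1; l2; p; q; r].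
  have := triDK T pqr_neq; rewrite mv_pqr /= => e'; by rewrite /= e'.
have := slide_factP (V_good V1) erefl; have := slide_factP (V_good V2) erefl.
rewrite E1 E2 S1 S2 A1 A2 B1 B2 aa'.
clear -ba bc ab' cb' aa'; rewrite aa' in ab'.
move=> F2 F1; split.
  move=> /andP[ah he] ac; move: F1 => {F2}.
  have ae : a < e by apply: leq_ltn_trans he.
  have -> : sgd [:: h; e; a; b; c] = [:: false; true; true; false].
    by rewrite /= /geq /= (leqNgt e) he (ltnW ae) ba (leqNgt c) bc.
  move=> /(_ isT).
  have -> : rd [:: 0; 1] [:: h; e; a; b; c] = [:: h; a; b; e; c].
    by rewrite /= trid_last ?ah ?he //= trid_last // ba ae.
  rewrite [nth _ _ 3]/= => ->; rewrite /=; case: (leqP b' e) => eb.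
    by rewrite trid_first /geq /= ?ah // ab' eb ?orbT.
  by rewrite trid_last /geq /= ?(leqNgt e h) ?he // (ltnW ae) eb ?orbT.
move=> /andP[eh ha] ca; move: F2 => {F1}.
have ea : e < a by apply: leq_ltn_trans ha.
have -> : sgd [:: h; e; a; b'; c'] = [:: true; false; false; true].
  by rewrite /= /geq /= eh (leqNgt a) ea (leqNgt b') ab' cb'.
move=> /(_ isT).
have -> : rd [:: 0; 1] [:: h; e; a; b'; c'] = [:: h; a; b'; e; c'].
  by rewrite /= trid_last ?eh ?ha ?orbT //= trid_last // (ltnW ea) ab' ?orbT.
rewrite [nth _ _ 3]/= => ->; rewrite /=; case: (leqP b e) => eb.
  by rewrite trid_last /geq /= ?eh // eb ea.
by rewrite trid_first /geq /= ?(leqNgt a h) ?ha // eb ba ?orbT.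
Qed.

Lemma top_slide_hi e : a' = a -> a < c -> a < e -> corner y e -> (c <= e) = (b' <= e).
Proof.
move=> aa' ac ae ce; have Yy := yam_antitone (yam_catl Y).
have [z1 Hz1 P1] := corner_last (yam_catl Y) ce; have [Hz _] := yam_rcons_inv Hz1.
have e0 : e = e.-1.+1 by rewrite prednK // (leq_ltn_trans _ ae).
have ch : corner z1 e.-1.
  have := Yy e.-1; rewrite /corner -e0 !(perm_cnt _ P1) !cntE eqxx addn1.
  by rewrite gtn_eqF ?addn0 // {2}e0.
rewrite -cats1 in Hz1; have [z [Hz' _ _ P2]] := yam_peel Hz1 ch.
have P : perm_eq y (z ++ [:: e.-1; e]) by apply: perm_trans P1 _; rewrite -cats1.
have [h _] := top_slide Hz' P aa'.
by apply: h => //; rewrite -ltnS -e0 ae leqnn.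
Qed.

(** The summand matters for [a = e.+1]: row [e] then has to give up two cells, one for [e] and one
    for the test row [h = a.-1]. *)
Lemma top_slide_lo e : a' = a -> c' <= a -> e < a -> cnt y e.+1 + (a == e.+1) < cnt y e ->
  (c' <= e) = (b <= e).
Proof.
move=> aa' ca ea ce; have a0 : a = a.-1.+1 by rewrite prednK // (leq_ltn_trans _ ea).
have ca1 := yam_mid_corner Y (leq_ltn_trans (leq0n _) ea).
have ce' : corner y e by apply: leq_ltn_trans ce; apply: leq_addr.
have [z1 Hz1 P1] := corner_last (yam_catl Y) ce'; have [Hz _] := yam_rcons_inv Hz1.
have ch : corner z1 a.-1.
  move: ce ca1; rewrite /corner !(perm_cnt _ P1) a0 /= !cntE; case: (eqVneq e a.-1) => [<-|].
    by clear; lia.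
  by move: ea; rewrite a0 /=; clear; lia.
rewrite -cats1 in Hz1; have [z [Hz' _ _ P2]] := yam_peel Hz1 ch.
have P : perm_eq y (z ++ [:: a.-1; e]) by apply: perm_trans P1 _; rewrite -cats1.
have [_ h] := top_slide Hz' P aa'.
by apply: h => //; rewrite -ltnS -a0 ea leqnn.
Qed.

(** If [a' < a], the corner [a.-1] as a test row in [top_square] determines all three rows; if
    [a' > a], the corner [a'.-1] gives a contradiction. If [a' = a], no test row separates [c] from
    [b'] or [b] from [c']; testing with the row just below the larger of the two gives equality. *)
Lemma top_final : trid a b c = (a', b', c').
Proof.
have [ba bc ab' cb'] := top_sig.
have Y2 : yam (rcons y a ++ [:: b; c]) by rewrite cat_rcons.
have Y3 : yam (rcons (rcons y a) b ++ [:: c]) by rewrite !cat_rcons.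
have Y2' : yam (rcons y a' ++ [:: b'; c']) by rewrite cat_rcons.
have Y3' : yam (rcons (rcons y a') b' ++ [:: c']) by rewrite !cat_rcons.
have K1 := yam_mid_corner Y; have K2 := yam_mid_corner Y2; have K3 := yam_mid_corner Y3.
have K1' := yam_mid_corner Y'; have K2' := yam_mid_corner Y2'; have K3' := yam_mid_corner Y3'.
case: (ltngtP a' a) => aa'.
- have a0 : 0 < a by apply: leq_ltn_trans aa'.
  have [_ + _] := top_square (K1 a0).
  move=> /(_ ltac:(by rewrite prednK) ltac:(by rewrite -ltnS prednK))[].
  case: (leqP b a.-1) => bg; last by rewrite trid_first ?bg ?ba ?orbT // => -[]; clear -a0; lia.
  rewrite trid_last ?bg ?prednK ?leqnn // => -[ea eb] cc.
  move: cb'; rewrite cc -eb => ca.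
  by rewrite -ea trid_first // bc ca.
- have a0 : 0 < a' by apply: leq_ltn_trans aa'.
  have [+ _ _] := top_square (K1' a0).
  by move=> /(_ ltac:(by rewrite -ltnS prednK))[]; rewrite -ltnS prednK // ltnn.
have ac : a < c.
  rewrite ltnNge; apply/negP => ca; have a0 : 0 < a by apply: leq_trans ca; apply: leq_ltn_trans bc.
  have ba1 : b <= a.-1 by rewrite -ltnS prednK //; apply: leq_trans bc ca.
  have [_ _] := top_square (K1 a0); rewrite aa' prednK // => /(_ (leqnn _) (leqnn _)).
  by rewrite trid_last ?ba1 ?prednK ?leqnn //= ltnNge ca.
have ca' : c' <= a.
  rewrite leqNgt; apply/negP => lt; have b0 : 0 < b' by apply: leq_ltn_trans ab'.
  have ab1 : a <= b'.-1 by rewrite -ltnS prednK // -aa'.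
  have cg : corner y b'.-1.
    have := K2' b0; rewrite aa' /corner !cntE prednK //.
    case: (eqVneq a b'.-1) => [e|_]; last by clear; lia.
    have cb2 : c' = b' by apply/eqP; rewrite eqn_leq cb' -[b']prednK // -e.
    have := K3'; rewrite aa' cb2 => /(_ b0); rewrite /corner !cntE prednK // e eqxx -e.
    by move: b0 e lt; rewrite cb2; clear; lia.
  have [/(_ ab1)[_]] := top_square cg; rewrite aa' trid_last ?ab1 ?prednK ?leqnn ?orbT //=.
  by rewrite leqNgt lt.
have Eb : b' = c.
  case: (ltngtP b' c) => // lt.
    have c0 : 0 < c by apply: leq_ltn_trans lt.
    have ac1 : a < c.-1 by rewrite -ltnS prednK // ; apply: leq_ltn_trans lt; rewrite -aa'.
    have ce : corner y c.-1.
      have := K3 c0; rewrite /corner !cntE prednK //.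
      by rewrite (ltn_eqF ac1) (ltn_eqF (leq_ltn_trans ba ac1)) !addn0; clear; lia.
    have := top_slide_hi aa' ac ac1 ce; rewrite -ltnS prednK // ltnn => /esym.
    by rewrite -ltnS prednK // lt.
  have b0 : 0 < b' by apply: leq_ltn_trans lt.
  have ac1 : a < b'.-1 by rewrite -ltnS prednK //; apply: leq_ltn_trans lt.
  have ce : corner y b'.-1.
    have := K2' b0; rewrite /corner !cntE prednK // aa'.
    by rewrite (ltn_eqF ac1) !addn0; clear; lia.
  have := top_slide_hi aa' ac ac1 ce; rewrite -ltnS prednK // lt => /esym.
  by rewrite -ltnS prednK // ltnn.
have Ec : c' = b.
  case: (ltngtP c' b) => // lt.
    have b0 : 0 < b by apply: leq_ltn_trans lt.
    have ba1 : b.-1 < a by rewrite prednK.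
    have ce : cnt y b.-1.+1 + (a == b.-1.+1) < cnt y b.-1.
      by have := K2 b0; rewrite /corner !cntE prednK // (gtn_eqF ba1) addn0.
    have := top_slide_lo aa' ca' ba1 ce; rewrite -ltnS prednK // lt => /esym.
    by rewrite -ltnS prednK // ltnn.
  have c0 : 0 < c' by apply: leq_ltn_trans lt.
  have ca1 : c'.-1 < a by rewrite prednK.
  have ce : cnt y c'.-1.+1 + (a == c'.-1.+1) < cnt y c'.-1.
    have := K3' c0; rewrite /corner !cntE prednK // aa' (gtn_eqF ca1).
    by rewrite (gtn_eqF (ltn_trans ca1 _)) -?aa' // ?addn0; clear; lia.
  have := top_slide_lo aa' ca' ca1 ce; rewrite -ltnS prednK // ltnn => /esym.
  by rewrite -ltnS prednK // lt.
by rewrite Eb Ec aa' trid_last // ba ac orbT.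
Qed.
End Top.
Lemma triD_neq x p q r : V (x ++ [:: p; q; r]) -> [&& p != q, q != r & p != r].
Proof.
move=> Vx; have := V_ok Vx; move/ok_cat=> /andP[_] /=; rewrite !inE !negb_or !andbT.
by case/andP=> /andP[-> ->] ->.
Qed.

Lemma phi_mv u j : V u -> size u <= n.+1 -> phi (mD j u) = md j (phi u).
Proof.
move=> Vu su; case: (ltngtP j.+2 n) => jn; first exact: phi_mv_low.
  by rewrite !mv_out ?size_phi //; apply: leq_trans su _.
move: su; rewrite leq_eqVlt => /orP[/eqP su|su]; last by rewrite !mv_out ?size_phi // jn.
have [|x [l [Eu sl sx]]] := @split_suffix 3 u; first by rewrite su -jn.
case: l sl Eu => [|p [|q [|r [|]]]] // _ Eu.
have sx3 : size x + 3 = n.+1 by rewrite -su Eu size_cat.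
have ex : size x = j by move: sx3; rewrite -jn; clear; lia.
rewrite Eu in Vu *; case e: (triD T p q r) => [[p' q'] r'].
have neq := triD_neq Vu; have [F1 F2 F3] := triD_flip neq e.
have Em : mD j (x ++ [:: p; q; r]) = x ++ [:: p'; q'; r'].
  by rewrite -ex -[size x]addn0 mv_catr /= e.
have Vu' : V (x ++ [:: p'; q'; r']) by rewrite -Em; apply: V_mv.
have [y [m [Ey sm sy]]] : exists y m, [/\ phi (x ++ [:: p; q; r]) = y ++ m, size m = 3 & size y = size x].
  have [|y [m [h1 h2 h3]]] := @split_suffix 3 (phi (x ++ [:: p; q; r])).
    by rewrite size_phi size_cat leq_addl.
  by exists y, m; rewrite h3 size_phi size_cat addnK.
case: m sm Ey => [|a [|b [|c [|]]]] // _ Ey.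
have [m [Em' sm]] : exists m, phi (x ++ [:: p'; q'; r']) = y ++ m /\ size m = 3.
  exists (drop (size x) (phi (x ++ [:: p'; q'; r']))); split.
    by rewrite -{1}(cat_take_drop (size x) (phi _)) phi_take -(phi_take x [:: p; q; r]) Ey -sy take_size_cat.
  by rewrite size_drop size_phi size_cat addKn.
case: m sm Em' => [|a' [|b' [|c' [|]]]] // _ Em'.
have su' : size (x ++ [:: p; q; r]) <= n.+1 by rewrite size_cat sx3.
have su'' : size (x ++ [:: p'; q'; r']) <= n.+1 by rewrite size_cat sx3.
rewrite Em Em' Ey -ex -sy -[size y]addn0 mv_catr /=.
suff -> : trid a b c = (a', b', c') by [].
have := sig_suffix_all Vu su' Ey (esym sy); rewrite /= /geq /= => -[s1 s2].
(* If the two signs agree, neither side moves. A peak is [top_final]; a valley is the peak case for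
   the moved word, since both kinds of moves are involutions. *)
have [pq|pq] := boolP (p < q); have [qr|qr] := boolP (q < r).
- have [e1 e2 e3] := F1 ltac:(by rewrite pq qr).
  move: Em'; rewrite e1 e2 e3 Ey => /eqP; rewrite eqseq_cat // eqxx /= => /eqP[<- <- <-].
  by rewrite /trid; move: s1 s2; rewrite pq qr; clear; do 2?case: ifP => //; lia.
- have rq : r < q by rewrite ltn_neqAle leqNgt qr andbT eq_sym; case/and3P: neq.
  exact: top_final Vu sx3 Ey Em' e pq rq (esym sy).
- have qp : q < p by rewrite ltn_neqAle leqNgt pq andbT eq_sym; case/and3P: neq.
  have /andP[pq' rq'] := F3 qp qr.
  have := triDK T neq; rewrite e /= => e'.
  have H := top_final Vu' sx3 Em' Ey e' pq' rq' (esym sy).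
  by have := tridK a' b' c'; rewrite H.
have [e1 e2 e3] := F1 ltac:(by rewrite (negPf pq) (negPf qr)).
move: Em'; rewrite e1 e2 e3 Ey => /eqP; rewrite eqseq_cat // eqxx /= => /eqP[<- <- <-].
by rewrite /trid; move: s1 s2; rewrite (negPf pq) (negPf qr); clear; do 2?case: ifP => //; lia.
Qed.

Lemma phi_run u cs : V u -> size u <= n.+1 -> phi (rD cs u) = rd cs (phi u).
Proof.
elim: cs u => //= c cs IHc u Vu su.
by rewrite IHc ?size_mv ?phi_mv //; apply: V_mv.
Qed.

(* A class on which the last letter of phi is constant; components are unions of these pieces. *)
Definition piece u w := exists2 cs, all (fun c => c.+2 < n) cs & w = rD cs u.

Lemma piece_refl u : piece u u.
Proof. by exists [::]. Qed.

Lemma piece_trans u v w : piece u v -> piece v w -> piece u w.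
Proof. by case=> cs h -> [cs' h' ->]; exists (cs ++ cs'); rewrite ?all_cat ?h // run_cat. Qed.

Lemma piece_size u w : piece u w -> size w = size u.
Proof. by case=> cs _ ->; rewrite size_run. Qed.

Lemma piece_V u w : V u -> piece u w -> V w.
Proof. by move=> Hu [cs _ ->]; apply: V_run. Qed.

Lemma piece_sym u w : V u -> piece u w -> piece w u.
Proof.
move=> Hu [cs h ->]; exists (rev cs); first by rewrite all_rev.
elim: cs u Hu h => //= c cs IHc u Hu /andP[_ h].
by rewrite rev_cons run_rcons -IHc ?mvDK //; [apply: V_ok|apply: V_mv].
Qed.

Lemma piece_mv c u : c.+2 < n -> piece u (mD c u).
Proof. by move=> cn; exists [:: c]; rewrite //= cn. Qed.

Lemma piece_catl x x' l : size x <= n -> connD x x' -> piece (x ++ l) (x' ++ l).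
Proof.
move=> sx [cs h ->]; exists cs; last by rewrite run_catl.
by apply: sub_all h => c h; apply: leq_trans h sx.
Qed.

Lemma piece_perm u w : V u -> size u = n.+1 -> piece u w -> perm_eq (phi u) (phi w).
Proof. by move=> Hu su [cs _ ->]; rewrite phi_run ?su // perm_sym perm_rund. Qed.

Lemma piece_last u w : V u -> size u = n.+1 -> piece u w -> last 0 (phi w) = last 0 (phi u).
Proof.
move=> Hu su [cs h ->]; rewrite phi_run ?su //.
have := size_phi u; rewrite su; case/lastP: (phi u) => // y a; rewrite size_rcons => -[sy].
by rewrite -cats1 run_catl ?sy // !last_cat.
Qed.

Lemma piece_uniq u w : V u -> size u = n.+1 -> piece u w -> phi w = phi u -> w = u.
Proof.
move=> Hu su [cs h ->]; case/lastP: u su Hu => // x c; rewrite size_rcons => -[sx] Hu.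
have Hx : V x by move: Hu; rewrite -cats1; apply: V_cat.
rewrite -cats1 run_catl ?sx // !cats1 !phi_rcons => /rcons_inj[e _].
have [_ _ _ U] := IH (eq_leq sx) Hx erefl.
by rewrite (U _ (conn_run _ _ _) e).
Qed.

Lemma piece_to u y : V u -> size u = n.+1 -> yam y -> perm_eq (phi u) y ->
  last 0 y = last 0 (phi u) -> exists2 w, piece u w & phi w = y.
Proof.
move=> Hu su Hy P; have Yu := yam_all Hu (eq_leq su); have sp := size_phi u.
move: (perm_size P); rewrite sp su => sy.
have [z [a E]] : exists z a, phi u = rcons z a.
  by case/lastP: (phi u) sp => [|z a] sp; [rewrite su in sp | exists z, a].
case/lastP: y sy Hy P => // z' a'; rewrite size_rcons => -[sz'] Hy P.
rewrite E !last_rcons => ea; rewrite E in P Yu sp.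
move: P Hy Yu; rewrite ea -!cats1 perm_cat2r => P /yam_catl Hz' /yam_catl Hz.
have sz : size z = n by move: sp; rewrite size_rcons su => -[].
have [cs /andP[h _] e] := conn_yam Hz Hz' P; rewrite sz in h.
exists (rD cs u); first by exists cs.
by rewrite phi_run ?su // E -cats1 run_catl ?sz // -e.
Qed.

Lemma phi_split k u : V u -> size u = n.+1 -> k <= n.+1 -> exists x l y m,
  [/\ u = x ++ l, phi u = y ++ m, size l = k, size m = k & size x = size y /\ size x + k = n.+1].
Proof.
move=> Hu su kn; have [|x [l [h1 h2 h3]]] := @split_suffix k u; first by rewrite su.
have [|y [m [h4 h5 h6]]] := @split_suffix k (phi u); first by rewrite size_phi su.
by exists x, l, y, m; rewrite h3 h6 size_phi su subnK.
Qed.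

Lemma suffix_run_all cs x l y m : V (x ++ l) -> size (x ++ l) <= n.+1 -> phi (x ++ l) = y ++ m ->
  size x = size y -> phi (x ++ rD cs l) = y ++ rd cs m /\ sgl (rD cs l) = sgd (rd cs m).
Proof.
move=> H s e sp.
have E : phi (x ++ rD cs l) = y ++ rd cs m by rewrite -run_catr phi_run ?e ?sp ?run_catr.
split=> //; apply: sig_suffix_all E sp; first by rewrite -run_catr; apply: V_run.
by rewrite size_cat size_run -size_cat.
Qed.

(** * The move of the last letter, and injectivity on components *)

Section Top2.
Variable t : nat.
Hypothesis nt : n = t.+2.
Notation top := (mD t).

Lemma top_cat x p q r : size x + 3 = n.+1 -> top (x ++ [:: p; q; r]) = x ++ mD 0 [:: p; q; r].
Proof. by move=> sx; rewrite -mv_catr addn0; congr mv; move: sx nt; clear; lia. Qed.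

Lemma piece_top x x' l : size x + 3 = n.+1 -> size l = 3 -> connD x x' ->
  piece (x ++ l) (x' ++ l) /\ piece (top (x ++ l)) (top (x' ++ l)).
Proof.
move=> sx; case: l => [|p [|q [|r [|]]]] // _ cx.
have sx' : size x' + 3 = n.+1 by rewrite (conn_size cx).
have sxn : size x <= n by move: sx; clear; lia.
by rewrite !top_cat //; split; apply: piece_catl.
Qed.

(** Replace the prefix by a tableau with last row [a.-1]. Then the last four letters are in the
    double-edge case of [square_fact]: the top move equals the move before it, which does not touch
    the last letter. *)
Lemma stay_hi x p q r y a b c : V (x ++ [:: p; q; r]) -> size x + 3 = n.+1 -> size x = size y ->
  phi (x ++ [:: p; q; r]) = y ++ [:: a; b; c] -> b < c <= a ->
  piece (x ++ [:: p; q; r]) (top (x ++ [:: p; q; r])).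
Proof.
move=> Vu sx sxy e /andP[bc ca].
have su : size (x ++ [:: p; q; r]) = n.+1 by rewrite size_cat sx.
have Y := yam_all Vu (eq_leq su); rewrite e in Y.
have ba : b < a by apply: leq_trans ca.
have a0 : 0 < a by apply: leq_ltn_trans ba.
have [z Hz P] := corner_last (yam_catl Y) (yam_mid_corner Y a0).
have ex : phi x = y by rewrite -(phi_take x [:: p; q; r]) e sxy take_size_cat.
have Vx := V_cat Vu; have sxn : size x <= n by move: sx; clear; lia.
rewrite -ex in P; have [x1 [cx e1 H1]] := conn_prefix Vx sxn Hz P.
have [V1 E1] := H1 [:: p; q; r] [:: a; b; c] Vu (eq_leq su) ltac:(by rewrite e ex).
have [h1 h2] := piece_top sx (erefl (size [:: p; q; r])) cx.
apply: (piece_trans h1); apply: piece_trans (piece_sym _ h2); last exact: V_mv.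
have := conn_size cx; case/lastP: x1 {H1 h1 h2} cx e1 V1 E1 => [|x0 l] cx e1 V1 E1.
  by move: (size_phi [::]); rewrite e1 size_rcons.
rewrite size_rcons => sx0; rewrite !cat_rcons in V1 E1 *.
have s1 : size (x0 ++ [:: l; p; q; r]) <= n.+1 by rewrite size_cat -sx -sx0 /= addSn -addnS.
have s01 : size x0 = size z.
  by have := size_phi (rcons x0 l); rewrite e1 !size_rcons => -[].
have [_ S0] := suffix_run_all [::] V1 s1 E1 s01; have [_ S1] := suffix_run_all [:: 1] V1 s1 E1 s01.
have := square_factP (V_good V1) erefl; rewrite [sgl [:: l; p; q; r]]S0 S1.
have ba1 : b <= a.-1 by rewrite -ltnS prednK.
have -> : sgd (rd [::] [:: a.-1; a; b; c]) = [:: false; true; false].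
  by rewrite /= /geq /= (ltnW ba) leqNgt prednK // leqnn (leqNgt c) bc.
have -> : rd [:: 1] [:: a.-1; a; b; c] = [:: a.-1; b; a; c] by rewrite /= trid_first // bc ca.
rewrite [nth _ _ 0]/= /geq /= ba1 => /eqP E0.
have -> : top (x0 ++ [:: l; p; q; r]) = x0 ++ rD [:: 1] [:: l; p; q; r].
  by rewrite -mv_catr; congr mv; move: sx sx0 nt; clear; lia.
have ->  : rD [:: 1] [:: l; p; q; r] = mD 0 [:: l; p; q; r] by rewrite [RHS]E0.
rewrite -mv_catr; apply: piece_mv.
by move: sx sx0 nt; clear; lia.
Qed.

Lemma top_split u : V u -> size u = n.+1 -> exists x p q r y a b c,
  [/\ u = x ++ [:: p; q; r], phi u = y ++ [:: a; b; c], size x = size y & size x + 3 = n.+1].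
Proof.
move=> Vu su; have [|x [l [y [m [-> -> sl sm [h1 h2]]]]]] := phi_split (k := 3) Vu su.
  by rewrite nt.
case: l sl => [|p [|q [|r [|]]]] // _; case: m sm => [|a [|b [|c [|]]]] // _.
by exists x, p, q, r, y, a, b, c.
Qed.

Lemma trid_case a b c : (trid a b c = (a, b, c) /\ (b <= a) = (c <= b)) \/
  (minn b c <= a < maxn b c /\ trid a b c = (a, c, b)) \/
  (minn a b < c <= maxn a b /\ trid a b c = (b, a, c)).
Proof.
rewrite /trid; case: ifP => h1; first by right; left.
by case: ifP => h2; [right; right | left; split=> //; move: h1 h2; clear; lia].
Qed.

Lemma stay u : V u -> size u = n.+1 -> last 0 (phi (top u)) = last 0 (phi u) -> piece u (top u).
Proof.
move=> Vu su; have [x [p [q [r [y [a [b [c [Eu E sxy sx]]]]]]]]] := top_split Vu su.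
have sy : size y + 3 = n.+1 by rewrite -sxy.
have Et : phi (top u) = y ++ md 0 [:: a; b; c].
  by rewrite phi_mv ?su // E -mv_catr addn0; congr mv; move: sy nt; clear; lia.
rewrite Et E !last_cat /=.
have [[e s]|[[h ->]|[h e]]] := trid_case a b c.
- have : sgl [:: p; q; r] = sgd [:: a; b; c].
    by apply: (@sig_suffix_all x _ y); rewrite -?Eu ?su.
  rewrite /= /geq /= s => -[s1 s2].
  have Vu' := Vu; rewrite Eu in Vu'; have neq := triD_neq Vu'.
  case ed : (triD T p q r) => [[p' q'] r']; have [F _ _] := triD_flip neq ed.
  have -> : top u = u; last by move=> _; apply: piece_refl.
  by rewrite Eu top_cat //= ed; have [-> -> ->] := F (etrans s1 (esym s2)).
- by move=> /= bc; move: h; rewrite bc minnn maxnn; clear; lia.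
move=> _; case: (ltngtP b a) => ab; last by move: h; rewrite ab minnn maxnn; clear; lia.
  rewrite Eu; apply: (stay_hi (y := y) (a := a) (b := b) (c := c)); rewrite -?Eu //.
  by move: h; rewrite (minn_idPr (ltnW ab)) (maxn_idPl (ltnW ab)).
have Vt := V_mv t Vu; apply: piece_sym => //.
have Ett : top (top u) = u by apply: mvDK; apply: V_ok.
rewrite -[X in piece _ X]Ett; have Et' : top u = x ++ mD 0 [:: p; q; r] by rewrite Eu top_cat.
rewrite Et' /=; apply: (stay_hi (y := y) (a := b) (b := a) (c := c)) => //; rewrite -?[x ++ _]Et' //.
  by rewrite Et /= e.
by move: h; rewrite (minn_idPl (ltnW ab)) (maxn_idPr (ltnW ab)).
Qed.

(** The two prefixes have images of the same content, so moves among the prefix letters join them,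
    and these moves do not interfere with the top move. *)
Lemma cross_same v v' y y' m : V v -> size v = n.+1 -> piece v v' ->
  phi v = y ++ m -> phi v' = y' ++ m -> size m = 3 -> piece (top v) (top v').
Proof.
move=> Vv sv pv E E' sm; have Vv' := piece_V Vv pv; have sv' : size v' = n.+1 by rewrite (piece_size pv).
have := piece_perm Vv sv pv; rewrite E E' perm_cat2r => P.
have [|x [l [y0 [m0 [Ev Ey sl sm0 [h1 h2]]]]]] := phi_split (k := 3) Vv sv; first by rewrite nt.
move: (Ey); rewrite E => /eqP; rewrite eqseq_cat; last first.
  by have := congr1 size Ey; rewrite E !size_cat sm sm0 => /addIn.
case/andP=> /eqP ey /eqP em; rewrite -ey -em in Ey h1 => {y0 m0 sm0 ey em}.
have Vx : V x by apply: (V_cat (t := l)); rewrite -Ev.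
have ex : phi x = y by rewrite -(phi_take x l) -Ev E h1 take_size_cat.
have Y' := yam_all Vv' (eq_leq sv'); rewrite E' in Y'.
have sxn : size x <= n by move: h2; clear; lia.
rewrite -ex in P; have [x1 [cx e1 H1]] := conn_prefix Vx sxn (yam_catl Y') P.
have [V1 E1] := H1 l m ltac:(by rewrite -Ev) ltac:(by rewrite -Ev sv) ltac:(by rewrite -Ev ex).
have [p1 p2] := piece_top h2 sl cx; rewrite -Ev in p1 p2.
suff <- : x1 ++ l = v' by [].
apply: piece_uniq => //; last by rewrite E1 E'.
exact: piece_trans (piece_sym Vv pv) p1.
Qed.

(** The images end in [e, b, c] and [e', b, c]. If [e] and [e'] differ, choose a prefix with image
    ending in [f, e']: turning [f, e', e] into [f, e, e'] commutes with the top move by [swap_fact],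
    which leads back to [cross_same]. *)
Lemma cross_uniq v v' : V v -> size v = n.+1 -> piece v v' ->
  last 0 (phi (top v)) = last 0 (phi (top v')) -> last 0 (phi (top v)) != last 0 (phi v) ->
  piece (top v) (top v').
Proof.
move=> Vv sv pv el nl; have Vv' := piece_V Vv pv; have sv' : size v' = n.+1 by rewrite (piece_size pv).
have [x [p [q [r [y [e [b [c [Ev E sxy sx]]]]]]]]] := top_split Vv sv.
have [x' [p' [q' [r' [y' [e' [b' [c' [Ev' E' sxy' sx']]]]]]]]] := top_split Vv' sv'.
have Et (u : seq nat) z i j k : V u -> size u = n.+1 -> phi u = z ++ [:: i; j; k] -> phi (top u) = z ++ md 0 [:: i; j; k].
  move=> Vu su Ez; rewrite phi_mv ?su // Ez -mv_catr addn0; congr mv.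
  have := size_phi u; rewrite Ez size_cat su nt /=; clear; lia.
have ec : c' = c by have := piece_last Vv sv pv; rewrite E E' !last_cat.
move: el nl; rewrite (Et _ _ _ _ _ Vv sv E) (Et _ _ _ _ _ Vv' sv' E') E !last_cat ec /=.
case: (trid_case e b c) => [[-> _]|[[h ->]|[_ ->]]]; rewrite /= ?eqxx //.
case: (trid_case e' b' c) => [[-> _]|[[h' ->]|[_ ->]]] /= ebb; rewrite ?ebb ?eqxx // -?ebb => bc {Et}.
rewrite ec -ebb in E' h' => {ec c' ebb}.
have [ee|ee] := eqVneq e e'.
  by rewrite -ee in E'; exact: (cross_same Vv sv pv E E').
have P : perm_eq (rcons y e) (rcons y' e').
  by have := piece_perm Vv sv pv; rewrite E E' -(cat_rcons e) -(cat_rcons e') perm_cat2r.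
have Y := yam_all Vv (eq_leq sv); have Y' := yam_all Vv' (eq_leq sv').
rewrite E -cat_rcons in Y; rewrite E' -cat_rcons in Y'.
have [_ ce] := yam_rcons_inv (yam_catl Y); have [_ ce'] := yam_rcons_inv (yam_catl Y').
rewrite -(corner_perm _ P) in ce'.
have [w [f [ef Hw Pw]]] := yam_two_sym (yam_catl Y) ce ce' ee.
have {}Pw : perm_eq y (w ++ [:: f; e']).
  by move: Pw; rewrite -cats1 -[[:: f; e'; e]]/([:: f; e'] ++ [:: e]) catA perm_cat2r.
have {}Hw : yam (w ++ [:: f; e']).
  by move: Hw; rewrite -[[:: f; e'; e]]/([:: f; e'] ++ [:: e]) catA; apply: yam_catl.
have Vx : V x by apply: (V_cat (t := [:: p; q; r])); rewrite -Ev.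
have ex : phi x = y by rewrite -(phi_take x [:: p; q; r]) -Ev E sxy take_size_cat.
have sxn : size x <= n by move: sx; clear; lia.
rewrite -ex in Pw; have [x1 [cx e1 H1]] := conn_prefix Vx sxn Hw Pw.
have [V1 E1] := H1 [:: p; q; r] [:: e; b; c] ltac:(by rewrite -Ev) ltac:(by rewrite -Ev sv) ltac:(by rewrite -Ev ex).
have [p1 p2] := piece_top sx (erefl (size [:: p; q; r])) cx; rewrite -Ev in p1 p2.
have [|p0 [l [El sl sp]]] := @split_suffix 2 x1; first by rewrite -size_phi e1 size_cat leq_addl.
case: l sl El => [|l1 [|l2 [|]]] // _ El.
have sx1 : size x1 = size w + 2 by rewrite -size_phi e1 size_cat.
have sp0 : size p0 = size w by rewrite sp sx1 addnK.
rewrite El -catA /= in V1 E1 p1 p2; rewrite -catA /= in E1.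
have s5 : size p0 + 5 = n.+1 by have := piece_size p1; rewrite size_cat sv.
have s5' : size (p0 ++ [:: l1; l2; p; q; r]) <= n.+1 by rewrite size_cat s5.
have S cs := suffix_run_all cs V1 s5' E1 sp0.
have tE : rd [:: 0] [:: f; e'; e; b; c] = [:: f; e; e'; b; c].
  by rewrite /= trid_last //; move: ef; clear; lia.
have tE2 : rd [:: 2] [:: f; e'; e; b; c] = [:: f; e'; e; c; b].
  by rewrite /= trid_last //; move: h; clear; lia.
have tE3 : rd [:: 0; 2] [:: f; e'; e; b; c] = [:: f; e; e'; c; b].
  have -> : rd [:: 0; 2] [:: f; e'; e; b; c] = md 2 (rd [:: 0] [:: f; e'; e; b; c]) by [].
  by rewrite tE /= trid_last //; move: h'; clear; lia.
have tE4 : rd [:: 2; 0] [:: f; e'; e; b; c] = [:: f; e; e'; c; b].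
  have -> : rd [:: 2; 0] [:: f; e'; e; b; c] = md 0 (rd [:: 2] [:: f; e'; e; b; c]) by [].
  by rewrite tE2 /= trid_last //; move: ef; clear; lia.
have [f2 S2] := S [:: 0]; rewrite tE in f2 S2.
have [_ S3] := S [:: 2]; rewrite tE2 in S3.
have [_ S4] := S [:: 0; 2]; rewrite tE3 in S4.
have [_ S5] := S [:: 2; 0]; rewrite tE4 in S5.
have [_ S1] := S [::].
have eb : (b <= e') = (b <= e) by move: h h' bc; clear; lia.
have comm := swap_factP (V_good V1) (erefl _) S1.
have {comm} comm : rD [:: 2; 0] [:: l1; l2; p; q; r] = rD [:: 0; 2] [:: l1; l2; p; q; r].
  apply: comm; rewrite ?S2 ?S3 ?S4 ?S5 /geq /= ?eb //.
  - by move: ef; clear; lia.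
  - by move: h bc; clear; lia.
  - by congr [:: _; _; _; _]; move: ef; clear; lia.
  - by congr [:: _; _; _; _]; move: h bc; clear; lia.
  - by congr [:: _; _; _; _]; move: ef h h' bc; clear; lia.
  by congr [:: _; _; _; _]; move: ef h h' bc; clear; lia.
have n5 : size p0 + 0 < n by move: s5 nt; clear; lia.
have low : (size p0 + 0).+2 < n by move: s5 nt; clear; lia.
have et : t = size p0 + 2 by move: s5 nt; clear; lia.
set L := [:: l1; l2; p; q; r] in V1 E1 p1 p2 f2 comm *.
have q1 : piece (p0 ++ L) (p0 ++ mD 0 L) by rewrite -mv_catr; apply: piece_mv.
have q2 : piece (top (p0 ++ L)) (top (p0 ++ mD 0 L)).
  have -> : top (p0 ++ mD 0 L) = p0 ++ rD [:: 2; 0] L by rewrite comm et mv_catr.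
  have -> : p0 ++ rD [:: 2; 0] L = mD (size p0 + 0) (top (p0 ++ L)) by rewrite et mv_catr mv_catr.
  exact: piece_mv.
apply: (piece_trans p2); apply: (piece_trans q2).
have Vq := piece_V V1 q1.
apply: (@cross_same _ _ (w ++ [:: f; e]) y' [:: e'; b; c]) => //.
- by rewrite size_cat size_mv.
- by apply: piece_trans (piece_sym V1 q1) _; apply: piece_trans (piece_sym Vv p1) pv.
by rewrite f2 -catA.
Qed.

(* Pieces joined by a move that changes the last letter of phi. *)
Definition cross u w := exists v,
  [/\ piece u v, last 0 (phi (top v)) != last 0 (phi v) & piece (top v) w].

Lemma cross_V u w : V u -> cross u w -> V w.
Proof. by move=> Vu [v [h1 _ h2]]; apply: piece_V h2; apply: V_mv; apply: piece_V h1. Qed.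

Lemma cross_size u w : cross u w -> size w = size u.
Proof. by case=> v [h1 _ h2]; rewrite (piece_size h2) size_mv (piece_size h1). Qed.

Lemma cross_sym u w : V u -> cross u w -> cross w u.
Proof.
move=> Vu [v [h1 nl h2]]; have Vv := piece_V Vu h1; exists (top v).
have e : top (top v) = v by apply: mvDK; apply: V_ok.
split; first exact: piece_sym (V_mv _ Vv) h2; first by rewrite e eq_sym.
by rewrite e; apply: piece_sym.
Qed.

Lemma cross_pieces u u' w w' : V u -> piece u u' -> piece w w' -> cross u w -> cross u' w'.
Proof.
move=> Vu pu pw [v [h1 nl h2]]; exists v; split=> //.
  exact: piece_trans (piece_sym Vu pu) h1.
exact: piece_trans h2 pw.
Qed.

Lemma cross_last u w : V u -> size u = n.+1 -> cross u w -> last 0 (phi w) != last 0 (phi u).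
Proof.
move=> Vu su [v [h1 nl h2]]; have Vv := piece_V Vu h1.
by rewrite (piece_last _ _ h2) ?size_mv ?(piece_size h1) // -?(piece_last Vu su h1) //; apply: V_mv.
Qed.

Lemma cross_func u w w' : V u -> size u = n.+1 -> cross u w -> cross u w' ->
  last 0 (phi w) = last 0 (phi w') -> piece w w'.
Proof.
move=> Vu su [v [h1 nl h2]] [v' [h1' nl' h2']].
have Vv := piece_V Vu h1; have Vv' := piece_V Vu h1'.
have sv : size v = n.+1 by rewrite (piece_size h1).
have sv' : size v' = n.+1 by rewrite (piece_size h1').
have [V1 V2] := (V_mv t Vv, V_mv t Vv').
rewrite (piece_last V1 _ h2) ?size_mv // (piece_last V2 _ h2') ?size_mv // => el.
apply: piece_trans (piece_sym V1 h2) _; apply: piece_trans h2'.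
apply: cross_uniq => //; exact: piece_trans (piece_sym Vu h1) h1'.
Qed.

Lemma cross_perm u w : V u -> size u = n.+1 -> cross u w -> perm_eq (phi u) (phi w).
Proof.
move=> Vu su [v [h1 nl h2]]; have Vv := piece_V Vu h1.
have sv : size v = n.+1 by rewrite (piece_size h1).
apply: perm_trans (piece_perm Vu su h1) _.
apply: perm_trans (piece_perm (V_mv t Vv) _ h2); last by rewrite size_mv.
by rewrite phi_mv ?sv // perm_sym perm_mvd.
Qed.

Lemma last_phi_corner u : V u -> size u = n.+1 -> corner (phi u) (last 0 (phi u)).
Proof.
move=> Vu su; have := yam_all Vu (eq_leq su); have := size_phi u; rewrite su.
by case/lastP: (phi u) => // y a _ /yam_rcons_inv[_]; rewrite last_rcons.
Qed.

Lemma cross_triangle u s r : V u -> size u = n.+1 -> last 0 (phi u) < s < r ->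
  corner (phi u) s -> corner (phi u) r ->
  exists b c, [/\ cross u b, cross b c, cross c u, last 0 (phi b) = r & last 0 (phi c) = s].
Proof.
move=> Vu su; set x := last 0 (phi u) => /andP[xs sr] cs cr.
have Yu := yam_all Vu (eq_leq su).
have [w [a [b [f [ineq Hw Pw]]]]] := yam_three Yu (last_phi_corner Vu su) cs cr ltac:(by rewrite xs sr).
have [|u0 pu0 e0] := piece_to Vu su Hw Pw; first by rewrite last_cat.
have V0 := piece_V Vu pu0; have s0 : size u0 = n.+1 by rewrite (piece_size pu0).
have [|p [L [Eu sL sp]]] := @split_suffix 6 u0.
  by rewrite -size_phi e0 size_cat leq_addl.
have sw : size u0 = size w + 6 by rewrite -size_phi e0 size_cat.
rewrite sw addnK in sp; rewrite Eu in V0 s0 e0 pu0 => {sw u0 Eu}.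
have s5 : size p + 6 = n.+1 by rewrite -s0 size_cat sL.
have et : t = size p + 3 by move: s5 nt; clear; lia.
have S k := suffix_run_all k V0 (eq_leq s0) e0 sp.
have tst l : top (p ++ l) = p ++ mD 3 l by rewrite et mv_catr.
have low k l : all (fun c => c < 3) k -> piece (p ++ l) (p ++ rD k l).
  move=> h; exists (map (addn (size p)) k); last by rewrite run_catr.
  rewrite all_map; apply: sub_all h => i /=; move: s5 nt; clear; lia.
set m0 := [:: a; b; f; s; r; x] in e0 S.
(* The rows after each move of [loop], as computed by [trid]; the final entry is [m0] again. *)
pose path := [:: [:: a; b; f; s; x; r]; [:: a; f; b; s; x; r]; [:: a; f; b; x; s; r];
  [:: a; b; f; x; s; r]; [:: a; b; x; f; s; r]; [:: a; b; x; f; r; s]; [:: a; b; f; x; r; s];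
  [:: a; f; b; x; r; s]; [:: a; f; b; r; x; s]; [:: a; f; r; b; x; s]; [:: a; f; r; b; s; x];
  [:: a; f; b; r; s; x]; [:: a; b; f; r; s; x]; [:: a; b; f; s; r; x]].
have {}ineq : [/\ x <= b, b < s, s <= f, f < r & b <= a < f].
  by move: ineq => /and3P[/andP[? ?] /andP[? ?] ?].
have pathE k : k < 14 -> rd (take k.+1 loop) m0 = nth [::] path k.
  have step c i : rd (rcons (take i loop) c) m0 = md c (rd (take i loop) m0) by rewrite run_rcons.
  case: ineq => i1 i2 i3 i4 /andP[i5 i6].
  elim: k => [|k IHk] k14; first by rewrite /= trid_last //; move: i1 i2 i3 i4 i5 i6 xs sr; clear; lia.
  rewrite (take_nth 0) // step IHk 1?ltnW //.
  move: i1 i2 i3 i4 i5 i6 xs sr k14; clear => i1 i2 i3 i4 i5 i6 xs sr k14.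
  do 13![case: k k14 => [|k] k14; first by
    first [rewrite /= trid_last //; lia | rewrite /= trid_first //; lia]].
  by [].
have closed : rD loop L = L.
  apply: (loop_factP (V_good V0) sL).
    rewrite (S [::]).2; move: ineq xs sr; clear => -[i1 i2 i3 i4 /andP[i5 i6]] xs sr.
    by rewrite /= /geq /=; congr [:: _; _; _; _; _]; lia.
  move=> k k14; rewrite (S _).2 pathE //.
  move: ineq xs sr; clear => -[i1 i2 i3 i4 /andP[i5 i6]] xs sr.
  do 14![case: k => [|k]; first by rewrite /= /geq /=; congr [:: _; _; _; _; _]; lia].
  by case: k.
have lastE k : k < 14 -> last 0 (phi (p ++ rD (take k.+1 loop) L)) = last 0 (nth [::] path k).
  move=> k14; rewrite (S _).1 pathE // last_cat; move: k14; rewrite /path; clear.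
  by do 14![case: k => [|k] //].
have last0 : last 0 (phi (p ++ L)) = x by rewrite e0 last_cat.
exists (p ++ rD (take 1 loop) L), (p ++ rD (take 6 loop) L).
rewrite !lastE //=; split=> //.
- exists (p ++ L); rewrite tst; split=> //; last exact: piece_refl.
  by rewrite (lastE 0) // last0 /= gtn_eqF // (ltn_trans xs).
- exists (p ++ rD (take 5 loop) L); rewrite tst; split.
  + exact: (low [:: 0; 2; 0; 1] (rD (take 1 loop) L)).
  + by rewrite (lastE 5) // (lastE 4) //= ltn_eqF.
  exact: piece_refl.
exists (p ++ rD (take 10 loop) L); rewrite tst; split.
- exact: (low [:: 1; 0; 2; 1] (rD (take 6 loop) L)).
- by rewrite (lastE 10) // (lastE 9) //= ltn_eqF.
apply: piece_trans (piece_sym Vu pu0).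
by have := low [:: 1; 0; 2] (rD (take 11 loop) L) isT; rewrite -run_cat closed.
Qed.

Section Trans.
Variables u w1 w2 : seq nat.
Hypotheses (Vu : V u) (su : size u = n.+1) (c1 : cross u w1) (c2 : cross w1 w2).
Let V1 : V w1. Proof. exact: cross_V c1. Qed.
Let s1 : size w1 = n.+1. Proof. by rewrite (cross_size c1). Qed.
Let V2 : V w2. Proof. exact: cross_V c2. Qed.
Let s2 : size w2 = n.+1. Proof. by rewrite (cross_size c2). Qed.
Let P1 : perm_eq (phi u) (phi w1). Proof. exact: cross_perm. Qed.
Let P2 : perm_eq (phi u) (phi w2). Proof. by apply: perm_trans P1 _; apply: cross_perm. Qed.
Let C1 : corner (phi u) (last 0 (phi w1)).
Proof. by rewrite (corner_perm _ P1); apply: last_phi_corner. Qed.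
Let C2 : corner (phi u) (last 0 (phi w2)).
Proof. by rewrite (corner_perm _ P2); apply: last_phi_corner. Qed.

(** When [u] has the smallest of the three last rows, the triangle starts at [u], and [cross_func]
    identifies its two other pieces with those of [w1] and [w2]. *)
Lemma cross_trans_source : last 0 (phi u) < last 0 (phi w1) -> last 0 (phi u) < last 0 (phi w2) ->
  cross u w2.
Proof.
move=> l1 l2; have nl := cross_last V1 s1 c2.
case: (ltngtP (last 0 (phi w1)) (last 0 (phi w2))) nl => // lt _.
  have [b [c [ub bc cu eb ec]]] := cross_triangle Vu su (introT andP (conj l1 lt)) C1 C2.
  have Vb := cross_V Vu ub; have sb : size b = n.+1 by rewrite (cross_size ub).
  have Vc := cross_V Vb bc; have sc : size c = n.+1 by rewrite (cross_size bc).
  have uc := cross_sym Vc cu; have cb := cross_sym Vb bc.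
  have p1 := cross_func Vu su c1 uc (esym ec).
  have c2' := cross_pieces V1 p1 (piece_refl w2) c2.
  have p2 := cross_func Vc sc cb c2' eb.
  exact: cross_pieces Vu (piece_refl u) p2 ub.
have [b [c [ub bc cu eb ec]]] := cross_triangle Vu su (introT andP (conj l2 lt)) C2 C1.
have Vb := cross_V Vu ub; have sb : size b = n.+1 by rewrite (cross_size ub).
have Vc := cross_V Vb bc; have uc := cross_sym Vc cu.
have p1 := cross_func Vu su c1 ub (esym eb).
have c2' := cross_pieces V1 p1 (piece_refl w2) c2.
have p2 := cross_func Vb sb bc c2' ec.
exact: cross_pieces Vu (piece_refl u) p2 uc.
Qed.

Lemma cross_trans_middle : last 0 (phi w1) < last 0 (phi u) -> last 0 (phi w1) < last 0 (phi w2) ->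
  last 0 (phi u) != last 0 (phi w2) -> cross u w2.
Proof.
move=> l1 l2 nl; have c1' := cross_sym Vu c1.
have Cu := last_phi_corner Vu su.
rewrite (corner_perm _ P1) in Cu; have C2' := C2; rewrite (corner_perm _ P1) in C2'.
case: (ltngtP (last 0 (phi u)) (last 0 (phi w2))) nl => // lt _.
  have [b [c [ub bc cu eb ec]]] := cross_triangle V1 s1 (introT andP (conj l1 lt)) Cu C2'.
  have Vb := cross_V V1 ub; have Vc := cross_V Vb bc; have uc := cross_sym Vc cu.
  have p1 := cross_func V1 s1 uc c1' ec; have p2 := cross_func V1 s1 ub c2 eb.
  exact: cross_pieces Vc p1 p2 (cross_sym Vb bc).
have [b [c [ub bc cu eb ec]]] := cross_triangle V1 s1 (introT andP (conj l2 lt)) C2' Cu.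
have Vb := cross_V V1 ub; have Vc := cross_V Vb bc; have uc := cross_sym Vc cu.
have p1 := cross_func V1 s1 ub c1' eb; have p2 := cross_func V1 s1 uc c2 ec.
exact: cross_pieces Vb p1 p2 bc.
Qed.
End Trans.

Lemma cross_trans u w1 w2 : V u -> size u = n.+1 -> cross u w1 -> cross w1 w2 ->
  last 0 (phi u) != last 0 (phi w2) -> cross u w2.
Proof.
move=> Vu su c1 c2 nl.
have V1 := cross_V Vu c1; have s1 : size w1 = n.+1 by rewrite (cross_size c1).
have V2 := cross_V V1 c2; have s2 : size w2 = n.+1 by rewrite (cross_size c2).
have n1 := cross_last Vu su c1; have n2 := cross_last V1 s1 c2.
have c1' := cross_sym Vu c1; have c2' := cross_sym V1 c2.
case: (ltngtP (last 0 (phi u)) (last 0 (phi w1))) n1 => // l1 _;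
case: (ltngtP (last 0 (phi u)) (last 0 (phi w2))) nl => // l2 nl';
case: (ltngtP (last 0 (phi w1)) (last 0 (phi w2))) n2 => // l3 _.
- exact: (cross_trans_source Vu su c1 c2).
- exact: (cross_trans_source Vu su c1 c2).
- by have := ltn_trans (ltn_trans l2 l1) l3; rewrite ltnn.
- by apply: (cross_sym V2); apply: (cross_trans_source V2 s2 c2' c1').
- by apply: (cross_trans_middle Vu su c1 c2); rewrite ?ltn_eqF // (gtn_eqF, ltn_eqF).
- by have := ltn_trans (ltn_trans l2 l3) l1; rewrite ltnn.
- by apply: (cross_trans_middle Vu su c1 c2); rewrite ?gtn_eqF.
by apply: (cross_sym V2); apply: (cross_trans_source V2 s2 c2' c1').
Qed.

(** By transitivity, a walk through many pieces shortens to at most one crossing. A crossing changes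
    the last row, so words of a component with equal images lie in one piece, where injectivity is
    known. *)
Lemma conn_piece u w : V u -> size u = n.+1 -> connD u w -> piece u w \/ cross u w.
Proof.
move=> Vu su [cs _ ->]; elim/last_ind: cs => [|cs c IHc]; first by left; apply: piece_refl.
rewrite run_rcons; set v := rD cs u in IHc *.
have Vv : V v by apply: V_run.
have sv : size v = n.+1 by rewrite size_run.
case: (ltngtP c t) => ct.
- have p : piece v (mD c v) by apply: piece_mv; rewrite nt.
  case: IHc => h; [left; exact: piece_trans p | right; exact: cross_pieces (piece_refl u) p h].
- by rewrite mv_out // sv nt.
rewrite ct; case: (eqVneq (last 0 (phi (top v))) (last 0 (phi v))) => e.
  have p := stay Vv sv e.
  case: IHc => h; [left; exact: piece_trans p | right; exact: cross_pieces (piece_refl u) p h].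
have cv : cross v (top v) by exists v; split=> //; apply: piece_refl.
case: IHc => h; first by right; apply: cross_pieces cv; [|apply: piece_sym|apply: piece_refl].
case: (eqVneq (last 0 (phi u)) (last 0 (phi (top v)))) => e'; last by right; apply: cross_trans h cv e'.
left; exact: (cross_func Vv sv (cross_sym Vu h) cv e').
Qed.

Lemma conn_uniq_top u w : V u -> size u = n.+1 -> connD u w -> phi w = phi u -> w = u.
Proof.
move=> Vu su uw e; case: (conn_piece Vu su uw) => h; first exact: piece_uniq.
by have := cross_last Vu su h; rewrite e eqxx.
Qed.
End Top2.

Lemma inv_succ : inv n.+1.
Proof.
move=> u Vu su; have su' := eq_leq su; split=> [|| j | w uw e].
- exact: yam_all.
- exact: sig_all.
- exact: phi_mv.
(* Words of at most two letters admit no move in range. *)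
case: (leqP n 1) => n1.
  case: uw => cs; rewrite su; case: cs => [_ -> //|c cs /= /andP[+ _]].
  by move: n1; clear; lia.
by apply: (conn_uniq_top (t := n.-2)) uw e; rewrite // !prednK //; move: n1; clear; lia.
Qed.
End Step.

Theorem inv_all n : inv n.
Proof.
suff : forall m, m <= n -> inv m by apply.
elim: n => [|n IH] m; last first.
  rewrite leq_eqVlt => /orP[/eqP -> | h]; first exact: inv_succ.
  by apply: IH.
rewrite leqn0 => /eqP -> u Vu /size0nil ->; split=> //.
by move=> w /conn_size/size0nil.
Qed.
End Insertion.

(** * Positions of entries under D *)

(** All permutations of three objects except the exchange of the outer two, which no operator
    performs. *)
Variant shuffle := Keep | SwapFst | SwapLst | RotL | RotR.

Definition app3 {A : Type} (s : shuffle) (x : A * A * A) : A * A * A :=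
  let: (a, b, c) := x in
  match s with
  | Keep => (a, b, c) | SwapFst => (b, a, c) | SwapLst => (a, c, b)
  | RotL => (b, c, a) | RotR => (c, a, b)
  end.

Definition code (close : bool) (p q r : nat) : shuffle :=
  if between p q r then Keep
  else if close then (if between q p r then RotL else RotR)
  else if between q p r then SwapLst else SwapFst.

Lemma pos_inj w : {in w &, injective (pos w)}.
Proof. by move=> x y xw yw [/(index_inj 0 xw yw)]. Qed.

Lemma perm_map_block (g : nat -> nat) (w s : seq nat) : uniq w -> injective g ->
  {subset s <= w} -> {in s, forall x, g x \in s} -> (forall x, x \notin s -> g x = x) ->
  perm_eq (map g w) w.
Proof.
move=> uw gi sw gs gn; have ug : uniq (map g w) by rewrite map_inj_uniq.
have sb : {subset map g w <= w}.
  move=> _ /mapP[x xw ->]; case: (boolP (x \in s)) => xs; last by rewrite gn.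
  by apply/sw/gs.
have sz : size w <= size (map g w) by rewrite size_map.
by apply: uniq_perm => //; apply: (uniq_min_size ug sb sz).2.
Qed.

Lemma eq_from_pos w w' : uniq w -> perm_eq w w' -> {in w, forall v, pos w v = pos w' v} -> w = w'.
Proof.
move=> uw P e; apply: (@eq_from_nth _ 0) => [|i iw]; first exact: perm_size.
have vw := mem_nth 0 iw; have [] := e _ vw; rewrite index_uniq // => {2}->.
by rewrite nth_index // -(perm_mem P).
Qed.

(** Positions start at 1, so the constant 0 never reaches [last_pos] and never selects [dt]. Facts
    about [d] thus follow from those about [D]. *)
Lemma D0 i w : D (fun=> 0) i w = d i w.
Proof. by rewrite /D /last_pos leq_max. Qed.

(** To be read with [a], [b], [c] the rows of three consecutive entries of a tableau and [P], [Q],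
    [R] their positions in the row reading word. *)
Lemma trid_code (a b c P Q R : nat) : (P < Q) = (b <= a) -> (Q < R) = (c <= b) -> (P < R) = (c <= a) ->
  P != Q -> Q != R -> P != R -> trid a b c = app3 (code false P Q R) (a, b, c).
Proof.
move=> h1 h2 h3 n1 n2 n3; rewrite /code /between.
case: ifP => k1; first by rewrite /trid ifF ?ifF //; lia.
by case: ifP => k2; [rewrite trid_last | rewrite trid_first] => //; lia.
Qed.

Lemma pos_map_inj (g : nat -> nat) w v : injective g -> pos (map g w) (g v) = pos w v.
Proof. by move=> gi; rewrite /pos index_map. Qed.

Definition swapv (a b x : nat) := if x == a then b else if x == b then a else x.

Lemma swapvK a b : involutive (swapv a b).
Proof.
move=> x; rewrite {2}/swapv; case: (eqVneq x a) => [->|xa].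
  by rewrite /swapv eqxx; case: eqP.
by case: (eqVneq x b) => [->|xb]; rewrite /swapv ?eqxx // (negPf xa) (negPf xb).
Qed.

Lemma pattern_of i w a b c : uniq w -> perm_eq [:: i.-1; i; i.+1] [:: a; b; c] ->
  a \in w -> b \in w -> c \in w -> pos w a < pos w b < pos w c -> pattern i w = [:: a; b; c].
Proof.
move=> uw P aw bw cw /andP[ab bc].
rewrite /pattern (@eq_filter _ _ (mem [:: a; b; c])); last by move=> x; apply: perm_mem.
apply/esym/eqP; suff : subseq [:: a; b; c] w by move/(subseq_uniqP uw) => {1}->.
move: aw cw ab bc; rewrite /pos !ltnS; case/splitPr: bw uw => w1 w2; rewrite cat_uniq /=.
case/and3P=> _ /norP[b1 _] /andP[b2 _]; rewrite !mem_cat !index_cat !inE (negPf b1) /= eqxx addn0.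
move=> aw cw; case: ifP aw => [aw1 _ _|]; last by move=> ? ?; lia.
case: ifP cw => [cw1 _|cw1 cw].
  by rewrite ltnNge ltnW // index_mem.
case: eqVneq cw => [->|_ /= cw _]; first by rewrite addn0 ltnn.
by rewrite -cat1s; apply: cat_subseq; rewrite ?sub1seq //= eqxx sub1seq.
Qed.

Definition repv (p q : seq nat) (x : nat) := if x \in p then nth 0 q (index x p) else x.

Lemma replace_pos i p q w : 0 < i -> uniq w -> {subset [:: i.-1; i; i.+1] <= w} ->
  perm_eq p [:: i.-1; i; i.+1] -> perm_eq q [:: i.-1; i; i.+1] ->
  perm_eq (replace_values p q w) w /\ forall v, pos (replace_values p q w) v = pos w (repv q p v).
Proof.
move=> i0 uw sub Pp Pq.
have U : uniq [:: i.-1; i; i.+1] by rewrite /= !inE; lia.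
have up : uniq p by rewrite (perm_uniq Pp).
have uq : uniq q by rewrite (perm_uniq Pq).
have spq : size p = size q by rewrite (perm_size Pp) (perm_size Pq).
have mpq x : (x \in p) = (x \in q) by rewrite (perm_mem Pp) (perm_mem Pq).
have K (p1 q1 : seq nat) : uniq q1 -> size p1 = size q1 ->
    (forall x, (x \in p1) = (x \in q1)) -> cancel (repv p1 q1) (repv q1 p1).
  move=> u1 s1 m1 x; rewrite /repv; case: (boolP (x \in p1)) => xp; last by rewrite -m1 (negPf xp).
  by rewrite mem_nth -?s1 ?index_mem // index_uniq -?s1 ?index_mem // nth_index.
have gi : injective (repv p q) := can_inj (K _ _ uq spq mpq).
split; last first.
  move=> v; rewrite -[RHS](pos_map_inj (g := repv p q)) //.
  by rewrite K // => x; rewrite mpq.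
apply: (@perm_map_block (repv p q) w p) => //.
- by move=> x; rewrite (perm_mem Pp); apply: sub.
- by move=> x xp; rewrite /repv xp mpq mem_nth // -spq index_mem.
by move=> x xp; rewrite /repv (negPf xp).
Qed.

Lemma swap_pos a b w : uniq w -> a \in w -> b \in w ->
  perm_eq (swap_values a b w) w /\ forall v, pos (swap_values a b w) v = pos w (swapv a b v).
Proof.
move=> uw aw bw; have gi := inv_inj (swapvK a b); split; last first.
  by move=> v; rewrite -{1}(swapvK a b v) pos_map_inj.
apply: (@perm_map_block (swapv a b) w [:: a; b]) => //.
- by move=> x; rewrite !inE => /orP[] /eqP ->.
- move=> x; rewrite !inE /swapv; case: (x =P a) => _; first by rewrite eqxx orbT.
  by case: (x =P b) => _ //=; rewrite eqxx.
by move=> x; rewrite !inE negb_or /swapv => /andP[/negPf -> /negPf ->].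
Qed.

(** In terms of positions, [d] and [dt] take the same form: both permute the positions of three
    entries by a [shuffle], although one is defined by exchanging values and the other by
    patterns. *)
Lemma D_pos tau i w P Q R : uniq w -> 0 < i -> {subset [:: i.-1; i; i.+1] <= w} ->
  pos w i.-1 = P -> pos w i = Q -> pos w i.+1 = R ->
  [/\ perm_eq (D tau i w) w,
      (pos (D tau i w) i.-1, pos (D tau i w) i, pos (D tau i w) i.+1) =
        app3 (code (last_pos i w <= tau (first_pos i w)) P Q R) (P, Q, R)
    & forall v, v \notin [:: i.-1; i; i.+1] -> pos (D tau i w) v = pos w v].
Proof.
move=> uw i0 sub eP eQ eR.
have aw : i.-1 \in w by apply: sub; rewrite !inE eqxx.
have bw : i \in w by apply: sub; rewrite !inE eqxx orbT.
have cw : i.+1 \in w by apply: sub; rewrite !inE eqxx !orbT.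
have [n1 [n2 n3]] : P != Q /\ Q != R /\ P != R.
  rewrite -eP -eQ -eR; split; first by apply: contraTneq i0 => /(pos_inj aw bw); lia.
  split; first by apply/eqP => /(pos_inj bw cw); lia.
  by apply/eqP => /(pos_inj aw cw); lia.
rewrite /D ltnNge; case: ifPn; rewrite ?negbK => cl.
  rewrite (negPf cl) /d eP eQ eR /code; case: ifP => h1; first by split; rewrite ?eP ?eQ ?eR.
  case: ifP => h2.
    have [p1 p2] := swap_pos uw bw cw; split=> //.
      by rewrite !p2 /swapv !eqxx ifF ?ifF ?ifF ?eP ?eQ ?eR //; lia.
    by move=> v; rewrite !inE !negb_or p2 /swapv => /and3P[_ /negPf -> /negPf ->].
  have [p1 p2] := swap_pos uw bw aw; split=> //.
    by rewrite !p2 /swapv !eqxx ifF ?ifF ?ifF ?eP ?eQ ?eR //; lia.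
  by move=> v; rewrite !inE !negb_or p2 /swapv => /and3P[/negPf -> /negPf -> _].
rewrite cl /dt.
have pat (a b c : nat) : perm_eq [:: i.-1; i; i.+1] [:: a; b; c] -> pos w a < pos w b < pos w c ->
    pattern i w = [:: a; b; c].
  by move=> h; apply: pattern_of => //; apply: sub; rewrite (perm_mem h) !inE eqxx ?orbT.
have eI : (i.-1 == i) = false by lia.
have eI' : (i == i.-1) = false by lia.
have eJ : (i == i.+1) = false by lia.
have eJ' : (i.+1 == i) = false by lia.
have eK : (i.-1 == i.+1) = false by lia.
have eK' : (i.+1 == i.-1) = false by lia.
have E := (eqseq_cons, eI, eI', eJ, eJ', eK, eK', eqxx, andbF, andbT).
have fin (p q : seq nat) s : perm_eq p [:: i.-1; i; i.+1] -> perm_eq q [:: i.-1; i; i.+1] ->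
    (pos w (repv q p i.-1), pos w (repv q p i), pos w (repv q p i.+1)) = app3 s (P, Q, R) ->
    [/\ perm_eq (replace_values p q w) w,
      (pos (replace_values p q w) i.-1, pos (replace_values p q w) i,
       pos (replace_values p q w) i.+1) = app3 s (P, Q, R)
    & forall v, v \notin [:: i.-1; i; i.+1] -> pos (replace_values p q w) v = pos w v].
  move=> Pp Pq h; have [p1 p2] := replace_pos i0 uw sub Pp Pq; split=> //; first by rewrite !p2.
  by move=> v vn; rewrite p2 /repv (perm_mem Pq) (negPf vn).
rewrite /code /between.
case: (ltngtP P Q) n1 => // pq _; case: (ltngtP Q R) n2 => // qr _ /=.
- rewrite (pat i.-1 i i.+1) ?eP ?eQ ?eR ?pq ?qr //= ?E.
  by split; rewrite ?eP ?eQ ?eR.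
- case: (ltngtP P R) n3 => // pr _ /=.
    rewrite (pat i.-1 i.+1 i) ?eP ?eQ ?eR ?pr ?qr //= ?E; last by apply/permP => ? /=; lia.
    apply: (fin _ _ RotR); try by apply/permP => ? /=; lia.
    by rewrite /repv /= !inE ?E /= ?E eP eQ eR.
  rewrite (pat i.+1 i.-1 i) ?eP ?eQ ?eR ?pr ?pq //= ?E; last by apply/permP => ? /=; lia.
  apply: (fin _ _ RotL); try by apply/permP => ? /=; lia.
  by rewrite /repv /= !inE ?E /= ?E eP eQ eR.
- case: (ltngtP P R) n3 => // pr _ /=.
    rewrite (pat i i.-1 i.+1) ?eP ?eQ ?eR ?pr ?pq //= ?E; last by apply/permP => ? /=; lia.
    apply: (fin _ _ RotL); try by apply/permP => ? /=; lia.
    by rewrite /repv /= !inE ?E /= ?E eP eQ eR.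
  rewrite (pat i i.+1 i.-1) ?eP ?eQ ?eR ?pr ?qr //= ?E; last by apply/permP => ? /=; lia.
  apply: (fin _ _ RotR); try by apply/permP => ? /=; lia.
  by rewrite /repv /= !inE ?E /= ?E eP eQ eR.
rewrite (pat i.+1 i i.-1) ?eP ?eQ ?eR ?pq ?qr //= ?E; last by apply/permP => ? /=; lia.
by split; rewrite ?eP ?eQ ?eR.
Qed.

(** * Fillings *)

Import Order.TTheory GRing.Theory Num.Theory.

Lemma partition_antitone (p : partition) : antitone (fun r => nth 0 p r).
Proof.
move=> r; case/andP: (partsP p); move: r; elim: (parts p) => [|a s IH] [|r] //=.
  by case: s {IH} => //= b s /andP[].
by move=> /path_sorted sp; rewrite inE negb_or => /andP[_ h]; apply: IH.
Qed.

Section Fill.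
Variables (k : nat) (nu : k.-tuple skew_shape).
Notation cell := (cell nu).
Notation n := (ncells nu).
Notation O := (content_order nu).
Notation sc := (@shifted_content k nu).

Definition in_shape (i : 'I_k) (r c : nat) :=
  nth 0 (inner (tnth nu i)) r <= c < nth 0 (outer (tnth nu i)) r.

Lemma mem_cells i r c : ((i, (r, c)) \in cells nu) = in_shape i r c.
Proof.
apply/allpairsPdep/idP => [[j [rc [_ h [-> e2]]]]|h].
  move: h; rewrite -e2 => /allpairsPdep[r' [c' [_ h [-> ->]]]].
  by move: h; rewrite mem_index_iota.
exists i, (r, c); split=> //; first by rewrite mem_enum.
apply/allpairsPdep; exists r, c; split=> //; rewrite ?mem_index_iota // mem_iota add0n /=.
(* The default value of [nth] makes the rows beyond the list empty, so the row of a cell is in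
   range. *)
by rewrite ltnNge; apply/negP => /(nth_default 0) e; move: h; rewrite /in_shape e ltn0 andbF.
Qed.

Lemma cellP (x : cell) : in_shape (shape_index x) (cell_row x) (cell_column x).
Proof. by rewrite -mem_cells; case: x => [[i [r c]] h]. Qed.

Lemma cell_exists i r c : in_shape i r c ->
  exists x : cell, [/\ shape_index x = i, cell_row x = r & cell_column x = c].
Proof.
by rewrite -mem_cells => h; exists (SeqSub h).
Qed.

Lemma cell_eq (x y : cell) : shape_index x = shape_index y -> cell_row x = cell_row y ->
  cell_column x = cell_column y -> x = y.
Proof.
case: x y => [[i [r c]] h] [[i' [r' c']] h']; rewrite /shape_index /cell_row /cell_column /=.
by move=> e1 e2 e3; apply: val_inj; rewrite /= e1 e2 e3.
Qed.

(** The shape index is the residue of the shifted content modulo [k]. *)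
Lemma sc_inj (x y : cell) : sc x = sc y -> shape_index x = shape_index y /\ content x = content y.
Proof.
rewrite /shifted_content => e; have := ltn_ord (shape_index x); have := ltn_ord (shape_index y) => iy ix.
have : (shape_index x = shape_index y :> nat)%Z.
  have : ((k%:Z * content x + (shape_index x : nat)%:Z)%R %% k%:Z)%Z = ((k%:Z * content y + (shape_index y : nat)%:Z)%R %% k%:Z)%Z by rewrite e.
  by rewrite ![(k%:Z * _)%R]mulrC !modzMDl !modz_small //= => -[].
move=> ei; split; first exact: val_inj.
move: e; rewrite ei => /addIr /(mulfI _); apply.
by have := leq_ltn_trans (leq0n _) ix; lia.
Qed.

Lemma sc_row_inj (x y : cell) : sc x = sc y -> cell_row x = cell_row y -> x = y.
Proof.
by move=> /sc_inj[e1 e2] e3; apply: cell_eq => //; move: e2; rewrite /content e3; lia.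
Qed.

Lemma content_le_total : total (@content_le k nu).
Proof.
move=> x y; rewrite /content_le; case: (ltgtP (sc x) (sc y)) => //= _; exact: leq_total.
Qed.

Lemma content_le_trans : transitive (@content_le k nu).
Proof.
move=> y x z; rewrite /content_le => /orP[h1|/andP[/eqP h1 r1]] /orP[h2|/andP[/eqP h2 r2]].
- by rewrite (lt_trans h1 h2).
- by rewrite -h2 h1.
- by rewrite h1 h2.
by rewrite h1 h2 eqxx (leq_trans r1 r2) orbT.
Qed.

Lemma perm_O : perm_eq O (enum cell).
Proof. by rewrite perm_sort. Qed.

Lemma mem_O (x : cell) : x \in O.
Proof. by rewrite (perm_mem perm_O) mem_enum. Qed.

Lemma uniq_O : uniq O.
Proof. by rewrite (perm_uniq perm_O) enum_uniq. Qed.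

Lemma size_O : size O = n.
Proof. by rewrite (perm_size perm_O) -cardE. Qed.

Lemma sorted_O : sorted (@content_le k nu) O.
Proof. exact: (sort_sorted content_le_total). Qed.

Lemma index_O_le (x y : cell) : index x O <= index y O -> content_le x y.
Proof.
apply: (sorted_leq_index content_le_trans _ sorted_O); rewrite ?mem_O //.
by move=> z; rewrite /content_le eqxx leqnn orbT.
Qed.

Lemma index_O_lt (x y : cell) : (sc x < sc y)%R -> index x O < index y O.
Proof.
move=> h; rewrite ltnNge; apply/negP => /index_O_le; rewrite /content_le.
by rewrite ltNge ltW //= => /andP[/eqP e]; rewrite e ltxx in h.
Qed.

Lemma sc_le_index (x y : cell) : index x O <= index y O -> (sc x <= sc y)%R.
Proof. by move/index_O_le; rewrite /content_le => /orP[/ltW|/andP[/eqP ->]]. Qed.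

Lemma cell_at v : v < n -> exists2 x : cell, v = index x O & nth_content nu v.+1 = sc x.
Proof.
rewrite -size_O => h; have x0 : cell by case: O h => // x.
exists (nth x0 O v); first by rewrite index_uniq ?uniq_O.
by rewrite /nth_content /= (nth_map x0).
Qed.

Lemma nth_content_index (x : cell) : nth_content nu (index x O).+1 = sc x.
Proof. by rewrite /nth_content /= (nth_map x) ?nth_index ?index_mem ?mem_O. Qed.

(** Shifted contents increase weakly along the reading order, so the indices over which [tau] takes
    its maximum form an initial segment. *)
Lemma tau_close (x y : cell) : index x O <= index y O ->
  ((index y O).+1 <= tau nu (index x O).+1) = (sc y - sc x <= k%:Z)%R.
Proof.
move=> xy; apply/idP/idP => h; last first.
  rewrite /tau; apply: (leq_bigmax_seq (F := id)); last by rewrite !nth_content_index.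
  by rewrite mem_index_iota /= ltnS -size_O index_mem mem_O.
rewrite leNgt; apply/negP => h'; move: h; apply/negP; rewrite -ltnNge ltnS.
apply/bigmax_leqP_seq => j; rewrite mem_index_iota; case: j => // j /andP[_ jn].
rewrite nth_content_index; have [z -> ->] := cell_at jn => hz.
have {}h' : (sc z < sc y)%R by apply: le_lt_trans (_ : sc x + k%:Z < sc y)%R; lia.
exact: index_O_lt.
Qed.

Lemma SYT_P (T : filling nu) : reflect [/\ injective T,
    forall x y, shape_index x = shape_index y -> cell_row x = cell_row y ->
      cell_column x < cell_column y -> T x < T y
  & forall x y, shape_index x = shape_index y -> cell_column x = cell_column y ->
      cell_row x < cell_row y -> T x < T y] (T \in SYT nu).
Proof.
rewrite inE /bijectiveb; apply: (iffP and3P).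
  case=> /andP[/injectiveP inj _] /forallP h1 /forallP h2; split=> // x y e1 e2 e3.
    by have /forallP/(_ y)/implyP := h1 x; rewrite e1 e2 e3 !eqxx => /(_ isT).
  by have /forallP/(_ y)/implyP := h2 x; rewrite e1 e2 e3 !eqxx => /(_ isT).
case=> inj h1 h2; split.
- apply/andP; split; first exact/injectiveP.
  apply/forallP => v; apply/existsP.
  have [g _ K] : bijective T by apply: inj_card_bij => //; rewrite card_ord.
  by exists (g v); rewrite K.
- by apply/forallP => x; apply/forallP => y; apply/implyP => /and3P[/eqP ? /eqP ? ?]; apply: h1.
by apply/forallP => x; apply/forallP => y; apply/implyP => /and3P[/eqP ? /eqP ? ?]; apply: h2.
Qed.

Lemma in_shape_box i r r' c c' r1 c1 : in_shape i r c -> in_shape i r' c' -> r <= r1 <= r' -> c <= c1 <= c' ->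
  in_shape i r1 c1.
Proof.
move=> /andP[i1 _] /andP[_ i2] /andP[rr1 rr2] /andP[cc1 cc2]; apply/andP; split.
  exact: leq_trans (antitone_le (partition_antitone _) rr1) (leq_trans i1 cc1).
exact: leq_ltn_trans cc2 (leq_trans i2 (antitone_le (partition_antitone _) rr2)).
Qed.

(* Two cells on a diagonal are the corners of a rectangle whose other two corners have entries in between. *)
Lemma diag_far (T : filling nu) (x y : cell) : T \in SYT nu -> sc x = sc y -> cell_row x < cell_row y ->
  T x + 3 <= T y.
Proof.
move=> /SYT_P[inj R C] e lt.
have [ei ec] := sc_inj e.
have lc : cell_column x < cell_column y by move: ec lt; rewrite /content; lia.
have sx := cellP x; have sy := cellP y; rewrite -ei in sy.
have [a [a1 a2 a3]] := cell_exists (in_shape_box (r1 := cell_row x) (c1 := cell_column y) sx sy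
  ltac:(by rewrite leqnn ltnW) ltac:(by rewrite leqnn ltnW)).
have [b [b1 b2 b3]] := cell_exists (in_shape_box (r1 := cell_row y) (c1 := cell_column x) sx sy
  ltac:(by rewrite leqnn ltnW) ltac:(by rewrite leqnn ltnW)).
have xa : T x < T a by apply: R; rewrite ?a1 ?a2 ?a3.
have ay : T a < T y by apply: C; rewrite ?a1 ?a2 ?a3.
have xb : T x < T b by apply: C; rewrite ?b1 ?b2 ?b3.
have yb : T b < T y by apply: R; rewrite ?b1 ?b2 ?b3.
have ab : (T a : nat) != T b.
  apply/eqP => /val_inj/inj h; by rewrite h b2 in a2; rewrite a2 ltnn in lt.
by move: xa ay xb yb ab; clear; lia.
Qed.

Lemma tie_far (T : filling nu) (x y : cell) : T \in SYT nu -> x != y -> sc x = sc y ->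
  (T x + 3 <= T y) || (T y + 3 <= T x).
Proof.
move=> ST xy e; case: (ltngtP (cell_row x) (cell_row y)) => h.
- by rewrite (diag_far ST e h).
- by rewrite (diag_far ST (esym e) h) orbT.
by rewrite (sc_row_inj e h) eqxx in xy.
Qed.

Section Word.
Variable T : filling nu.
Hypothesis inj : injective T.

Section Order.
Variable L : seq cell.
Hypotheses (uL : uniq L) (fL : forall x, x \in L).

Lemma fword_uniq : uniq (map (entry T) L).
Proof. by rewrite map_inj_uniq // => x y [] /val_inj /inj. Qed.

Lemma fword_mem v : (v \in map (entry T) L) = (0 < v <= n).
Proof.
apply/mapP/idP => [[x _ ->]|/andP[v0 vn]]; first by rewrite /entry /=.
have [g _ K] : bijective T by apply: inj_card_bij => //; rewrite card_ord.
have vn' : v.-1 < n by rewrite prednK.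
by exists (g (Ordinal vn')); rewrite ?fL // /entry K /= prednK.
Qed.

Lemma fword_pos x : pos (map (entry T) L) (entry T x) = (index x L).+1.
Proof. by rewrite /pos index_map // => y z [] /val_inj /inj. Qed.
End Order.

Notation w := (content_word T).

Lemma uniq_word : uniq w.
Proof. exact: fword_uniq uniq_O. Qed.

Lemma mem_word v : (v \in w) = (0 < v <= n).
Proof. exact: fword_mem mem_O v. Qed.

Lemma pos_entry x : pos w (entry T x) = (index x O).+1.
Proof. exact: fword_pos. Qed.

Lemma cell_of v : 0 < v <= n -> exists x, v = entry T x.
Proof. by rewrite -mem_word => /mapP[x _ ->]; exists x. Qed.

Lemma word_filling w' : perm_eq w' w -> exists T' : filling nu,
  [/\ injective T', content_word T' = w' & forall x, pos w' (entry T' x) = (index x O).+1].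
Proof.
move=> P; have sw : size w' = n by rewrite (perm_size P) size_map size_O.
have uw : uniq w' by rewrite (perm_uniq P) uniq_word.
have ix x : index x O < size w' by rewrite sw -size_O index_mem mem_O.
have b x : (nth 0 w' (index x O)).-1 < n.
  have := mem_nth 0 (ix x); rewrite (perm_mem P) mem_word => /andP[? ?]; by rewrite prednK.
exists [ffun x => Ordinal (b x)].
have eT x : entry [ffun x => Ordinal (b x)] x = nth 0 w' (index x O).
  rewrite /entry ffunE /= prednK //.
  by have := mem_nth 0 (ix x); rewrite (perm_mem P) mem_word => /andP[].
have pT x : pos w' (entry [ffun x => Ordinal (b x)] x) = (index x O).+1.
  by rewrite eT /pos index_uniq.
split=> //.
  move=> x y h; have : index x O = index y O.
    by apply: succn_inj; rewrite -!pT /entry h.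
  by move/(index_inj x (mem_O x) (mem_O y)).
apply: (@eq_from_nth _ 0) => [|i]; rewrite size_map size_O ?sw // => ilt.
have x0 : cell by move: ilt; rewrite -size_O; case: O => // x.
by rewrite (nth_map x0) ?size_O // eT index_uniq ?size_O ?uniq_O.
Qed.
End Word.

(** * The operators on the cells of a filling *)

Lemma sc_row (x y : cell) m : shape_index x = shape_index y -> cell_row x = cell_row y ->
  cell_column x + m = cell_column y -> (`|sc x - sc y| = (k * m)%N%:Z)%R.
Proof.
move=> es er e; rewrite distrC /shifted_content /content es er -e.
by lia.
Qed.

Lemma sc_col (x y : cell) m : shape_index x = shape_index y -> cell_column x = cell_column y ->
  cell_row x + m = cell_row y -> (`|sc x - sc y| = (k * m)%N%:Z)%R.
Proof.
move=> es er e; rewrite /shifted_content /content es er -e.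
by lia.
Qed.

Lemma D_cells (T : filling nu) i (X1 X2 X3 : cell) : injective T -> 1 < i < n ->
  i.-1 = entry T X1 -> i = entry T X2 -> i.+1 = entry T X3 ->
  let w := content_word T in
  let s := code (last_pos i w <= tau nu (first_pos i w)) (pos w i.-1) (pos w i) (pos w i.+1) in
  exists T' : filling nu, [/\ injective T', content_word T' = D (tau nu) i w,
    [/\ entry T' (app3 s (X1, X2, X3)).1.1 = i.-1, entry T' (app3 s (X1, X2, X3)).1.2 = i
      & entry T' (app3 s (X1, X2, X3)).2 = i.+1]
    & forall x, x \notin [:: X1; X2; X3] -> entry T' x = entry T x].
Proof.
move=> inj /andP[i1 iN] e1 e2 e3 w s.
have sub : {subset [:: i.-1; i; i.+1] <= w}.
  by move=> v; rewrite !inE mem_word // => /or3P[] /eqP ->; lia.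
have uw := uniq_word inj.
have [P E F] := D_pos (tau nu) uw (ltnW i1) sub erefl erefl erefl.
have [T' [inj' eT' pT']] := word_filling inj P.
have look x v : v \in w -> pos (D (tau nu) i w) v = (index x O).+1 -> entry T' x = v.
  move=> vw; rewrite -pT'; move/(@pos_inj (D (tau nu) i w)) => h; apply/esym/h.
    by rewrite (perm_mem P).
  by rewrite -eT' mem_word // /entry /= ltn_ord.
exists T'; split=> //.
  have p1 : pos w i.-1 = (index X1 O).+1 by rewrite e1 pos_entry.
  have p2 : pos w i = (index X2 O).+1 by rewrite {1}e2 pos_entry.
  have p3 : pos w i.+1 = (index X3 O).+1 by rewrite e3 pos_entry.
  move: E; rewrite -/s p1 p2 p3 => E.
  have m1 : i.-1 \in w by apply: sub; rewrite !inE eqxx.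
  have m2 : i \in w by apply: sub; rewrite !inE eqxx orbT.
  have m3 : i.+1 \in w by apply: sub; rewrite !inE eqxx !orbT.
  by clearbody s; split; apply: look => //; move: E; case: s => -[h1 h2 h3]; rewrite /pos /= ?h1 ?h2 ?h3.
move=> x; rewrite !inE => xn; apply: look; first by rewrite mem_word // /entry /= ltn_ord.
rewrite F ?pos_entry // !inE; apply: contra xn.
by rewrite e1 e3 e2 /entry !eqSS => /or3P[] /eqP/val_inj/inj ->; rewrite eqxx ?orbT.
Qed.

(** The test in [D] compares the first and the last of three positions, so the distance that matters
    is that of the two cells whose contents are not in the middle. *)
Definition cell_shuffle (X1 X2 X3 : cell) : shuffle :=
  if (sc X1 < sc X2 < sc X3)%R || (sc X3 < sc X2 < sc X1)%R then Keep
  else if (sc X2 < sc X1 < sc X3)%R || (sc X3 < sc X1 < sc X2)%R then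
    (if (`|sc X2 - sc X3| <= k%:Z)%R then RotL else SwapLst)
  else (if (`|sc X1 - sc X2| <= k%:Z)%R then RotR else SwapFst).

Lemma D_code (T : filling nu) i (X1 X2 X3 : cell) : injective T ->
  i.-1 = entry T X1 -> i = entry T X2 -> i.+1 = entry T X3 ->
  sc X1 != sc X2 -> sc X2 != sc X3 -> sc X1 != sc X3 ->
  let w := content_word T in
  code (last_pos i w <= tau nu (first_pos i w)) (pos w i.-1) (pos w i) (pos w i.+1) =
  cell_shuffle X1 X2 X3.
Proof.
move=> inj e1 e2 e3 s12 s23 s13 w.
have p1 : pos w i.-1 = (index X1 O).+1 by rewrite e1 pos_entry.
have p2 : pos w i = (index X2 O).+1 by rewrite {1}e2 pos_entry.
have p3 : pos w i.+1 = (index X3 O).+1 by rewrite e3 pos_entry.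
have idx x y : sc x != sc y -> (index x O < index y O) = (sc x < sc y)%R.
  move=> ne; apply/idP/idP => [h|]; last exact: index_O_lt.
  by rewrite lt_neqAle ne sc_le_index // ltnW.
have clo x y : first_pos i w = (index x O).+1 -> last_pos i w = (index y O).+1 ->
    (sc x < sc y)%R -> (last_pos i w <= tau nu (first_pos i w)) = (`|sc x - sc y| <= k%:Z)%R.
  move=> -> -> h; rewrite tau_close; last by apply: ltnW; apply: index_O_lt.
  by rewrite distrC ger0_norm // subr_ge0 ltW.
have btw x y z : sc x != sc y -> sc y != sc z -> between (index x O).+1 (index y O).+1 (index z O).+1 =
    (sc x < sc y < sc z)%R || (sc z < sc y < sc x)%R.
  by move=> h1 h2; rewrite /between !ltnS !idx // eq_sym.
have fl : first_pos i w = (minn (index X1 O) (minn (index X2 O) (index X3 O))).+1 /\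
          last_pos i w = (maxn (index X1 O) (maxn (index X2 O) (index X3 O))).+1.
  by rewrite /first_pos /last_pos p1 p2 p3; clear; lia.
have s21 : sc X2 != sc X1 by rewrite eq_sym.
have s32 : sc X3 != sc X2 by rewrite eq_sym.
have s31 : sc X3 != sc X1 by rewrite eq_sym.
rewrite /code /cell_shuffle p1 p2 p3 !btw //.
case: ifPn => // n1; have [m|m] := boolP ((sc X2 < sc X1 < sc X3)%R || _).
  suff -> : (last_pos i w <= tau nu (first_pos i w)) = (`|sc X2 - sc X3| <= k%:Z)%R by [].
  case/orP: (m) => /andP[h1 h2].
    by apply: clo; [| |exact: lt_trans h2]; move: h1 h2; rewrite -!idx //; case: fl => f l; rewrite ?f ?l; clear; lia.
  by rewrite distrC; apply: clo; [| |exact: lt_trans h2]; move: h1 h2; rewrite -!idx //; case: fl => f l; rewrite ?f ?l; clear; lia.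
suff -> : (last_pos i w <= tau nu (first_pos i w)) = (`|sc X1 - sc X2| <= k%:Z)%R by [].
have m' : (sc X1 < sc X3 < sc X2)%R || (sc X2 < sc X3 < sc X1)%R.
  by move: n1 m s12 s23 s13; clear; lia.
case/orP: m' => /andP[h1 h2].
  by apply: clo; [| |exact: lt_trans h2]; move: h1 h2; rewrite -!idx //; case: fl => f l; rewrite ?f ?l; clear; lia.
by rewrite distrC; apply: clo; [| |exact: lt_trans h2]; move: h1 h2; rewrite -!idx //; case: fl => f l; rewrite ?f ?l; clear; lia.
Qed.

Lemma SYT_cells (T : filling nu) i : T \in SYT nu -> 1 < i < n -> exists X1 X2 X3,
  [/\ i.-1 = entry T X1, i = entry T X2 & i.+1 = entry T X3] /\
  [/\ sc X1 != sc X2, sc X2 != sc X3 & sc X1 != sc X3].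
Proof.
move=> ST iN; have [inj _ _] := SYT_P _ ST.
have [X1 e1] : exists x, i.-1 = entry T x by apply: cell_of => //; lia.
have [X2 e2] : exists x, i = entry T x by apply: cell_of => //; lia.
have [X3 e3] : exists x, i.+1 = entry T x by apply: cell_of => //; lia.
exists X1, X2, X3; split=> //.
have far x y : entry T x < entry T y -> entry T y <= entry T x + 2 -> sc x != sc y.
  move=> xy d; have : x != y by apply: contraTneq xy => ->; rewrite ltnn.
  by move=> ne; apply/eqP => /(tie_far ST ne); move: d xy; rewrite /entry; clear; lia.
by split; apply: far; rewrite -?e1 -?e2 -?e3; move: iN; clear; lia.
Qed.

(* Knuth moves only exchange two cells at shifted content distance more than k, rotations never
   exchange the outer two of three cells within distance k; neighbours are at distance exactly k. *)
Lemma D_filling (T : filling nu) i X1 X2 X3 : T \in SYT nu -> 1 < i < n ->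
  i.-1 = entry T X1 -> i = entry T X2 -> i.+1 = entry T X3 ->
  sc X1 != sc X2 -> sc X2 != sc X3 -> sc X1 != sc X3 ->
  let s := cell_shuffle X1 X2 X3 in
  exists T', [/\ T' \in SYT nu, content_word T' = D (tau nu) i (content_word T),
    [/\ entry T' (app3 s (X1, X2, X3)).1.1 = i.-1, entry T' (app3 s (X1, X2, X3)).1.2 = i
      & entry T' (app3 s (X1, X2, X3)).2 = i.+1]
    & forall x, x \notin [:: X1; X2; X3] -> entry T' x = entry T x].
Proof.
move=> ST iN e1 e2 e3 s12 s23 s13 s; have [inj R C] := SYT_P _ ST.
have [T' [inj' eT' B F]] := D_cells inj iN e1 e2 e3; exists T'.
rewrite (D_code inj e1 e2 e3 s12 s23 s13) -/s in B; split=> //.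
have blk x : x \in [:: X1; X2; X3] -> i.-1 <= entry T x <= i.+1.
  by rewrite !inE => /or3P[] /eqP ->; rewrite -?e1 -?e2 -?e3; lia.
have blkN x : x \notin [:: X1; X2; X3] -> (entry T x < i.-1) || (i.+1 < entry T x).
  rewrite !inE !negb_or => /and3P[h1 h2 h3].
  have d z : x != z -> entry T x != entry T z by apply: contra => /eqP[/val_inj/inj ->].
  by move: (d _ h1) (d _ h2) (d _ h3); rewrite -e1 -e2 -e3; lia.
have blk' x : x \in [:: X1; X2; X3] -> i.-1 <= entry T' x <= i.+1.
  clearbody s; case: B; rewrite !inE; case: s => /= h1 h2 h3 /or3P[] /eqP ->;
  by rewrite ?h1 ?h2 ?h3; lia.
(* The last hypothesis says that cells of one row or column farther apart than [k] have an entry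
   between theirs, so they never hold two consecutive entries. *)
have keep x y : T x < T y -> (k%:Z <= `|sc x - sc y|)%R ->
   ((k%:Z < `|sc x - sc y|)%R -> exists z, T x < T z < T y) -> T' x < T' y.
  move=> lt d1 d2; suff : entry T' x < entry T' y by [].
  have lt' : entry T x < entry T y by [].
  have [xb|xb] := boolP (x \in [:: X1; X2; X3]); have [yb|yb] := boolP (y \in [:: X1; X2; X3]); last first.
  - by rewrite !F.
  - by rewrite F //; have := blkN _ xb; have := blk' _ yb; have := blk _ yb; move: lt'; clear; lia.
  - by rewrite (F y) //; have := blkN _ yb; have := blk' _ xb; have := blk _ xb; move: lt'; clear; lia.
  have noz a b : entry T b = (entry T a).+1 -> ~ (exists z, T a < T z < T b).
    by move=> e [z /andP[z1 z2]]; move: e z1 z2; rewrite /entry; clear; lia.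
  move: B; rewrite /s /cell_shuffle; case: ifP => h1 /=.
    by move: xb yb lt'; rewrite !inE => /or3P[] /eqP -> /or3P[] /eqP -> + [f1 f2 f3]; rewrite ?f1 ?f2 ?f3 -?e1 -?e2 -?e3; move: iN; clear; lia.
  case: ifP => btw.
    case: ifP => cl [f1 f2 f3].
      move: xb yb lt' d1; rewrite !inE => /or3P[] /eqP -> /or3P[] /eqP ->; rewrite ?f1 ?f2 ?f3 -?e1 -?e2 -?e3 => lt'; move: iN btw cl lt'; clear; lia.
    move: xb yb lt' d2; rewrite !inE => /or3P[] /eqP -> /or3P[] /eqP ->; rewrite ?f1 ?f2 ?f3 -?e1 -?e2 -?e3; try by (move: iN; clear; lia).
    by move=> _; rewrite ltNge cl => /(_ isT)/noz; case; rewrite -e2 -e3.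
  have btw3 : (sc X1 < sc X3 < sc X2)%R || (sc X2 < sc X3 < sc X1)%R.
    by move: h1 btw s12 s23 s13; clear; lia.
  case: ifP => cl [f1 f2 f3].
    move: xb yb lt' d1; rewrite !inE => /or3P[] /eqP -> /or3P[] /eqP ->; rewrite ?f1 ?f2 ?f3 -?e1 -?e2 -?e3 => lt'; move: iN btw3 cl lt'; clear; lia.
  move: xb yb lt' d2; rewrite !inE => /or3P[] /eqP -> /or3P[] /eqP ->; rewrite ?f1 ?f2 ?f3 -?e1 -?e2 -?e3; try by (move: iN; clear; lia).
  by move=> _; rewrite ltNge cl => /(_ isT)/noz; case; rewrite -e1 -e2; move: iN; clear; lia.
apply/SYT_P; split=> // x y es er lt.
  have d := sc_row es er (subnKC (ltnW lt)).
  apply: keep; rewrite ?d; first exact: R.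
    by rewrite lez_nat leq_pmulr // subn_gt0.
  rewrite ltz_nat -{1}[k]muln1 ltn_mul2l => /andP[_ h].
  have [z [z1 z2 z3]] := cell_exists (in_shape_box (r' := cell_row x) (c' := cell_column y)
    (r1 := cell_row x) (c1 := (cell_column x).+1) (cellP x)
    ltac:(by rewrite es er; exact: cellP) ltac:(by rewrite !leqnn) ltac:(by rewrite leqnSn lt)).
  by exists z; rewrite !R ?z1 ?z2 ?z3 //; lia.
have d := sc_col es er (subnKC (ltnW lt)).
apply: keep; rewrite ?d; first exact: C.
  by rewrite lez_nat leq_pmulr // subn_gt0.
rewrite ltz_nat -{1}[k]muln1 ltn_mul2l => /andP[_ h].
have [z [z1 z2 z3]] := cell_exists (in_shape_box (r' := cell_row y) (c' := cell_column x)
  (r1 := (cell_row x).+1) (c1 := cell_column x) (cellP x)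
  ltac:(by rewrite es er; exact: cellP) ltac:(by rewrite leqnSn lt) ltac:(by rewrite !leqnn)).
by exists z; rewrite !C ?z1 ?z2 ?z3 //; lia.
Qed.
End Fill.

(** * Fillings as words of content ranks *)

Lemma ok_nth u : (forall a b, a < b -> b <= a.+2 -> b < size u -> nth 0 u a != nth 0 u b) -> ok u.
Proof.
elim: u => //= x u IH H; rewrite IH; last by move=> a b ab ba bu; apply: (H a.+1 b.+1).
rewrite andbT; apply/negP => /(nthP 0)[b]; rewrite size_take_min => bu.
have b2 : b < 2 by apply: leq_trans bu (geq_minl _ _).
have bs : b < size u by apply: leq_trans bu (geq_minr _ _).
by rewrite nth_take // => e; have := H 0 b.+1 isT b2 bs; rewrite /= e eqxx.
Qed.

Section Letters.
Variables (k : nat) (nu : k.-tuple skew_shape).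
Notation cell := (cell nu).
Notation n := (ncells nu).
Notation O := (content_order nu).
Notation sc := (@shifted_content k nu).

Definition sorted_contents : seq int := sort <=%R (shifted_contents nu).
Notation S := sorted_contents.

Lemma uniq_S : uniq S.
Proof. by rewrite sort_uniq undup_uniq. Qed.

Lemma mem_S (x : cell) : sc x \in S.
Proof. by rewrite mem_sort mem_undup map_f // mem_enum. Qed.

Lemma sorted_S : sorted <=%R S.
Proof. exact: (sort_sorted le_total). Qed.

Definition letter (x : cell) : nat := index (sc x) S.

Lemma letter_lt (x y : cell) : (letter x < letter y) = (sc x < sc y)%R.
Proof.
apply/idP/idP => h.
  rewrite lt_neqAle; apply/andP; split.
    by apply: contraTneq h; rewrite /letter => ->; rewrite ltnn.
  by apply: (@sorted_ltn_index _ <=%R le_trans S sorted_S); rewrite ?mem_S.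
rewrite ltnNge; apply/negP => h'.
have : (sc y <= sc x)%R.
  by apply: (@sorted_leq_index _ <=%R le_trans (fun x => lexx x) S sorted_S); rewrite ?mem_S.
by rewrite leNgt h.
Qed.

Lemma letter_eq (x y : cell) : (letter x == letter y) = (sc x == sc y).
Proof. by rewrite eqn_leq (leqNgt (letter x)) (leqNgt (letter y)) !letter_lt -!leNgt eq_le. Qed.

Definition twist : pred nat := fun j =>
  (j.+2 < size S) && (nth 0%R S j.+2 - nth 0%R S j <= k%:Z)%R.

Lemma nth_letter (x : cell) : nth 0%R S (letter x) = sc x.
Proof. by rewrite nth_index ?mem_S. Qed.

Lemma letter_lt_size (x : cell) : letter x < size S.
Proof. by rewrite index_mem mem_S. Qed.

Definition word_letters (w : seq nat) : seq nat :=
  [seq index (nth_content nu (pos w v.+1)) S | v <- iota 0 n].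

Lemma size_letters w : size (word_letters w) = n.
Proof. by rewrite size_map size_iota. Qed.

Lemma nth_letters (T : filling nu) (x : cell) : injective T ->
  nth 0 (word_letters (content_word T)) (T x) = letter x.
Proof.
move=> inj; rewrite (nth_map 0) ?size_iota // nth_iota // add0n.
by rewrite -[(T x).+1]/(entry T x) pos_entry // nth_content_index.
Qed.

Lemma letters_ok (T : filling nu) : T \in SYT nu -> ok (word_letters (content_word T)).
Proof.
move=> ST; have [inj _ _] := SYT_P _ ST; apply: ok_nth => a b ab ba; rewrite size_letters => bn.
have [x ex] := cell_of inj (v := a.+1) ltac:(by rewrite /= (ltn_trans ab bn)).
have [y ey] := cell_of inj (v := b.+1) ltac:(by rewrite /=).
move: ex ey ab ba => [->] [->] ab ba; rewrite !nth_letters // letter_eq.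
have ne : x != y by apply: contraTneq ab => ->; rewrite ltnn.
apply/eqP => /(tie_far ST ne) /orP[]; rewrite addn3 => h.
  by have := leq_trans h ba; rewrite ltnn.
by have := leq_trans h (ltnW ab); rewrite ltnNge leqW // leqW.
Qed.

Definition letters_split (w : seq nat) (i : nat) :=
  let g v := index (nth_content nu (pos w v.+1)) S in
  map g (iota 0 i.-2) ++ [:: g i.-2; g i.-1; g i] ++ map g (iota i.+1 (n - i.+1)).

Lemma letters_splitE w i : 1 < i < n -> word_letters w = letters_split w i.
Proof.
move=> /andP[i1 iN]; rewrite /word_letters /letters_split.
have -> : iota 0 n = iota 0 i.-2 ++ [:: i.-2; i.-1; i] ++ iota i.+1 (n - i.+1).
  have e : i.+1 = i.-2 + 3 by lia.
  rewrite -{1}(subnKC iN) iotaD add0n {1}e iotaD add0n -catA; congr (_ ++ _).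
  by rewrite /=; congr [:: _, _, _ & _]; lia.
by rewrite !map_cat.
Qed.

(** The function [f] is left abstract: the bound on [diam] is needed only to show that
    [triD (twist nu)] satisfies the hypothesis. *)
Lemma letters_move (T : filling nu) i f : T \in SYT nu -> 1 < i < n ->
  (forall X1 X2 X3, sc X1 != sc X2 -> sc X2 != sc X3 -> sc X1 != sc X3 ->
    f (letter X1) (letter X2) (letter X3) =
      app3 (cell_shuffle X1 X2 X3) (letter X1, letter X2, letter X3)) ->
  exists T', [/\ T' \in SYT nu, content_word T' = D (tau nu) i (content_word T) &
    word_letters (content_word T') = mv f i.-2 (word_letters (content_word T))].
Proof.
move=> ST iN fE; have [X1 [X2 [X3 [[e1 e2 e3] [s12 s23 s13]]]]] := SYT_cells ST iN.
have [T' [ST' eT' B F]] := D_filling ST iN e1 e2 e3 s12 s23 s13.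
exists T'; split=> //; have [inj _ _] := SYT_P _ ST; have [inj' _ _] := SYT_P _ ST'.
have g_T (U : filling nu) x v : injective U -> entry U x = v.+1 ->
    index (nth_content nu (pos (content_word U) v.+1)) S = letter x.
  by move=> iU <-; rewrite pos_entry // nth_content_index.
rewrite !(letters_splitE _ iN) /letters_split.
have same v : v < n -> v.+1 \notin [:: i.-1; i; i.+1] ->
    index (nth_content nu (pos (content_word T') v.+1)) S =
    index (nth_content nu (pos (content_word T) v.+1)) S.
  move=> vn vi; have [x ex] := cell_of inj (v := v.+1) vn.
  rewrite (g_T T x) //; apply: g_T => //; rewrite F // !inE.
  by apply: contra vi; rewrite !inE => /or3P[] /eqP h; rewrite ex h -?e1 -?e2 -?e3 eqxx ?orbT.
have i2 : i.-2.+1 = i.-1 by lia.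
have i1 : i.-1.+1 = i by lia.
case/andP: iN => i1' iN.
have -> : map (fun v => index (nth_content nu (pos (content_word T') v.+1)) S) (iota 0 i.-2) =
          map (fun v => index (nth_content nu (pos (content_word T) v.+1)) S) (iota 0 i.-2).
  by apply/eq_in_map => v; rewrite mem_iota => h; apply: same; rewrite ?inE; move: h iN; clear; lia.
have -> : map (fun v => index (nth_content nu (pos (content_word T') v.+1)) S) (iota i.+1 (n - i.+1)) =
          map (fun v => index (nth_content nu (pos (content_word T) v.+1)) S) (iota i.+1 (n - i.+1)).
  by apply/eq_in_map => v; rewrite mem_iota => h; apply: same; rewrite ?inE; move: h iN; clear; lia.
set p := map _ (iota 0 _); have sp : i.-2 = size p + 0 by rewrite addn0 size_map size_iota.
have -> : forall r, mv f i.-2 (p ++ r) = p ++ mv f 0 r by move=> r; rewrite sp mv_catr.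
congr (_ ++ _).
rewrite (g_T T X1 i.-2 inj (etrans (esym e1) (esym i2))) (g_T T X2 i.-1 inj (etrans (esym e2) (esym i1))).
rewrite (g_T T X3 i inj (esym e3)) [RHS]/= fE //.
move: B; set s := cell_shuffle _ _ _; clearbody s.
case: s => /= -[b1 b2 b3];
by rewrite (g_T T' _ i.-2 inj' (etrans b1 (esym i2))) (g_T T' _ i.-1 inj' (etrans b2 (esym i1))) (g_T T' _ i inj' b3).
Qed.

(** Letters forget which cell of a diagonal holds an entry, but entries increase to the northeast
    along a diagonal. The content word is therefore its entries sorted by letter and then by
    size. *)
Lemma letters_inj (T T' : filling nu) : T \in SYT nu -> T' \in SYT nu ->
  word_letters (content_word T) = word_letters (content_word T') -> content_word T = content_word T'.
Proof.
move=> ST ST' e; set u := word_letters (content_word T) in e.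
pose R v v' := (nth 0 u v.-1 < nth 0 u v'.-1) || (nth 0 u v.-1 == nth 0 u v'.-1) && (v <= v').
have srt (U : filling nu) : U \in SYT nu -> word_letters (content_word U) = u -> sorted R (content_word U).
  move=> SU eU; have [inj _ _] := SYT_P _ SU; rewrite sorted_map.
  apply: sub_sorted (sorted_O nu) => x y; rewrite /content_le /R /entry /= -eU !nth_letters // letter_lt letter_eq.
  case/orP=> [-> //|/andP[/eqP h]]; rewrite h eqxx ltxx /= leq_eqVlt => /orP[/eqP h'|h'].
    by rewrite (sc_row_inj h h').
  by rewrite ltnS; apply: leq_trans (diag_far SU h h'); rewrite leq_addr.
have [inj _ _] := SYT_P _ ST; have [inj' _ _] := SYT_P _ ST'.
apply: (sorted_eq _ _ (srt _ ST erefl) (srt _ ST' (esym e))).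
- move=> b a c; rewrite /R; clear; lia.
- by move=> a b; rewrite /R => h; apply/eqP; move: h; clear; lia.
apply: uniq_perm; rewrite ?uniq_word // => v; by rewrite !mem_word.
Qed.

Lemma diam_ge4 (x1 x2 x3 x4 : int) : {subset [:: x1; x2; x3; x4] <= S} ->
  (x1 < x2)%R -> (x2 < x3)%R -> (x3 < x4)%R -> (x4 - x1 <= k%:Z)%R -> 4 <= diam nu.
Proof.
move=> sub h1 h2 h3 h4.
have mem x : x \in [:: x1; x2; x3; x4] -> x \in shifted_contents nu by move/sub; rewrite mem_sort.
pose z x (h : x \in [:: x1; x2; x3; x4]) : seq_sub (shifted_contents nu) := SeqSub (mem x h).
pose R := [set z : seq_sub (shifted_contents nu) | val z \in [:: x1; x2; x3; x4]].
have u4 : uniq [:: x1; x2; x3; x4] by rewrite /= !inE; move: h1 h2 h3; clear; lia.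
have <- : #|R| = 4.
  rewrite cardE -(size_map val) -[4]/(size [:: x1; x2; x3; x4]); apply: perm_size.
  apply: uniq_perm => //; first by rewrite (map_inj_uniq val_inj) enum_uniq.
  move=> x; apply/mapP/idP => [[y + ->]|h]; first by rewrite mem_enum inE.
  by exists (z x h); rewrite // mem_enum inE.
rewrite /diam; apply: (@leq_bigmax_cond _ _ (fun R : {set seq_sub (shifted_contents nu)} => #|R|) R).
apply/forallP => x; apply/implyP; rewrite inE => hx; apply/forallP => y; apply/implyP; rewrite inE => hy.
by move: hx hy; rewrite !inE => /or4P[] /eqP -> /or4P[] /eqP ->; move: h1 h2 h3 h4; clear; lia.
Qed.

Lemma diam_gt3 : 3 < diam nu -> exists x1 x2 x3 x4 : int, [/\ {subset [:: x1; x2; x3; x4] <= S},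
  (x1 < x2)%R, (x2 < x3)%R, (x3 < x4)%R & (x4 - x1 <= k%:Z)%R].
Proof.
rewrite ltnNge => /bigmax_leqP H.
have [R /andP[/forallP hR c]] : exists R : {set seq_sub (shifted_contents nu)},
   [forall x in R, forall y in R, (`|val x - val y| <= k%:Z)%R] && (3 < #|R|).
  apply/existsP; apply: contraT; rewrite negb_exists => /forallP h; case: H => R hR.
  by have := h R; rewrite hR /= -leqNgt.
pose s := sort <=%R [seq val x | x <- enum R].
have ss : size s = #|R| by rewrite size_sort size_map -cardE.
have us : uniq s by rewrite sort_uniq (map_inj_uniq val_inj) enum_uniq.
have so : sorted <%R s by rewrite lt_sorted_uniq_le us sort_sorted //; apply: le_total.
have ms x : x \in s -> exists2 y, y \in R & x = val y.
  by rewrite mem_sort => /mapP[y]; rewrite mem_enum => hy ->; exists y.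
have {ss} : 3 < size s by rewrite ss.
case: s us so ms => [|x1 [|x2 [|x3 [|x4 s]]]] //= _ /and4P[h1 h2 h3 _] ms _.
exists x1, x2, x3, x4; split=> //.
  move=> x hx; have [|y _ ->] := ms x; last by rewrite mem_sort; exact: valP.
  by move: hx; rewrite !inE => /or4P[] ->; rewrite ?orbT.
have [|y yR ->] := ms x1; first by rewrite inE eqxx.
have [|y' yR' ->] := ms x4; first by rewrite !inE eqxx !orbT.
have /implyP/(_ yR')/forallP/(_ y)/implyP/(_ yR) := hR y'.
by apply: le_trans; apply: ler_norm.
Qed.

Section Small.
Hypothesis small : diam nu <= 3.

(** A content other than that of [b] between those of [a] and [c] would give four contents within
    distance [k], so the three ranks are consecutive. *)
Lemma twist_close (a b c : cell) : (sc a < sc b)%R -> (sc b < sc c)%R ->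
  (letter c == (letter a).+2) && twist (letter a) = (sc c - sc a <= k%:Z)%R.
Proof.
move=> ab bc; have lab : letter a < letter b by rewrite letter_lt.
have lbc : letter b < letter c by rewrite letter_lt.
apply/idP/idP => [/andP[/eqP e /andP[_]]|h]; first by rewrite -e !nth_letter.
have e : letter c = (letter a).+2.
  apply/eqP; rewrite eqn_leq; apply/andP; split; last by apply: leq_ltn_trans lbc.
  rewrite leqNgt; apply/negP => lt; move: small; rewrite leqNgt; apply/negP; rewrite negbK.
  have lS := letter_lt_size c.
  pose j := if letter b == (letter a).+1 then (letter b).+1 else (letter a).+1.
  have [j1 j2 j3] : [/\ letter a < j, j < letter c & j != letter b].
    by rewrite /j; case: eqP => h1; split; move: h1 lab lbc lt; clear; lia.
  have jS : j < size S by apply: ltn_trans lS.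
  have xS := mem_nth 0%R jS; set x := nth 0%R S j in xS.
  have ltS v w : v < size S -> w < size S -> v < w -> (nth 0%R S v < nth 0%R S w)%R.
    move=> hv hw vw; rewrite lt_neqAle nth_uniq ?uniq_S // ltn_eqF //=.
    by apply: (sorted_leq_nth le_trans (fun x => lexx x) 0%R sorted_S) => //; apply: ltnW.
  have ax : (sc a < x)%R by rewrite -nth_letter; apply: ltS => //; apply: letter_lt_size.
  have xc : (x < sc c)%R by rewrite -(nth_letter c); apply: ltS.
  case: (ltngtP j (letter b)) j3 => // jb _.
    have xb : (x < sc b)%R by rewrite -(nth_letter b); apply: ltS => //; apply: letter_lt_size.
    apply: (@diam_ge4 (sc a) x (sc b) (sc c)) => // z; rewrite !inE.
    by case/or4P=> /eqP ->; rewrite ?mem_S.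
  have xb : (sc b < x)%R by rewrite -(nth_letter b); apply: ltS => //; apply: letter_lt_size.
  apply: (@diam_ge4 (sc a) (sc b) x (sc c)) => // z; rewrite !inE.
  by case/or4P=> /eqP ->; rewrite ?mem_S.
by rewrite e eqxx /twist -e letter_lt_size !nth_letter h.
Qed.

Lemma triD_letters X1 X2 X3 : sc X1 != sc X2 -> sc X2 != sc X3 -> sc X1 != sc X3 ->
  triD twist (letter X1) (letter X2) (letter X3) =
  app3 (cell_shuffle X1 X2 X3) (letter X1, letter X2, letter X3).
Proof.
move=> s12 s23 s13; rewrite /triD /cell_shuffle /between !letter_lt; set close := (_ == _.+2) && _.
have far (x y z : cell) M m : (sc x < sc y < sc z)%R ->
    (letter x < letter y -> letter y < letter z -> M = letter z /\ m = letter x) ->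
    (M == m.+2) && twist m = (`|sc x - sc z| <= k%:Z)%R.
  move=> /andP[h1 h2]; rewrite !letter_lt => /(_ h1 h2)[-> ->].
  by rewrite (twist_close h1 h2); move: h1 h2; clear; lia.
case: ifPn => // n1; have [m|m] := boolP ((sc X2 < sc X1 < sc X3)%R || _).
  suff -> : close = (`|sc X2 - sc X3| <= k%:Z)%R by case: ifP.
  by rewrite /close; case/orP: m => m; [|rewrite distrC]; apply: far m _; clear; lia.
suff -> : close = (`|sc X1 - sc X2| <= k%:Z)%R by case: ifP.
have m' : (sc X1 < sc X3 < sc X2)%R || (sc X2 < sc X3 < sc X1)%R.
  by move: n1 m s12 s23 s13; clear; lia.
by rewrite /close; case/orP: m' => m'; [|rewrite distrC]; apply: far m' _; clear; lia.
Qed.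
End Small.
End Letters.

(** * Tableaux as Yamanouchi words *)

(** The list stops at the first empty row because a partition has no zero parts. *)
Definition rows_of (y : seq nat) : seq nat :=
  [seq cnt y r | r <- iota 0 (find (fun r => cnt y r == 0) (iota 0 (size y).+1))].

Definition has_shape (y la : seq nat) := forall r, nth 0 la r = cnt y r.

Lemma yam_cnt_out y r : yam y -> size y <= r -> cnt y r = 0.
Proof.
by move=> Hy h; apply/count_memPn; apply: contraTN h => ry; rewrite -ltnNge; apply: yam_bound.
Qed.

Lemma rows_ofP y : yam y -> is_partition (rows_of y) /\ has_shape y (rows_of y).
Proof.
move=> Hy; have A := yam_antitone Hy; rewrite /rows_of; pose P r := cnt y r == 0; rewrite -/P; set m := find _ _.
have hp : has P (iota 0 (size y).+1).
  by apply/hasP; exists (size y); rewrite ?mem_iota ?add0n ?ltnSn // /P yam_cnt_out.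
have mn : m < (size y).+1 by have := hp; rewrite has_find size_iota.
have zm : cnt y m = 0 by have := nth_find 0 hp; rewrite nth_iota // => /eqP.
split.
  apply/andP; split.
    apply: homo_sorted (iota_sorted 0 m) => i j ij /=; exact: antitone_le A ij.
  apply/mapP => -[r]; rewrite mem_iota add0n /= => rm; apply/eqP.
  have := before_find 0 rm; rewrite nth_iota; last exact: ltn_trans rm mn.
  by rewrite /P add0n eq_sym => ->.
move=> r; case: (ltnP r m) => rm; first by rewrite (nth_map 0) ?size_iota // nth_iota.
rewrite nth_default ?size_map ?size_iota //; apply/esym/eqP; rewrite -leqn0 -zm.
exact: antitone_le A rm.
Qed.

(** The cell, as row and column, that holds the entry [v+1] in the tableau of [y]. *)
Definition cell_pos (y : seq nat) (v : nat) : nat * nat :=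
  (nth 0 y v, cnt (take v y) (nth 0 y v)).

Lemma cnt_take_lt y v w : v < w -> w <= size y -> cnt (take v y) (nth 0 y v) < cnt (take w y) (nth 0 y v).
Proof.
move=> vw wy; have vy : v < size y by apply: leq_trans wy.
rewrite -(cat_take_drop v.+1 (take w y)) take_takel // cnt_cat (take_nth 0) // cnt_rcons eqxx.
by rewrite addn1 addSn ltnS leq_addr.
Qed.

Lemma cell_pos_inj y v w : v < size y -> w < size y -> cell_pos y v = cell_pos y w -> v = w.
Proof.
wlog vw : v w / v < w.
  move=> H vy wy e; case: (ltngtP v w) => h //; first exact: H.
  by apply/esym/H.
by move=> vy wy [e1]; have := cnt_take_lt vw (ltnW wy); rewrite -e1 => /ltn_eqF/eqP.
Qed.

Lemma cell_pos_exists y r c : c < cnt y r -> exists2 v, v < size y & cell_pos y v = (r, c).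
Proof.
elim/last_ind: y => // y s IH; rewrite cnt_rcons size_rcons => h.
have [lt|ge] := ltnP c (cnt y r).
  have [v vy e] := IH lt; exists v; first exact: ltnW.
  by rewrite -e /cell_pos nth_rcons vy -cats1 takel_cat // ltnW.
have e : s = r by apply/eqP; move: h ge; case: eqP => //; clear; lia.
exists (size y); rewrite ?ltnSn // /cell_pos nth_rcons ltnn eqxx -cats1 take_size_cat // e.
by congr (_, _); move: h ge; rewrite e eqxx; clear; lia.
Qed.

Section Tableau.
Variable la : partition.
Notation nu := (one_shape la).
Notation cell := (cell nu).
Notation n := (ncells nu).

Lemma one_in_shape i r c : @in_shape 1 nu i r c = (c < nth 0 la r).
Proof. by rewrite /in_shape (tnth_nth (straight_shape la)) (ord1 i) /= nth_nil. Qed.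

Lemma cell1_eq (x y : cell) : cell_row x = cell_row y -> cell_column x = cell_column y -> x = y.
Proof. by move=> h1 h2; apply: cell_eq => //; rewrite [LHS]ord1 [RHS]ord1. Qed.

Section Word.
Variable y : seq nat.
Hypotheses (Hy : yam y) (shp : has_shape y la).

Lemma cell_of_pos v : v < size y -> exists x : cell, (cell_row x, cell_column x) = cell_pos y v.
Proof.
move=> vy; have : @in_shape 1 nu ord0 (nth 0 y v) (cnt (take v y) (nth 0 y v)).
  by rewrite one_in_shape shp; have := cnt_take_lt vy (leqnn _); rewrite take_size.
by case/cell_exists=> x [_ h1 h2]; exists x; rewrite h1 h2.
Qed.

Lemma pos_of_cell (x : cell) : exists2 v, v < size y & (cell_row x, cell_column x) = cell_pos y v.
Proof.
have := cellP x; rewrite one_in_shape shp => /cell_pos_exists[v vy e]; by exists v.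
Qed.

Definition entry_of (x : cell) : nat :=
  find (fun v => cell_pos y v == (cell_row x, cell_column x)) (iota 0 (size y)).

Lemma entry_ofP x : entry_of x < size y /\ cell_pos y (entry_of x) = (cell_row x, cell_column x).
Proof.
have [v vy e] := pos_of_cell x.
have h : has (fun v => cell_pos y v == (cell_row x, cell_column x)) (iota 0 (size y)).
  by apply/hasP; exists v; rewrite ?mem_iota //= e.
have lt : entry_of x < size y by move: h; rewrite has_find size_iota.
by split=> //; have := nth_find 0 h; rewrite nth_iota // => /eqP.
Qed.

Lemma entry_of_eq x v : v < size y -> cell_pos y v = (cell_row x, cell_column x) -> entry_of x = v.
Proof. by have [h1 h2] := entry_ofP x; rewrite -h2 => vy /(cell_pos_inj vy h1). Qed.

Let entry_ord (x : cell) : 'I_(size y) := Ordinal (proj1 (entry_ofP x)).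

Let entry_ord_inj : injective entry_ord.
Proof.
move=> x x' /(congr1 val) /= e; have [_ h1] := entry_ofP x; have [_ h2] := entry_ofP x'.
by move: h1; rewrite e h2 => -[e1 e2]; apply: cell1_eq.
Qed.

Lemma ncells_yam : n = size y.
Proof.
rewrite /ncells -(card_codom entry_ord_inj) -[RHS]card_ord; apply: eq_card => v.
rewrite inE; apply/codomP; have [x ex] := cell_of_pos (ltn_ord v); exists x.
by apply: val_inj => /=; rewrite (entry_of_eq (ltn_ord v) (esym ex)).
Qed.

Definition tab_of (t : filling nu) := forall x, cell_pos y (t x) = (cell_row x, cell_column x).

Lemma cell_pos_mono v w : v < size y -> w < size y ->
  (cell_pos y v).1 = (cell_pos y w).1 -> (cell_pos y v).2 < (cell_pos y w).2 -> v < w.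
Proof.
rewrite /= => vy wy e; rewrite e; case: (ltngtP v w) => // [lt|->]; last by rewrite ltnn.
by rewrite ltnNge => /negP[]; apply: ltnW; rewrite -e; have := cnt_take_lt lt (ltnW vy); rewrite e.
Qed.

(* The lattice condition at the prefix ending with the (c+1)-st letter of the upper row. *)
Lemma cell_pos_column v w : v < size y -> w < size y ->
  (cell_pos y v).1 < (cell_pos y w).1 -> (cell_pos y v).2 = (cell_pos y w).2 -> v < w.
Proof.
rewrite /= => vy wy lt e; rewrite ltnNge; apply/negP => wv.
have A := antitone_le (Hy w.+1) (ltnW lt).
have := cnt_take_lt (ltnSn w) wy.
move: A; rewrite (take_nth 0 wy) !cnt_rcons eqxx (gtn_eqF lt) addn0 addn1 => A _.
have := antitone_le (Hy v.+1) (ltnW lt).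
have h : cnt (take w y) (nth 0 y v) <= cnt (take v y) (nth 0 y v).
  by rewrite -(cat_take_drop w (take v y)) take_takel // cnt_cat leq_addr.
by move: h; rewrite e => h _; have := leq_trans A h; rewrite ltnn.
Qed.

Lemma tab_exists : exists2 t, t \in SYT nu & tab_of t.
Proof.
have b x : entry_of x < n by rewrite ncells_yam; case: (entry_ofP x).
exists [ffun x => Ordinal (b x)]; last by move=> x; rewrite ffunE; case: (entry_ofP x).
apply/SYT_P; split=> [x x'|x x' _ er lt|x x' _ ec lt]; rewrite !ffunE.
- by move=> [e]; apply: entry_ord_inj; apply: val_inj.
- have [h1 h2] := entry_ofP x; have [h3 h4] := entry_ofP x'.
  by apply: cell_pos_mono; rewrite ?h2 ?h4.
have [h1 h2] := entry_ofP x; have [h3 h4] := entry_ofP x'.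
by apply: cell_pos_column; rewrite ?h2 ?h4.
Qed.

Lemma tab_of_uniq t t' : tab_of t -> tab_of t' -> t = t'.
Proof.
move=> h h'; apply/ffunP => x; apply: val_inj => /=; have := h x; rewrite -(h' x).
by apply: cell_pos_inj; rewrite -ncells_yam.
Qed.

Lemma tab_cell t v : tab_of t -> v < size y -> exists2 x, t x = v :> nat & (cell_row x, cell_column x) = cell_pos y v.
Proof.
move=> h vy; have [x ex] := cell_of_pos vy; exists x => //.
by have := h x; rewrite ex; apply: cell_pos_inj => //; rewrite -ncells_yam.
Qed.
End Word.

Notation O := (sort (@row_reading_le la) (enum cell)).

Lemma rr_total : total (@row_reading_le la).
Proof. by move=> x y; rewrite /row_reading_le; lia. Qed.

Lemma rr_trans : transitive (@row_reading_le la).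
Proof. by move=> y x z; rewrite /row_reading_le; lia. Qed.

Lemma mem_rr x : x \in O. Proof. by rewrite mem_sort mem_enum. Qed.
Lemma uniq_rr : uniq O. Proof. by rewrite sort_uniq enum_uniq. Qed.
Lemma index_rr x x' : x != x' -> (index x O < index x' O) = row_reading_le x x'.
Proof.
move=> ne; apply/idP/idP => h.
  by apply: (@sorted_ltn_index _ _ rr_trans O (sort_sorted rr_total _)); rewrite ?mem_rr.
rewrite ltnNge; apply/negP => h'.
have rr_refl : reflexive (@row_reading_le la) by move=> z; rewrite /row_reading_le eqxx leqnn orbT.
have : row_reading_le x' x.
  by apply: (@sorted_leq_index _ _ rr_trans rr_refl O (sort_sorted rr_total _)); rewrite ?mem_rr.
move: h; rewrite /row_reading_le => h h''; move/eqP: ne; apply.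
by apply: cell1_eq; move: h h''; clear; lia.
Qed.

Lemma tab_inj y t : tab_of y t -> injective t.
Proof. by move=> h x x' e; have := h x; rewrite e h => -[e1 e2]; apply: cell1_eq. Qed.

Lemma has_shape_perm y y' : perm_eq y y' -> has_shape y la -> has_shape y' la.
Proof. by move=> P h r; rewrite h (perm_cnt _ P). Qed.

Lemma cell_pos_move y j v : j.+2 < size y -> v \notin [:: j; j.+1; j.+2] -> v < size y ->
  cell_pos (mv trid j y) v = cell_pos y v.
Proof.
move=> jy vj vy; have [p [a [b [c [s [-> sp ->]]]]]] := mv_split trid jy.
have Q : perm_eq [:: (trid a b c).1.1; (trid a b c).1.2; (trid a b c).2] [:: a; b; c] by exact: perm_trid.
case: (ltnP v j) => h.
  by rewrite /cell_pos !nth_cat !take_cat sp h.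
have h3 : 2 < v - j by move: vj h; rewrite !inE !negb_or; clear; lia.
rewrite /cell_pos !nth_cat !take_cat sp ltnNge h /= -(subnK h3).
rewrite !addn3 /=; congr (_, _); rewrite !cnt_cat; congr (_ + _).
rewrite -[LHS]/(cnt ([:: _; _; _] ++ take _ s) _) -[RHS]/(cnt ([:: a; b; c] ++ take _ s) _).
by rewrite !cnt_cat (perm_cnt _ Q).
Qed.

(** Words are compared through positions. On one side [D_pos] permutes the positions of three cells;
    on the other [trid] permutes their rows, by the same [shuffle] since the rows of consecutive
    entries determine their reading order ([trid_code]). *)
Lemma tab_move y t t' j : yam y -> has_shape y la -> tab_of y t -> tab_of (mv trid j y) t' ->
  j.+2 < size y -> map (entry t') O = d j.+2 (map (entry t) O).
Proof.
move=> Hy shp h h' jy; have inj := tab_inj h; have inj' := tab_inj h'.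
have Hy' := yam_mvd j Hy; have P := perm_mvd j y.
have shp' : has_shape (mv trid j y) la by apply: has_shape_perm shp; rewrite perm_sym.
have sn := ncells_yam shp; have sn' := ncells_yam shp'.
have [X1 e1 c1] := tab_cell shp h (ltnW (ltnW jy)).
have [X2 e2 c2] := tab_cell shp h (ltnW jy).
have [X3 e3 c3] := tab_cell shp h jy.
have le x x' v v' : v < v' -> v' < size y -> (cell_row x, cell_column x) = cell_pos y v ->
    (cell_row x', cell_column x') = cell_pos y v' ->
    x != x' /\ ((index x O).+1 < (index x' O).+1) = (nth 0 y v' <= nth 0 y v).
  move=> vv' v'y ex ex'; have vy := ltn_trans vv' v'y; have ne : x != x'.
    apply: contraTneq vv' => E; have e : cell_pos y v = cell_pos y v' by rewrite -ex -ex' E.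
    by rewrite (cell_pos_inj _ v'y e) ?ltnn.
  split=> //; rewrite ltnS index_rr // /row_reading_le.
  move: ex ex' => [-> ->] [-> ->]; have := cnt_take_lt vv' (ltnW v'y).
  by case: (ltngtP (nth 0 y v') (nth 0 y v)) => //= -> /ltnW ->.
have [n12 l12] := le _ _ _ _ (ltnSn _) (ltnW jy) c1 c2.
have [n23 l23] := le _ _ _ _ (ltnSn _) jy c2 c3.
have [n13 l13] := le _ _ _ _ (ltnW (ltnSn _)) jy c1 c3.
have uO := uniq_rr; have fO := mem_rr.
have uw : uniq (map (entry t) O) by apply: fword_uniq.
have uw' : uniq (map (entry t') O) by apply: fword_uniq.
have mw v : (v \in map (entry t) O) = (0 < v <= n) by apply: fword_mem.
have mw' v : (v \in map (entry t') O) = (0 < v <= n) by apply: fword_mem.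
have sub : {subset [:: j.+2.-1; j.+2; j.+3] <= map (entry t) O}.
  by move=> v; rewrite mw !inE sn => /or3P[] /eqP ->; move: jy; clear; lia.
have p1 : pos (map (entry t) O) j.+1 = (index X1 O).+1 by rewrite -e1; apply: fword_pos.
have p2 : pos (map (entry t) O) j.+2 = (index X2 O).+1 by rewrite -e2; apply: fword_pos.
have p3 : pos (map (entry t) O) j.+3 = (index X3 O).+1 by rewrite -e3; apply: fword_pos.
have [Q E F] := D_pos (fun=> 0) uw (isT : 0 < j.+2) sub p1 p2 p3.
have i0 : (last_pos j.+2 (map (entry t) O) <= 0) = false by rewrite /last_pos leqNgt leq_max.
rewrite i0 in E; rewrite -D0; apply: eq_from_pos => //.
  apply: uniq_perm => //; first by rewrite (perm_uniq Q).
  by move=> v; rewrite (perm_mem Q) mw mw'.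
have look x v : v < size y -> cell_pos (mv trid j y) v = (cell_row x, cell_column x) -> t' x = v :> nat.
  move=> vy ex; have := h' x; rewrite -ex; apply: cell_pos_inj; rewrite ?size_mv //.
  by rewrite -(size_mv trid j) -sn'.
set s := code _ _ _ _ in E.
have [k1 k2 k3] : [/\ t' (app3 s (X1, X2, X3)).1.1 = j :> nat, t' (app3 s (X1, X2, X3)).1.2 = j.+1 :> nat
    & t' (app3 s (X1, X2, X3)).2 = j.+2 :> nat].
  have [p [a [b [c [z [ey sp ey']]]]]] := mv_split trid jy.
  have ea : nth 0 y j = a by rewrite ey nth_cat sp ltnn subnn.
  have eb : nth 0 y j.+1 = b by rewrite ey nth_cat sp ltnNge leqnSn subSnn.
  have ec : nth 0 y j.+2 = c by rewrite ey nth_cat sp ltnNge ltnW // -addn2 addKn.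
  rewrite ea eb in l12; rewrite eb ec in l23; rewrite ea ec in l13.
  have d (x x' : cell) : x != x' -> (index x O).+1 != (index x' O).+1.
    by apply: contra => /eqP[/(index_inj x (fO _) (fO _)) ->].
  have [m12 m23 m13] := And3 (d _ _ n12) (d _ _ n23) (d _ _ n13).
  have tc := trid_code l12 l23 l13 m12 m23 m13; rewrite -/s in tc.
  have P3 a' b' c' : [/\ cell_pos (p ++ [:: a', b', c' & z]) j = (a', cnt p a'),
      cell_pos (p ++ [:: a', b', c' & z]) j.+1 = (b', cnt p b' + (a' == b')) &
      cell_pos (p ++ [:: a', b', c' & z]) j.+2 = (c', cnt p c' + (a' == c') + (b' == c'))].
    rewrite /cell_pos !nth_cat !take_cat sp ltnn subnn !(ltnNge _ j) leqnSn (ltnW (leqnSn _)) /=.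
    by rewrite subSnn -addn2 addKn /= ?take0 ?cats0 !cntE ?addn0 ?addnA.
  have [y1 y2 y3] := P3 a b c; rewrite -ey in y1 y2 y3.
  have [z1 z2 z3] := P3 (trid a b c).1.1 (trid a b c).1.2 (trid a b c).2.
  rewrite -ey' in z1 z2 z3; rewrite y1 in c1; rewrite y2 in c2; rewrite y3 in c3.
  have [j0 j1] : j < size y /\ j.+1 < size y by split; apply: ltnW => //; apply: ltnW.
  (* Permuting rows amounts to permuting cells only if the exchanged rows differ, since the column
     of an entry counts the earlier letters of its row. *)
  have nab : s = SwapFst -> a != b.
    by rewrite /s /code /between; case: ifP => // k1; case: ifP => // k2 _; move: l12 l23 l13 k1 k2 m12 m23 m13; clear; lia.
  have nbc : s = SwapLst -> b != c.
    by rewrite /s /code /between; case: ifP => // k1; case: ifP => // k2 _; move: l12 l23 l13 k1 k2 m12 m23 m13; clear; lia.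
  have nL : s <> RotL by rewrite /s /code; case: ifP => // _; case: ifP.
  have nR : s <> RotR by rewrite /s /code; case: ifP => // _; case: ifP.
  clearbody s; rewrite tc in z1 z2 z3; clear -look c1 c2 c3 z1 z2 z3 nab nbc nL nR j0 j1 jy.
  case: s z1 z2 z3 nab nbc nL nR => //= z1 z2 z3 nab nbc _ _; split; apply: look => //;
    rewrite ?z1 ?z2 ?z3 ?c1 ?c2 ?c3 //; try (move/(_ erefl): nab => nab); try (move/(_ erefl): nbc => nbc);
    congr (_, _); rewrite ?(negPf nab) ?(negPf nbc) ?addn0 // 1?eq_sym ?(negPf nab) ?(negPf nbc) ?addn0 //;
    by clear -nab nbc; lia.
have posE x v : t' x = v :> nat -> pos (map (entry t') O) v.+1 = (index x O).+1.
  by move=> <-; apply: fword_pos.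
move=> v; rewrite mw' => /andP[v0 vn]; case: (boolP (v \in [:: j.+1; j.+2; j.+3])) => vj; last first.
  rewrite F //; have vy : v.-1 < size y by rewrite -sn prednK.
  have [x ex cx] := tab_cell shp h vy.
  have ev : v = v.-1.+1 by rewrite prednK.
  rewrite ev (posE x); first by rewrite -ex; apply/esym/fword_pos.
  apply: look => //; rewrite cell_pos_move ?cx //; apply: contra vj.
  by rewrite {2}ev !inE !eqSS.
have {}E : [/\ pos (D (fun=> 0) j.+2 (map (entry t) O)) j.+1 = (index (app3 s (X1, X2, X3)).1.1 O).+1,
    pos (D (fun=> 0) j.+2 (map (entry t) O)) j.+2 = (index (app3 s (X1, X2, X3)).1.2 O).+1
  & pos (D (fun=> 0) j.+2 (map (entry t) O)) j.+3 = (index (app3 s (X1, X2, X3)).2 O).+1].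
  by clearbody s; move: E; case: s {k1 k2 k3} => /= -[h1 h2 h3]; rewrite /pos h1 h2 h3.
case: E => E1 E2 E3; move: vj; rewrite !inE => /or3P[] /eqP ->.
- by rewrite (posE _ _ k1).
- by rewrite (posE _ _ k2).
by rewrite (posE _ _ k3).
Qed.

Lemma tab_of_inj y y' t : has_shape y la -> has_shape y' la -> tab_of y t -> tab_of y' t -> y = y'.
Proof.
move=> s s' h h'; have e := ncells_yam s; have e' := ncells_yam s'.
apply: (@eq_from_nth _ 0) => [|v vy]; first by rewrite -e.
have [x <- [<- _]] := tab_cell s h vy.
by have := h' x => -[].
Qed.

Lemma row_word_inj (t t' : filling nu) : injective t -> injective t' ->
  map (entry t) O = map (entry t') O -> t = t'.
Proof.
move=> i i' /eq_in_map h; apply/ffunP => x; apply: val_inj.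
by have [] := h x (mem_rr x).
Qed.
End Tableau.

(** * Small diameter *)

Lemma nth_mv_out f j u v : v \notin [:: j; j.+1; j.+2] -> nth 0 (mv f j u) v = nth 0 u v.
Proof.
move=> vj; case: (leqP (size u) j.+2) => [/mv_out -> // | ju].
have [p [a [b [c [s [-> sp ->]]]]]] := mv_split f ju; rewrite !nth_cat sp; case: ltnP => // h.
have h3 : 2 < v - j by move: vj h; rewrite !inE !negb_or; clear; lia.
by rewrite -(subnK h3) !addn3.
Qed.

Lemma nth_mv_in f j u : j.+2 < size u ->
  let t := f (nth 0 u j) (nth 0 u j.+1) (nth 0 u j.+2) in
  [/\ nth 0 (mv f j u) j = t.1.1, nth 0 (mv f j u) j.+1 = t.1.2 & nth 0 (mv f j u) j.+2 = t.2].
Proof.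
move=> ju; have [p [a [b [c [s [-> sp ->]]]]]] := mv_split f ju; rewrite !nth_cat sp.
by rewrite ltnn subnn !(ltnNge _ j) leqnSn (ltnW (leqnSn _)) /= subSnn -addn2 addKn.
Qed.

Lemma mvd_fix y j : j.+2 < size y ->
  (mv trid j y == y) = ((nth 0 y j.+1 <= nth 0 y j) == (nth 0 y j.+2 <= nth 0 y j.+1)).
Proof.
move=> jy; have [p [a [b [c [s [-> sp ->]]]]]] := mv_split trid jy.
rewrite eqseq_cat // eqxx /= !nth_cat sp ltnn subnn !(ltnNge _ j) leqnSn (ltnW (leqnSn _)) /=.
rewrite subSnn -addn2 addKn /= !eqseq_cons eqxx andbT /trid.
by case: ifP => h1 /=; [|case: ifP => h2 /=]; rewrite ?eqxx; lia.
Qed.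

Lemma code_invol p q r : p != q -> q != r -> p != r ->
  let t := app3 (code false p q r) (p, q, r) in app3 (code false t.1.1 t.1.2 t.2) t = (p, q, r).
Proof.
move=> h1 h2 h3; rewrite /code; case k1 : (between p q r); first by rewrite /= k1.
case k2 : (between q p r) => /=.
  have -> : between p r q = false by move: k1 k2; rewrite /between; clear; lia.
  by have -> : between r p q by move: k1 k2; rewrite /between; clear; lia.
have -> : between q p r = false by [].
by have -> : between p q r = false by [].
Qed.

Lemma dK i w : uniq w -> 0 < i -> {subset [:: i.-1; i; i.+1] <= w} -> d i (d i w) = w.
Proof.
move=> uw i0 sub; rewrite -!D0; set w1 := D _ i w.
have [P1 E1 F1] := D_pos (fun=> 0) uw i0 sub erefl erefl erefl; rewrite -/w1 in P1 E1 F1.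
have uw1 : uniq w1 by rewrite (perm_uniq P1).
have sub1 : {subset [:: i.-1; i; i.+1] <= w1} by move=> v /sub; rewrite (perm_mem P1).
have [P2 E2 F2] := D_pos (fun=> 0) uw1 i0 sub1 erefl erefl erefl.
have far u : (last_pos i u <= 0) = false by rewrite /last_pos leqNgt leq_max.
rewrite !far in E1 E2.
have ne a b : a \in [:: i.-1; i; i.+1] -> b \in [:: i.-1; i; i.+1] -> a != b -> pos w a != pos w b.
  by move=> /sub ha /sub hb; apply: contra => /eqP/(pos_inj ha hb) ->.
have K : (pos (D (fun=> 0) i w1) i.-1, pos (D (fun=> 0) i w1) i, pos (D (fun=> 0) i w1) i.+1) =
    (pos w i.-1, pos w i, pos w i.+1).
  rewrite E2; have := @code_invol (pos w i.-1) (pos w i) (pos w i.+1).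
  rewrite -E1 /=; apply; apply: ne; rewrite ?inE ?eqxx ?orbT //; move: i0; clear; lia.
case: K => k1 k2 k3; apply: eq_from_pos.
- by rewrite (perm_uniq P2).
- exact: perm_trans P2 P1.
move=> v _; case: (boolP (v \in [:: i.-1; i; i.+1])) => vi; last by rewrite F2 ?F1.
by move: vi; rewrite !inE => /or3P[] /eqP ->; [exact: (congr1 succn k1)|exact: (congr1 succn k2)|exact: (congr1 succn k3)].
Qed.

Lemma trid_desc p q r : (q <= p) != (r <= q) -> let t := trid p q r in
  (t.1.2 <= t.1.1) = ~~ (q <= p) /\ (t.2 <= t.1.2) = ~~ (r <= q).
Proof.
rewrite /trid; case: (leqP q p) => h1; case: (leqP r q) => h2 // _; case: ifP => h3 /=; try (case: ifP => h4 /=);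
  split; apply/eqP; rewrite ?eqb_id ?eqbF_neg; move: h1 h2 h3; try move: h4; clear; lia.
Qed.

(** This and [trid_next] are (Ax3) in terms of rows, with [e] the row of the entry just before or
    just after the three that move. *)
Lemma trid_prev e p q r : (q <= p) != (r <= q) -> let t := trid p q r in
  ((p <= e) == ~~ (q <= p)) || ((t.1.1 <= e) == ~~ (t.1.2 <= t.1.1)).
Proof.
rewrite /trid; case: (leqP q p) => h1; case: (leqP r q) => h2 // _; case: ifP => h3 /=; try (case: ifP => h4 /=);
  rewrite ?eqb_id ?eqbF_neg; move: h1 h2 h3; try move: h4; clear; lia.
Qed.

Lemma trid_next e p q r : (q <= p) != (r <= q) -> let t := trid p q r in
  ((r <= q) == ~~ (e <= r)) || ((t.2 <= t.1.2) == ~~ (e <= t.2)).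
Proof.
rewrite /trid; case: (leqP q p) => h1; case: (leqP r q) => h2 // _; case: ifP => h3 /=; try (case: ifP => h4 /=);
  rewrite ?eqb_id ?eqbF_neg; move: h1 h2 h3; try move: h4; clear; lia.
Qed.

Section Small.
Variables (k : nat) (nu : k.-tuple skew_shape).
Hypothesis small : diam nu <= 3.
Notation n := (ncells nu).
Notation G := (LLT_graph nu).
Notation T0 := (twist nu).
Notation mD := (mv (triD T0)).
Notation rD := (run (triD T0)).
Notation md := (mv trid).
Notation rd := (run trid).
Notation wd v := (val (v : LLT_vertex nu)).

Definition uv (v : vertex G) : seq nat := word_letters nu (wd v).
Definition valid (u : seq nat) : Prop :=
  exists T t, T \in SYT nu /\ word_letters nu (content_word T) = u ++ t.
Definition Y (v : vertex G) : seq nat := phi T0 (uv v).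

Lemma vertexP (v : vertex G) : exists2 T, T \in SYT nu & content_word T = wd v.
Proof.
have /mapP[T hT e] := ssvalP (v : LLT_vertex nu).
by exists T => //; rewrite mem_enum in hT.
Qed.

Lemma vertex_of (T : filling nu) : T \in SYT nu -> exists v : vertex G, wd v = content_word T.
Proof.
move=> ST; have h : content_word T \in LLT_words nu by apply: map_f; rewrite mem_enum.
by exists (SeqSub h : LLT_vertex nu).
Qed.

Lemma uv_inj : injective uv.
Proof.
move=> v w e; apply: val_inj; have [T ST ev] := vertexP v; have [U SU ew] := vertexP w.
by rewrite /= -ev -ew; apply: letters_inj; rewrite // ev ew.
Qed.

Lemma size_uv v : size (uv v) = n.
Proof. exact: size_letters. Qed.

Lemma uv_valid v : valid (uv v).
Proof. by have [T ST e] := vertexP v; exists T, [::]; rewrite cats0 e. Qed.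

Lemma next v i : 1 < i < n ->
  exists2 w : vertex G, wd w = D (tau nu) i (wd v) & uv w = mD i.-2 (uv v).
Proof.
move=> iN; have [T ST e] := vertexP v.
have [T' [ST' e1 e2]] := letters_move ST iN (triD_letters small).
by have [w ew] := vertex_of ST'; exists w; rewrite /uv ew -e.
Qed.

Lemma valid_cat u t : valid (u ++ t) -> valid u.
Proof. by case=> T [s [ST e]]; exists T, (t ++ s); rewrite catA. Qed.

Lemma valid_mv j u : valid u -> valid (mD j u).
Proof.
case=> T [s [ST e]]; case: (leqP (size u) j.+2) => ju; first by rewrite mv_out //; exists T, s.
have iN : 1 < j.+2 < n.
  by rewrite /= -(size_letters nu (content_word T)) e size_cat; apply: leq_trans ju (leq_addr _ _).
have [T' [ST' _ e2]] := letters_move ST iN (triD_letters small).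
by exists T', s; rewrite e2 e mv_catl.
Qed.

Lemma valid_ok u : valid u -> ok u.
Proof. by case=> T [s [ST e]]; have := letters_ok ST; rewrite e => /ok_cat /andP[]. Qed.

Lemma phi_inv m : inv T0 valid m.
Proof. by move=> u Vu su; apply: (inv_all valid_cat valid_mv valid_ok Vu su). Qed.

Lemma size_Y v : size (Y v) = n.
Proof. by rewrite size_phi size_uv. Qed.

Lemma yam_Y v : yam (Y v).
Proof. by have [] := phi_inv (uv_valid v) (size_uv v). Qed.

Lemma phi_mvV u j : valid u -> phi T0 (mD j u) = md j (phi T0 u).
Proof. by move=> Vu; have [_ _ ->] := phi_inv Vu erefl. Qed.

Lemma phi_runV u cs : valid u -> phi T0 (rD cs u) = rd cs (phi T0 u).
Proof.
elim: cs u => //= c cs IH u Vu.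
by rewrite IH ?phi_mvV //; apply: valid_mv.
Qed.

Lemma phi_uniqV u w : valid u -> conn (triD T0) u w -> phi T0 w = phi T0 u -> w = u.
Proof. by move=> Vu; have [_ _ _ U] := phi_inv Vu erefl; apply: U. Qed.

(** Edges are symmetric by definition; one of the two alternatives suffices because the moves are
    involutions on [ok] words. *)
Lemma edgeE i v w : 1 < i < n -> edge i v w = (uv v != uv w) && (uv w == mD i.-2 (uv v)).
Proof.
move=> iN; rewrite /= /word_edge (inj_eq uv_inj); case: (v =P w) => //= nvw.
have E a b : (wd b == D (tau nu) i (wd a)) = (uv b == mD i.-2 (uv a)).
  have [c h1 h2] := next a iN; rewrite -h1 -h2 (inj_eq uv_inj); exact: val_eqE.
rewrite !E orb_idr // => /eqP ->; rewrite mvDK //; apply: valid_ok; exact: uv_valid.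
Qed.

Lemma edge_Y i v w : 1 < i < n -> edge i v w -> Y w = md i.-2 (Y v) /\ Y w != Y v.
Proof.
move=> iN; rewrite edgeE // => /andP[ne /eqP e]; have e' : Y w = md i.-2 (Y v).
  by rewrite /Y e phi_mvV //; apply: uv_valid.
split=> //; apply: contraNneq ne => h; rewrite eq_sym; apply/eqP.
apply: phi_uniqV => //; first exact: uv_valid; by rewrite e; apply: conn_mv.
Qed.

Lemma sgE v h : 0 < h < n -> sg v h = (nth 0 (Y v) h <= nth 0 (Y v) h.-1).
Proof.
case: h => // h /= hn; have [_ S _ _] := phi_inv (uv_valid v) erefl.
have hs : h.+1 < size (Y v) by rewrite size_Y.
transitivity (nth false (sgd (Y v)) h); last exact: (nth_sigw geq hs).
rewrite -S nth_sigw ?size_uv //.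
have h1 : h < n.-1 by move: hn; clear; lia.
rewrite /sg /= (_ : h = Ordinal h1) // nth_mktuple /= /word_sign.
have [T ST e] := vertexP v; have [inj _ _] := SYT_P _ ST.
have [x ex] := cell_of inj (v := h.+1) ltac:(by rewrite /= ltnW).
have [z ez] := cell_of inj (v := h.+2) ltac:(by rewrite /=).
have px : pos (content_word T) h.+1 = (index x (content_order nu)).+1 by rewrite ex pos_entry.
have pz : pos (content_word T) h.+2 = (index z (content_order nu)).+1 by rewrite ez pos_entry.
move: (ex) (ez) => [ex'] [ez']; rewrite /uv -e [ssval v](esym e) px pz ltnS.
have -> : nth 0 (word_letters nu (content_word T)) h = letter x by rewrite ex' nth_letters.
have -> : nth 0 (word_letters nu (content_word T)) h.+1 = letter z by rewrite ez' nth_letters.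
rewrite letter_lt.
have ne : x != z by apply/eqP => h'; move: ez'; rewrite -h' -ex'; clear; lia.
have sne : shifted_content x != shifted_content z.
  by apply/eqP => /(tie_far ST ne); rewrite -ex' -ez'; clear; lia.
apply/idP/idP => [|/index_O_lt //] lt.
by rewrite Order.POrderTheory.lt_neqAle sne sc_le_index // ltnW.
Qed.

Lemma color i : is_color G i -> 1 < i < n. Proof. by []. Qed.

Lemma admitsE i v : 1 < i < n -> admits_neighbor i v = (md i.-2 (Y v) != Y v).
Proof.
case: i => [|[|i]] // iN; rewrite /admits_neighbor !sgE //; last by rewrite /= ltnW.
by rewrite mvd_fix ?size_Y //=; case: leqP; case: leqP.
Qed.

Lemma LLT_ax1 : ax1 G.
Proof.
move=> i /color iN; split=> [v w evw|v]; last first.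
  rewrite admitsE // => nf; have [w ew ew'] := next v iN; exists w; split.
    rewrite edgeE // ew' eqxx andbT; apply: contraNneq nf => e.
    by rewrite /Y -phi_mvV -?e //; apply: uv_valid.
  by move=> w'; rewrite edgeE // => /andP[_ /eqP e]; apply: uv_inj; rewrite e.
have [h1 h2] := edge_Y iN evw; rewrite !admitsE // -h1 h2 /= h1 mvdK eq_sym -h1 //.
Qed.

Lemma LLT_ax2 : ax2 G.
Proof.
move=> i v w /color iN evw; have [h1 h2] := edge_Y iN evw.
case: i iN evw h1 h2 => [|[|j]] // iN evw /= h1 h2.
have jn : j.+2 < size (Y v) by rewrite size_Y.
have [n1 n2 n3] := nth_mv_in trid jn; rewrite -h1 in n1 n2 n3.
move: h2; rewrite h1 mvd_fix // => h2.
have [f1 f2] : (nth 0 (Y w) j.+1 <= nth 0 (Y w) j) = ~~ (nth 0 (Y v) j.+1 <= nth 0 (Y v) j) /\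
    (nth 0 (Y w) j.+2 <= nth 0 (Y w) j.+1) = ~~ (nth 0 (Y v) j.+2 <= nth 0 (Y v) j.+1).
  by rewrite n1 n2 n3; apply: trid_desc.
split; rewrite ?sgE /= ?f1 ?f2 ?negbK //; try by rewrite ltnW.
move=> h /andP[h0 hn] hj; rewrite !sgE ?h0 // h1 !nth_mv_out //;
  move: hj h0; rewrite !inE; clear; lia.
Qed.

Lemma LLT_ax3 : ax3 G.
Proof.
move=> i v w /color iN evw; have [h1 h2] := edge_Y iN evw.
case: i iN evw h1 h2 => [|[|j]] // iN evw /= h1 h2.
have jn : j.+2 < size (Y v) by rewrite size_Y.
have [n1 n2 n3] := nth_mv_in trid jn; rewrite -h1 in n1 n2 n3.
move: h2; rewrite h1 mvd_fix // => h2.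
split.
  rewrite /sg_defined /admits_neighbor subn2 /= => /andP[j0 jN].
  rewrite !sgE /= ?j0 ?(ltnW iN) // n1 n2.
  have e : nth 0 (Y w) j.-1 = nth 0 (Y v) j.-1.
    by rewrite h1 nth_mv_out // !inE; move: j0; clear; lia.
  by rewrite e; apply: (@trid_prev _ _ _ (nth 0 (Y v) j.+2)).
rewrite /sg_defined /admits_neighbor /= => jN.
rewrite !sgE /= ?(ltnW jN) // n2 n3.
have e : nth 0 (Y w) j.+3 = nth 0 (Y v) j.+3.
  by rewrite h1 nth_mv_out // !inE; clear; lia.
by rewrite e; apply: (@trid_next _ (nth 0 (Y v) j)).
Qed.

(** Moves more than two apart act on disjoint triples of letters. *)
Lemma LLT_ax5 : ax5 G.
Proof.
move=> i j v w x /color iN /color jN ij; rewrite !edgeE // => /andP[nvw /eqP ew] /andP[nwx /eqP ex].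
have [y _ ey] := next v jN; exists y; rewrite !edgeE //.
have comm u : mD i.-2 (mD j.-2 u) = mD j.-2 (mD i.-2 u).
  by case/orP: ij => h; [rewrite mv_comm | rewrite -mv_comm] => //; move: h iN jN; clear; lia.
have okv := valid_ok (uv_valid v); have okw := valid_ok (uv_valid w).
have e : uv x = mD i.-2 (uv y) by rewrite ex ew ey comm.
split; rewrite ?ey ?eqxx ?andbT.
  by apply: contraNneq nwx => h; rewrite ex ew -comm -h.
rewrite e ey mvDK ?eqxx ?andbT; last by apply: valid_ok; rewrite -ey; apply: uv_valid.
apply: contraNneq nvw => h; rewrite ew.
by have := congr1 (mD j.-2) h; rewrite comm -ew !mvDK // => ->.
Qed.

Lemma comp_run (J : seq nat) v w : {in J, forall j, 1 < j < n} -> w \in component J v ->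
  exists2 cs, all (fun c => c.+2 \in J) cs & uv w = rD cs (uv v).
Proof.
move=> Jn; rewrite inE => /connectP[p]; elim: p v => [|x p IH] v /=; first by move=> _ ->; exists [::].
move=> /andP[/hasP[j jJ ev] pp] ew; have [cs h1 h2] := IH x pp ew.
have jn := Jn _ jJ; move: ev; rewrite edgeE // => /andP[_ /eqP e].
exists (j.-2 :: cs); last by rewrite h2 e.
by rewrite /= h1 andbT; case: j jJ jn {e} => [|[|j]].
Qed.

Lemma run_path (J : seq nat) v cs i : {in J, forall j, 1 < j < n} -> all (fun c => c.+2 \in J) cs ->
  exists w p, [/\ uv w = rD cs (uv v), colored_path J v p w &
    count (fun s => s.1 == i) p <= count (fun c => c.+2 == i) cs].
Proof.
move=> Jn; elim: cs v => [|c cs IH] v /=; first by move=> _; exists v, [::]; split=> /=.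
move=> /andP[cJ csJ]; have cn := Jn _ cJ; have [x _ ex] := next v cn.
have [w [p [h1 h2 h3]]] := IH x csJ; exists w; have [e|ne] := eqVneq (uv v) (uv x).
  exists p; split; [by rewrite h1 ex | by rewrite (uv_inj e) | exact: leq_trans h3 (leq_addl _ _)].
have ec : edge c.+2 v x by rewrite edgeE // ne ex eqxx.
exists ((c.+2, x) :: p); split; [by rewrite h1 ex | | by rewrite /= leq_add2l].
by apply/and3P; split.
Qed.

Lemma valid_conn_sym u w : valid u -> conn (triD T0) u w -> conn (triD T0) w u.
Proof. exact: (conn_sym valid_mv valid_ok). Qed.

(** Colors up to [i] act only on the first [i+1] letters. The walk that [conn_yam] provides for the
    image of this prefix uses the top move at most once, and injectivity of [phi] shows that the
    same moves join the two given vertices. *)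
Lemma LLT_ax6 : ax6 G.
Proof.
move=> i v w /color iN; set J := iota _ _ => wJ.
have memJ j : (j \in J) = (1 < j <= i) by rewrite mem_iota /=; move: iN; clear; lia.
have Jn : {in J, forall j, 1 < j < n} by move=> j; rewrite memJ => /andP[-> h]; move: h iN; clear; lia.
have [cs csJ ew] := comp_run Jn wJ.
set u := take i.+1 (uv v).
have su : size u = i.+1 by rewrite size_takel // size_uv; case/andP: iN.
have Vu : valid u by apply: (@valid_cat _ (drop i.+1 (uv v))); rewrite cat_take_drop; apply: uv_valid.
have inJ ds : all (fun c => c.+2 < size u) ds = all (fun c => c.+2 \in J) ds.
  by apply: eq_all => c; rewrite memJ su ltnS.
have run_u ds : all (fun c => c.+2 < size u) ds -> rD ds (uv v) = rD ds u ++ drop i.+1 (uv v).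
  by move=> h; rewrite -{1}(cat_take_drop i.+1 (uv v)) run_catl.
have ecs := csJ; rewrite -inJ in ecs.
have Vu' : valid (rD cs u) by apply: V_run Vu; exact: valid_mv.
have yu : yam (phi T0 u) by have [] := phi_inv Vu erefl.
have yu' : yam (phi T0 (rD cs u)) by have [] := phi_inv Vu' erefl.
have P : perm_eq (phi T0 u) (phi T0 (rD cs u)) by rewrite phi_runV // perm_sym perm_rund.
have [ds /andP[dsz dsc] eds] := conn_yam yu yu' P.
rewrite size_phi in dsz dsc; have dsJ := dsz; rewrite inJ in dsJ.
have e : rD ds u = rD cs u.
  apply: phi_uniqV Vu' _ _; last by rewrite eds phi_runV.
  exact: conn_trans (valid_conn_sym Vu (conn_run _ _ _)) (conn_run _ _ _).
have [w' [p [h1 h2 h3]]] := run_path v i Jn dsJ; exists p.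
  by rewrite (_ : w = w') //; apply: uv_inj; rewrite h1 ew !run_u // e.
apply: leq_trans h3 _; rewrite su in dsc; apply: leq_trans dsc.
rewrite -[i.+1 - 3]/(i - 2) leq_eqVlt; apply/orP; left; apply/eqP; apply: eq_count => c /=.
by move: iN; clear; lia.
Qed.

(** The shape is that of the whole word [Y v], whatever the colors. Moves preserve it, injectivity
    separates vertices, and every edge at an image lifts to a move of letters, so the image is an
    entire component. *)
Lemma LLT_iso (J : seq nat) (v : vertex G) : {in J, forall j, 1 < j < n} -> exists (la : partition) (u : vertex (tableau_graph la)),
  scg_n (tableau_graph la) = n /\ colored_iso J (component J v) (component J u).
Proof.
move=> Jn; have [pa shp] := rows_ofP (yam_Y v); pose la := Partition pa; exists la.
have {}shp : has_shape (Y v) la by [].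
have sn : ncells (one_shape la) = n by rewrite (ncells_yam shp) size_Y.
(* Vertices whose image has another shape get an arbitrary tableau; they lie outside the
   component. *)
have [f fP] : exists f : vertex G -> tableau la, forall w, has_shape (Y w) la -> tab_of (Y w) (val (f w)).
  apply: (@fin_all_exists (vertex G) (fun=> tableau la) (fun w t => has_shape (Y w) la -> tab_of (Y w) (val t))) => w; have [t St ht] := tab_exists (yam_Y v) shp.
  have [/boolp.asboolP hw|/boolp.asboolP hw] := boolP (boolp.asbool (has_shape (Y w) la)); last by exists (exist _ t St).
  by have [t' St' ht'] := tab_exists (yam_Y w) hw; exists (exist _ t' St').
exists (f v); split=> //.
have edge_t j (t t' : tableau la) : 1 < j < n -> @edge (tableau_graph la) j t t' =
    (t != t') && (row_reading_word t' == d j (row_reading_word t)).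
  move=> jn; rewrite /= /word_edge; case: eqP => //= _; rewrite orb_idr // => /eqP e.
  have [inj _ _] := SYT_P _ (valP t'); rewrite [X in d j X]e dK //.
  - by apply: fword_uniq => //; apply: uniq_rr.
  - by case/andP: jn => /ltnW.
  move=> z; rewrite fword_mem //; last exact: mem_rr.
  by rewrite sn !inE; move: jn; clear; lia.
have tmove w j (t : tableau la) : 1 < j < n -> has_shape (Y w) la -> tab_of (md j.-2 (Y w)) (val t) ->
    row_reading_word t = d j (row_reading_word (f w)).
  case: j => [|[|j]] // jn sw ht; have H := tab_move (yam_Y w) sw (fP _ sw) ht.
  by apply: H; rewrite size_Y; case/andP: jn.
have step w x j : 1 < j < n -> has_shape (Y w) la -> has_shape (Y x) la ->
    (row_reading_word (f x) == d j (row_reading_word (f w))) = (Y x == md j.-2 (Y w)).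
  move=> jn sw sx; have sm : has_shape (md j.-2 (Y w)) la by apply: has_shape_perm sw; rewrite perm_sym perm_mvd.
  have [t St ht] := tab_exists (yam_mvd j.-2 (yam_Y w)) sm.
  rewrite -(tmove w j (exist _ t St)) //; apply/eqP/eqP => [e|e]; last first.
    by congr row_reading_word; apply: val_inj; apply: (tab_of_uniq sm _ ht); rewrite -e; apply: fP.
  have [i1 _ _] := SYT_P _ (valP (f x)); have [i2 _ _] := SYT_P _ St.
  apply: (tab_of_inj sx sm (fP _ sx)); by rewrite (row_word_inj i1 i2 e).
have comp_shape w : w \in component J v -> has_shape (Y w) la /\ conn (triD T0) (uv v) (uv w).
  move=> /(comp_run Jn)[cs _ e]; rewrite e; split; last exact: conn_run.
  apply: has_shape_perm shp; rewrite /Y e phi_runV; last exact: uv_valid.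
  by rewrite perm_sym perm_rund.
have Y_inj w x : w \in component J v -> x \in component J v -> Y w = Y x -> w = x.
  move=> /comp_shape[_ cw] /comp_shape[_ cx] e; apply: uv_inj; apply: phi_uniqV e; first exact: uv_valid.
  exact: conn_trans (valid_conn_sym (uv_valid v) cx) cw.
have f_inj : {in component J v &, injective f}.
  move=> w x hw hx e; apply: Y_inj => //; have [sw _] := comp_shape _ hw; have [sx _] := comp_shape _ hx.
  by apply: (tab_of_inj sw sx (fP _ sw)); rewrite e; apply: fP.
have f_edge w x j : j \in J -> w \in component J v -> x \in component J v ->
    edge j w x = @edge (tableau_graph la) j (f w) (f x).
  move=> jJ hw hx; have jn := Jn _ jJ; have [sw cw] := comp_shape _ hw; have [sx cx] := comp_shape _ hx.
  rewrite edge_t // step // (inj_in_eq f_inj) // edgeE // (inj_eq uv_inj); congr (_ && _).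
  apply/eqP/eqP => [e|e]; first by rewrite /Y e phi_mvV //; apply: uv_valid.
  have [y _ ey] := next w jn; rewrite -ey; congr uv; apply: uv_inj; apply: phi_uniqV.
  - exact: uv_valid.
  - apply: conn_trans (valid_conn_sym (uv_valid w) _) (conn_trans (valid_conn_sym (uv_valid v) cw) cx).
    by rewrite ey; apply: conn_mv.
  by rewrite ey phi_mvV; [exact: esym | exact: uv_valid].
have lift w (t : tableau la) j : j \in J -> w \in component J v -> @edge (tableau_graph la) j (f w) t ->
    exists2 x, x \in component J v & t = f x.
  move=> jJ hw; have jn := Jn _ jJ; have [sw cw] := comp_shape _ hw; rewrite edge_t // => /andP[ne /eqP e].
  have [x _ ex] := next w jn; have hx : x \in component J v.
    have [ewx|nwx] := eqVneq (uv w) (uv x); first by rewrite -(uv_inj ewx).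
    move: hw; rewrite !inE => /connect_trans; apply; apply: connect1; apply/hasP; exists j => //.
    by rewrite edgeE // nwx ex /=.
  exists x => //; have [sx _] := comp_shape _ hx; apply: val_inj.
  have [i1 _ _] := SYT_P _ (valP t); have [i2 _ _] := SYT_P _ (valP (f x)).
  apply: (row_word_inj i1 i2); rewrite -[LHS]/(row_reading_word t) -[RHS]/(row_reading_word (f x)) e.
  by apply/esym/eqP; rewrite step // /Y ex phi_mvV //; apply: uv_valid.
have v0 : v \in component J v by rewrite inE connect0.
exists f; split=> //; last by move=> j jJ w x hw hx; apply: f_edge.
apply/setP => t; rewrite inE; apply/imsetP/connectP => [[w hw ->]|[p]].
  apply/connectP; move: (hw); rewrite inE => /connectP[p]; elim/last_ind: p w hw => [|p x IH] w hw.
    by move=> _ /= ->; apply: connect0.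
  rewrite rcons_path last_rcons => /andP[pp /hasP[j jJ ej]] ->.
  have hl : last v p \in component J v by rewrite inE; apply/connectP; exists p.
  have hx : x \in component J v.
    by move: hl; rewrite !inE => /connect_trans; apply; apply: connect1; apply/hasP; exists j.
  apply: connect_trans (IH _ hl pp erefl) (connect1 _).
  by apply/hasP; exists j; rewrite // -f_edge.
elim/last_ind: p t => [|p x IH] t /=; first by move=> _ ->; exists v.
rewrite rcons_path last_rcons => /andP[pp /hasP[j jJ ej]] ->.
have [w hw ew] := IH _ pp erefl; rewrite ew in ej.
exact: lift jJ hw ej.
Qed.

Lemma LLT_ax4 : ax4 G.
Proof.
move=> i iN v J; have Jn : {in J, forall j, 1 < j < n}.
  by move=> j; rewrite mem_filter !inE => /andP[j1 /or3P[] /eqP e]; move: iN j1; rewrite e /=; clear; lia.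
have [la [u [sn iso]]] := LLT_iso v Jn; exists la, u; split=> //.
by rewrite sn; case/andP: iN.
Qed.

Lemma LLT_dual : dual_equivalence_graph G.
Proof.
split; split; [exact: LLT_ax1 | exact: LLT_ax2 | exact: LLT_ax3 | exact: LLT_ax4 | exact: LLT_ax5 | exact: LLT_ax6].
Qed.
End Small.

(** * Large diameter *)

Definition quad : Type := nat * nat * nat * nat.

(** [lo3] and [hi3] are the effects of [d i.-1] and [d i] on the positions of the four entries from
    [i-2] to [i+1], see [twin_d]. *)
Definition lo3 (p : quad) : quad :=
  let: (a, b, c, e) := p in (app3 (code false a b c) (a, b, c), e).

Definition hi3 (p : quad) : quad :=
  let: (a, b, c, e) := p in let t := app3 (code false b c e) (b, c, e) in (a, t.1.1, t.1.2, t.2).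

(* In G_lambda the components of E_{i-1} and E_i together have at most three vertices. *)
Lemma lo3_hi3 (a b c e : nat) (p := (a, b, c, e)) : uniq [:: a; b; c; e] ->
  lo3 p != p -> hi3 p != p -> lo3 p != hi3 p -> lo3 (hi3 p) = hi3 p.
Proof.
rewrite /lo3 /hi3 /p /code /= !inE !negb_or => /and4P[/and3P[n1 n2 n3] /andP[n4 n5] n6 _].
case k1 : (between a b c); first by rewrite eqxx.
case k2 : (between b c e); first by rewrite eqxx.
case k3 : (between b a c); case k4 : (between c b e) => /= _ _; rewrite ?eqxx // => _.
- by have -> : between a b e by move: n1 n2 n3 n4 n5 n6 k1 k2 k3 k4; rewrite /between; clear; lia.
- by have -> : between a b e by move: n1 n2 n3 n4 n5 n6 k1 k2 k3 k4; rewrite /between; clear; lia.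
by have -> : between a c b by move: n1 n2 n3 n4 n5 n6 k1 k2 k3 k4; rewrite /between; clear; lia.
Qed.

Definition quad_pos (i : nat) (w : seq nat) : quad := (pos w i.-2, pos w i.-1, pos w i, pos w i.+1).
Definition block i := [:: i.-2; i.-1; i; i.+1].

Section Words.
Variable i : nat.
Hypothesis i2 : 2 < i.

Definition twin (w w' : seq nat) : Prop :=
  perm_eq w' w /\ forall v, v \notin block i -> pos w' v = pos w v.

Lemma twin_eq w w1 w2 : uniq w -> twin w w1 -> twin w w2 -> quad_pos i w1 = quad_pos i w2 -> w1 = w2.
Proof.
move=> uw [P1 F1] [P2 F2] e; apply: eq_from_pos.
- by rewrite (perm_uniq P1).
- by apply: perm_trans P1 _; rewrite perm_sym.
move=> v _; case: (boolP (v \in block i)) => vi; last by rewrite F1 ?F2.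
case: e => e1 e2 e3 e4.
by move: vi; rewrite !inE => /or4P[] /eqP ->; rewrite /pos ?e1 ?e2 ?e3 ?e4.
Qed.

Lemma twin_d w w1 : uniq w -> {subset block i <= w} -> twin w w1 ->
  [/\ twin w (d i.-1 w1), twin w (d i w1), quad_pos i (d i.-1 w1) = lo3 (quad_pos i w1)
    & quad_pos i (d i w1) = hi3 (quad_pos i w1)].
Proof.
move=> uw sub [P F]; have uw1 : uniq w1 by rewrite (perm_uniq P).
have sub1 : {subset block i <= w1} by move=> v /sub; rewrite (perm_mem P).
have far j u : (last_pos j u <= 0) = false by rewrite /last_pos leqNgt leq_max.
have e : i.-1.+1 = i by lia.
have s1 : {subset [:: i.-1.-1; i.-1; i.-1.+1] <= w1}.
  by move=> v h; apply: sub1; move: h; rewrite e /block !inE => /or3P[] ->; rewrite ?orbT.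
have s2 : {subset [:: i.-1; i; i.+1] <= w1}.
  by move=> v h; apply: sub1; move: h; rewrite /block !inE => /or3P[] ->; rewrite ?orbT.
have i1 : 0 < i.-1 by lia.
have i0 : 0 < i by lia.
have [Q1 E1 F1] := D_pos (fun=> 0) uw1 i1 s1 erefl erefl erefl.
have [Q2 E2 F2] := D_pos (fun=> 0) uw1 i0 s2 erefl erefl erefl.
rewrite !D0 !far in Q1 E1 F1 Q2 E2 F2; rewrite e in E1 F1.
split.
- split; first exact: perm_trans Q1 P.
  move=> v vi; rewrite F1 ?F //; apply: contra vi; rewrite /block !inE => /or3P[] ->; by rewrite ?orbT.
- split; first exact: perm_trans Q2 P.
  move=> v vi; rewrite F2 ?F //; apply: contra vi; rewrite /block !inE => /or3P[] ->; by rewrite ?orbT.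
- rewrite /quad_pos /lo3 -[i.-2]/(i.-1.-1) -E1 (F1 i.+1) // !inE; move: i2; clear; lia.
rewrite /quad_pos /hi3 -E2 /= (F2 i.-2) // !inE; move: i2; clear; lia.
Qed.

Lemma short_path w w0 w2 w3 : uniq w -> {subset block i <= w} ->
  w0 = d i.-1 w -> w2 = d i w -> w3 = d i.-1 w2 -> w0 != w -> w2 != w -> w0 != w2 -> w3 = w2.
Proof.
move=> uw sub -> -> -> n0 n2 n02; have t0 : twin w w by split=> //; apply: perm_refl.
have [tA tB qA qB] := twin_d uw sub t0; have [tAB _ qAB _] := twin_d uw sub tB.
have ne x y : twin w x -> twin w y -> x != y -> quad_pos i x != quad_pos i y.
  by move=> tx ty; apply: contra => /eqP /(twin_eq uw tx ty) ->.
apply: (twin_eq uw) => //; rewrite qAB qB; apply: lo3_hi3.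
- have u4 : uniq (block i) by rewrite /= !inE; move: i2; clear; lia.
  by rewrite -[X in uniq X]/(map (pos w) (block i)) map_inj_in_uniq // => x y /sub hx /sub hy; apply: pos_inj.
- by rewrite -qA ne.
- by rewrite -qB ne.
by rewrite -qA -qB ne.
Qed.
End Words.

Lemma tableau_short (la : partition) i (t0 t1 t2 t3 : vertex (tableau_graph la)) :
  2 < i < ncells (one_shape la) -> edge i.-1 t0 t1 -> edge i t1 t2 -> edge i.-1 t2 t3 -> t0 = t2.
Proof.
move=> iN; have inj (t : tableau la) : injective (val t) by have [] := SYT_P _ (valP t).
pose rw (t : tableau la) := row_reading_word t.
have rw_inj (t t' : tableau la) : rw t = rw t' -> t = t'.
  by move=> e; apply: val_inj; apply: row_word_inj (inj t) (inj t') e.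
have urw t : uniq (rw t) by apply: fword_uniq => //; apply: uniq_rr.
have mrw t v : (v \in rw t) = (0 < v <= ncells (one_shape la)) by apply: fword_mem => //; apply: mem_rr.
have E j (t t' : tableau la) : 1 < j < ncells (one_shape la) -> @edge (tableau_graph la) j t t' ->
    [/\ rw t != rw t', rw t' = d j (rw t) & rw t = d j (rw t')].
  move=> jN /andP[ne h]; have sub t'' : {subset [:: j.-1; j; j.+1] <= rw t''}.
    by move=> v; rewrite mrw !inE; move: jN; clear; lia.
  have j0 : 0 < j by case/andP: jN => /ltnW.
  have {}ne : rw t != rw t' by apply: contra ne => /eqP/rw_inj ->.
  case/orP: h => /eqP h; rewrite -!/(rw _) in h; split=> //; by rewrite h dK.
move=> e01 e12 e23; have [|n01 _ w0] := E i.-1 _ _ _ e01; first by move: iN; clear; lia.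
have [|n12 w2 _] := E i _ _ _ e12; first by move: iN; clear; lia.
have [|n23 w3 _] := E i.-1 _ _ _ e23; first by move: iN; clear; lia.
apply: rw_inj; apply/eqP/negPn/negP => n02; move: n23; rewrite eq_sym; apply/negP; rewrite negbK; apply/eqP.
have [i2 _] := andP iN.
apply: (short_path i2 (urw t1)) w0 w2 w3 n01 _ n02; last by rewrite eq_sym.
by move=> v; rewrite mrw !inE; move: iN; clear; lia.
Qed.

(** * Four consecutive entries in a window of length [k] *)

Section Large.
Variables (k : nat) (nu : k.-tuple skew_shape).
Notation cell := (cell nu).
Notation n := (ncells nu).
Notation sc := (@shifted_content k nu).
Notation G := (LLT_graph nu).

Definition below (x y : cell) : bool :=
  [&& x != y, shape_index x == shape_index y, cell_row x <= cell_row y & cell_column x <= cell_column y].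

Lemma below_trans x y z : below x y -> below y z -> below x z.
Proof.
move=> /and4P[n1 /eqP s1 r1 c1] /and4P[n2 /eqP s2 r2 c2]; apply/and4P; split.
- apply: contra n1 => /eqP e; apply/eqP; apply: cell_eq => //; rewrite -?e in r2 c2; lia.
- by rewrite s1 s2.
- exact: leq_trans r1 r2.
exact: leq_trans c1 c2.
Qed.

Lemma below_irr x : below x x = false.
Proof. by rewrite /below eqxx. Qed.

Lemma below_height x y : below x y -> cell_row x + cell_column x < cell_row y + cell_column y.
Proof.
move=> /and4P[ne /eqP s r c]; rewrite ltn_neqAle leq_add // andbT; apply: contra ne => /eqP e.
by apply/eqP; apply: cell_eq => //; move: e r c; clear; lia.
Qed.

Lemma linear_extension (L : seq cell) : uniq L -> (forall x, x \in L) ->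
  (forall x y, below x y -> index x L < index y L) ->
  exists2 T : filling nu, T \in SYT nu & forall x, entry T x = (index x L).+1.
Proof.
move=> uL fL mono; have sL : size L = n by rewrite -(card_uniqP uL) /ncells; apply: eq_card => x; rewrite fL.
have b x : index x L < n by rewrite -sL index_mem fL.
exists [ffun x => Ordinal (b x)]; last by move=> x; rewrite /entry ffunE.
apply/SYT_P; split=> [x y|x y es er lt|x y es ec lt]; rewrite !ffunE.
- by move=> [] /(index_inj x (fL x) (fL y)).
- apply: mono; rewrite /below es er (ltnW lt) !eqxx leqnn !andbT.
  by apply: contraTneq lt => ->; rewrite ltnn.
apply: mono; rewrite /below es ec (ltnW lt) !eqxx leqnn !andbT.
by apply: contraTneq lt => ->; rewrite ltnn.
Qed.

(* The cells strictly below C, then C, then the other cells. *)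
Lemma consecutive_filling (C : seq cell) : uniq C ->
  (forall a b z, a \in C -> b \in C -> below a z -> below z b -> False) ->
  (forall a b, a \in C -> b \in C -> below a b -> index a C < index b C) ->
  exists T a, [/\ T \in SYT nu, a + size C <= n & forall c, c \in C -> entry T c = a + (index c C).+1].
Proof.
move=> uC conv mono; pose lower x := (x \notin C) && has (below x) C.
pose upper x := (x \notin C) && ~~ has (below x) C.
pose h (x y : cell) := cell_row x + cell_column x <= cell_row y + cell_column y.
pose L1 := sort h [seq x <- enum cell | lower x]; pose L3 := sort h [seq x <- enum cell | upper x].
have m1 x : (x \in L1) = lower x by rewrite mem_sort mem_filter mem_enum andbT.
have m3 x : (x \in L3) = upper x by rewrite mem_sort mem_filter mem_enum andbT.
have h_lt L x y : x \in sort h L -> y \in sort h L -> below x y -> index x (sort h L) < index y (sort h L).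
  move=> hx hy /below_height lt; rewrite ltnNge; apply/negP => le.
  have h_total : total h by move=> ? ?; apply: leq_total.
  have h_trans : transitive h by move=> ? ? ?; apply: leq_trans.
  have := sorted_leq_index h_trans (fun z => leqnn _) (sort_sorted h_total L) _ _ hy hx le.
  by rewrite /h leqNgt lt.
have uL : uniq (L1 ++ C ++ L3).
  have u1 : uniq L1 by rewrite sort_uniq filter_uniq // enum_uniq.
  have u3 : uniq L3 by rewrite sort_uniq filter_uniq // enum_uniq.
  rewrite !cat_uniq u1 u3 uC andbT /=; apply/andP; split; last first.
    by apply/hasPn => x; rewrite m3 => /andP[].
  apply/hasPn => x; rewrite mem_cat m1 /lower => /orP[->//|]; rewrite m3 => /andP[_ /negPf ->].
  by rewrite andbF.
have fL x : x \in L1 ++ C ++ L3.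
  by rewrite !mem_cat m1 m3 /lower /upper; case: (x \in C) => //=; case: has.
have iL x : index x (L1 ++ C ++ L3) = if lower x then index x L1 else
    if x \in C then size L1 + index x C else size L1 + (size C + index x L3).
  rewrite !index_cat m1; case: ifP => // _; by case: ifP.
have low z c : c \in C -> below z c -> z \notin C -> lower z.
  by move=> cC zc zC; rewrite /lower zC; apply/hasP; exists c.
have [T ST eT] : exists2 T : filling nu, T \in SYT nu & forall x, entry T x = (index x (L1 ++ C ++ L3)).+1.
  apply: linear_extension => // x y xy; rewrite !iL.
  have [lx|nlx] := boolP (lower x).
    have ix : index x L1 < size L1 by rewrite index_mem m1.
    have [ly|nly] := boolP (lower y); first by apply: h_lt; rewrite // -/L1 m1.
    by case: ifP => _; apply: leq_trans ix (leq_addr _ _).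
  have [xC|xC] := boolP (x \in C).
    have -> : lower y = false.
      by apply/negP => /andP[_ /hasP[c cC yc]]; apply: (conv x c y).
    case: ifP => yC; rewrite ltn_add2l; first exact: mono.
    by apply: leq_trans (leq_addr _ _); rewrite index_mem.
  have ux : upper x by move: nlx; rewrite /lower /upper xC.
  have -> : lower y = false.
    apply/negP => /andP[_ /hasP[c cC yc]]; move/negP: nlx; apply.
    exact: low cC (below_trans xy yc) xC.
  case: ifP => yC; first by rewrite (low x y) in nlx.
  rewrite !ltn_add2l; apply: h_lt; rewrite // -/L3 m3 //.
  by rewrite /upper yC; apply: contra nlx => /hasP[c cC yc]; apply: low cC (below_trans xy yc) xC.
exists T, (size L1); split=> //.
  have <- : size (L1 ++ C ++ L3) = n by rewrite -(card_uniqP uL) /ncells; apply: eq_card => x; rewrite fL.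
  by rewrite !size_cat addnA leq_addr.
by move=> c cC; rewrite eT iL /lower cC /= addnS.
Qed.

Lemma content_word_inj (T T' : filling nu) x : content_word T = content_word T' -> entry T x = entry T' x.
Proof. by move/eq_in_map; apply; apply: mem_O. Qed.

Lemma bad_filling (T : filling nu) i (y1 y2 y3 y4 : cell) : T \in SYT nu -> 2 < i < n ->
  [/\ entry T y1 = i.-2, entry T y2 = i.-1, entry T y3 = i & entry T y4 = i.+1] ->
  (sc y2 < sc y1 /\ sc y1 < sc y4 /\ sc y4 < sc y3 \/ sc y3 < sc y4 /\ sc y4 < sc y1 /\ sc y1 < sc y2)%R ->
  (`|sc y2 - sc y3| <= k%:Z)%R -> ~ ax4 G.
Proof.
move=> ST iN [e1 e2 e3 e4] ord close H.
have i1N : 1 < i.-1 < n by move: iN; clear; lia.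
have iN' : 1 < i < n by move: iN; clear; lia.
have i11 : i.-1.+1 = i by move: iN; clear; lia.
have shuf (a b c : cell) : ((sc b < sc a < sc c) || (sc c < sc a < sc b))%R ->
    (`|sc b - sc c| <= k%:Z)%R -> cell_shuffle a b c = RotL.
  move=> h1 h2; rewrite /cell_shuffle h1 h2 ifF //; move: h1; clear; lia.
have shufR (a b c : cell) : ((sc a < sc c < sc b) || (sc b < sc c < sc a))%R ->
    (`|sc a - sc b| <= k%:Z)%R -> cell_shuffle a b c = RotR.
  move=> h1 h2; rewrite /cell_shuffle h2 !ifF //; move: h1; clear; lia.
have sne x y : (sc x < sc y \/ sc y < sc x)%R -> sc x != sc y by clear; lia.
have [T0 [ST0 w0 b0 f0]] : exists T', [/\ T' \in SYT nu, content_word T' = D (tau nu) i.-1 (content_word T),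
    [/\ entry T' y2 = i.-2, entry T' y3 = i.-1 & entry T' y1 = i] & forall x, x \notin [:: y1; y2; y3] -> entry T' x = entry T x].
  have := @D_filling _ nu T i.-1 y1 y2 y3 ST i1N (esym e1) (esym e2).
  rewrite i11 shuf //; last by move: ord; clear; lia.
  by apply=> //; apply: sne; move: ord; clear; lia.
have [T2 [ST2 w2 b2 f2]] : exists T', [/\ T' \in SYT nu, content_word T' = D (tau nu) i (content_word T),
    [/\ entry T' y4 = i.-1, entry T' y2 = i & entry T' y3 = i.+1] & forall x, x \notin [:: y2; y3; y4] -> entry T' x = entry T x].
  have := @D_filling _ nu T i y2 y3 y4 ST iN' (esym e2) (esym e3) (esym e4).
  rewrite shufR //; last by move: ord; clear; lia.
  by apply=> //; apply: sne; move: ord; clear; lia.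
have [c4 c2 c3] := b2.
have c1 : entry T2 y1 = i.-2.
  rewrite f2 // !inE; apply/negP; move=> /or3P[] /eqP e; by move: ord; rewrite e; clear; lia.
have [T3 [ST3 w3 b3 f3]] : exists T', [/\ T' \in SYT nu, content_word T' = D (tau nu) i.-1 (content_word T2),
    [/\ entry T' y4 = i.-2, entry T' y2 = i.-1 & entry T' y1 = i] & forall x, x \notin [:: y1; y4; y2] -> entry T' x = entry T2 x].
  have := @D_filling _ nu T2 i.-1 y1 y4 y2 ST2 i1N (esym c1) (esym c4).
  rewrite i11 shuf //; try by move: ord close; clear; lia.
  by apply=> //; apply: sne; move: ord; clear; lia.
have [v1 ev1] := vertex_of ST; have [v0 ev0] := vertex_of ST0.
have [v2 ev2] := vertex_of ST2; have [v3 ev3] := vertex_of ST3.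
have ne (v w : vertex G) (U W : filling nu) y : val (v : LLT_vertex nu) = content_word U ->
    val (w : LLT_vertex nu) = content_word W -> entry U y != entry W y -> v != w.
  by move=> ev ew; apply: contra => /eqP e; apply/eqP; apply: content_word_inj; rewrite -ev -ew e.
have [g1 g2] : i.-2 != i /\ i.-2 != i.-1 by move: iN; clear; lia.
have n01 : v0 != v1 by apply: (ne _ _ T0 T y2) => //; rewrite e2; case: b0 => ->.
have n12 : v1 != v2 by apply: (ne _ _ T T2 y4) => //; rewrite e4 c4; move: iN; clear; lia.
have n23 : v2 != v3 by apply: (ne _ _ T2 T3 y1) => //; rewrite c1; case: b3 => _ _ ->.
have n02 : v0 != v2 by apply: (ne _ _ T0 T2 y1) => //; rewrite c1 eq_sym; case: b0 => _ _ ->.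
have E01 : edge i.-1 v0 v1 by apply/andP; split=> //; apply/orP; right; rewrite ev0 ev1 w0.
have E12 : edge i v1 v2 by apply/andP; split=> //; apply/orP; left; rewrite ev1 ev2 w2.
have E23 : edge i.-1 v2 v3 by apply/andP; split=> //; apply/orP; left; rewrite ev2 ev3 w3.
have iG : (scg_m G).+1 < i < scg_n G by [].
have [la [u [un [f [inj _ pres]]]]] := H i iG v1.
move: inj pres un; set J := filter _ _ => inj pres un.
have [iJ i1J] : i \in J /\ i.-1 \in J.
  by rewrite !mem_filter !inE subn1 !eqxx ?orbT /=; move: iN; clear; lia.
have adj v w j : j \in J -> edge j v w -> v \in component J v1 -> w \in component J v1.
  move=> jJ evw; rewrite !inE => /connect_trans; apply; apply: connect1; apply/hasP; by exists j.
have C1 : v1 \in component J v1 by rewrite inE connect0.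
have C0 : v0 \in component J v1 by apply: (adj v1 v0 i.-1) => //; rewrite edge_sym.
have C2 : v2 \in component J v1 by apply: (adj v1 v2 i).
have C3 : v3 \in component J v1 by apply: (adj v2 v3 i.-1).
have iT : 2 < i < ncells (one_shape la) by case/andP: iN => ->.
have := tableau_short iT; move/(_ (f v0) (f v1) (f v2) (f v3)); rewrite -!pres // => /(_ E01 E12 E23).
by move/(inj _ _ C0 C2) => e; rewrite e eqxx in n02.
Qed.

(** Choosing the southwestern end of each diagonal makes two chosen cells of one shape adjacent when
    their contents differ by 1, so that no cell lies between them. *)
Definition lowest (x : cell) : Prop := forall z, sc z = sc x -> cell_row x <= cell_row z.

Lemma lowest_exists c : c \in sorted_contents nu -> exists2 x, sc x = c & lowest x.
Proof.
rewrite mem_sort mem_undup => /mapP[z _ ->].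
case: (@arg_minnP _ z (fun x => sc x == sc z) (fun x : cell => cell_row x) (eqxx _)) => x /eqP e H; exists x => // z' e'.
by apply: H; rewrite e' e.
Qed.

(** Within one shape, shifted contents differ by multiples of [k]. *)
Lemma far_shapes (a b : cell) : (sc a < sc b)%R -> (sc b - sc a < k%:Z)%R -> shape_index a != shape_index b.
Proof.
move=> lt d; apply/eqP => e; have k0 : (0 < k%:Z)%R by have := ltn_ord (shape_index a); lia.
move: lt d; rewrite /shifted_content e => lt d.
have h1 : (content a < content b)%R by rewrite -(ltr_pM2l k0); move: lt; clear; lia.
have h2 : (content b < content a + 1)%R by rewrite -(ltr_pM2l k0); move: d; clear; lia.
by move: h1 h2; clear; lia.
Qed.

(** If the cells were not adjacent, the skew shape would contain a cell on one of the two diagonals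
    below the chosen one. *)
Lemma lowest_adjacent (a b : cell) : lowest a -> lowest b -> (sc a < sc b)%R -> (sc b - sc a <= k%:Z)%R ->
  shape_index a = shape_index b ->
  cell_row a = cell_row b /\ (cell_column a).+1 = cell_column b \/
  (cell_row b).+1 = cell_row a /\ cell_column a = cell_column b.
Proof.
move=> la lb lt d e; have k0 : (0 < k%:Z)%R by have := ltn_ord (shape_index a); lia.
have ec : (content b = content a + 1)%R.
  move: lt d; rewrite /shifted_content e => lt d.
  have h1 : (content a < content b)%R by rewrite -(ltr_pM2l k0); move: lt; clear; lia.
  have h2 : (content b <= content a + 1)%R by rewrite -(ler_pM2l k0); move: d; clear; lia.
  by move: h1 h2; clear; lia.
have sa := cellP a; have sb := cellP b; rewrite -e in sb.
case: (ltngtP (cell_row a) (cell_row b)) => h; last by left; split=> //; move: ec h; rewrite /content; clear; lia.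
  have [] := @cell_exists _ nu (shape_index a) (cell_row a) (cell_column a).+1.
    by apply: in_shape_box sa sb _ _; move: ec h; rewrite /content; clear; lia.
  move=> z [z1 z2 z3]; have : cell_row b <= cell_row z.
    by apply: lb; rewrite /shifted_content /content z1 z2 z3 -e; move: ec; rewrite /content => ec; congr (_ * _ + _)%R; move: ec; clear; lia.
  by rewrite z2 leqNgt h.
right; case: (ltngtP (cell_row b).+1 (cell_row a)) => h'; [|by move: h h'; clear; lia|]; last first.
  by split=> //; move: ec h'; rewrite /content; clear; lia.
have [] := @cell_exists _ nu (shape_index a) (cell_row b).+1 (cell_column b).
  by apply: in_shape_box sb sa _ _; move: ec h'; rewrite /content; clear; lia.
move=> z [z1 z2 z3]; have : cell_row a <= cell_row z.
  by apply: la; rewrite /shifted_content /content z1 z2 z3; move: ec; rewrite /content => ec; congr (_ * _ + _)%R; move: ec; clear; lia.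
by rewrite z2 leqNgt h'.
Qed.

Lemma ax4_diam : ax4 G -> diam nu <= 3.
Proof.
move=> H; rewrite leqNgt; apply/negP => /diam_gt3[x1 [x2 [x3 [x4 [sub l12 l23 l34 d14]]]]].
have get x : x \in [:: x1; x2; x3; x4] -> exists2 c : cell, sc c = x & lowest c.
  by move=> /sub; apply: lowest_exists.
have [c1 e1 low1] := get x1 ltac:(by rewrite !inE eqxx).
have [c2 e2 low2] := get x2 ltac:(by rewrite !inE eqxx orbT).
have [c3 e3 low3] := get x3 ltac:(by rewrite !inE eqxx !orbT).
have [c4 e4 low4] := get x4 ltac:(by rewrite !inE eqxx !orbT).
move: l12 l23 l34 d14; rewrite -{}e1 -{}e2 -{}e3 -{}e4 => l12 l23 l34 d14 {get sub x1 x2 x3 x4}.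
have far a b : (sc a < sc b)%R -> (sc b - sc a < k%:Z)%R -> below a b || below b a = false.
  move=> h1 h2; have ne := far_shapes h1 h2; apply/negP => /orP[] /and4P[_ /eqP e _ _].
    by rewrite e eqxx in ne.
  by rewrite e eqxx in ne.
(* Only [c1] and [c4] can be at distance exactly [k]; all other pairs lie in different shapes and
   are incomparable. *)
have [/norP[n12 n21] /norP[n13 n31] /norP[n23 n32]] :
    [/\ ~~ (below c1 c2 || below c2 c1), ~~ (below c1 c3 || below c3 c1) & ~~ (below c2 c3 || below c3 c2)].
  by split; rewrite far //; move: l12 l23 l34 d14; clear; lia.
have [/norP[n24 n42] /norP[n34 n43]] : ~~ (below c2 c4 || below c4 c2) /\ ~~ (below c3 c4 || below c4 c3).
  by split; rewrite far //; move: l12 l23 l34 d14; clear; lia.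
have anti a b : below a b -> below b a -> False.
  by move=> h1 h2; have := below_trans h1 h2; rewrite below_irr.
have cover z : (below c1 z -> below z c4 -> False) /\ (below c4 z -> below z c1 -> False).
  split=> b1 b2; have := below_trans b1 b2 => /and4P[_ /eqP es r c]; have l14 : (sc c1 < sc c4)%R by move: l12 l23 l34; clear; lia.
    have adj := lowest_adjacent low1 low4 l14 d14 es.
    by have := below_height b1; have := below_height b2; move: adj r c; clear; lia.
  have adj := lowest_adjacent low1 low4 l14 d14 (esym es).
  by have := below_height b1; have := below_height b2; move: adj r c; clear; lia.
have main y1 y2 y3 y4 : perm_eq [:: y1; y2; y3; y4] [:: c1; c2; c3; c4] ->
  (sc y2 < sc y1 /\ sc y1 < sc y4 /\ sc y4 < sc y3 \/ sc y3 < sc y4 /\ sc y4 < sc y1 /\ sc y1 < sc y2)%R ->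
  (`|sc y2 - sc y3| <= k%:Z)%R ->
  (forall a b, a \in [:: c1; c2; c3; c4] -> b \in [:: c1; c2; c3; c4] -> below a b -> a = y2 /\ b = y3) -> False.
  move=> P ord close only; have u4 : uniq [:: y1; y2; y3; y4].
    have ne (a b : cell) : (sc a < sc b \/ sc b < sc a)%R -> a != b.
      by move=> h; apply: contraPneq h => ->; clear; lia.
    by rewrite /= !inE !negb_or !ne //; move: ord; clear; lia.
  have [|a b h1 h2 h3|T [a [ST an eT]]] := consecutive_filling u4.
  - move=> a b z; rewrite !(perm_mem P) => aC bC az zb.
    have := below_trans az zb; move: aC bC; rewrite !inE => /or4P[] /eqP ea /or4P[] /eqP eb; subst a b;
    rewrite ?below_irr ?(negPf n12) ?(negPf n21) ?(negPf n13) ?(negPf n31) ?(negPf n23) ?(negPf n32)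
      ?(negPf n24) ?(negPf n42) ?(negPf n34) ?(negPf n43) // => _.
      by have [h _] := cover z; apply: h.
    by have [_ h] := cover z; apply: h.
  - have [-> ->] := only a b ltac:(by rewrite -(perm_mem P)) ltac:(by rewrite -(perm_mem P)) h3.
    move: u4; rewrite /= !inE !negb_or => /and4P[/and3P[m1 m2 m3] /andP[m4 m5] m6 _].
    by rewrite !eqxx (negPf m1) (negPf m2) (negPf m4).
  apply: (@bad_filling T (a + 3) y1 y2 y3 y4) ord close H => //.
    by move: an => /=; clear; lia.
  move: u4; rewrite /= !inE !negb_or => /and4P[/and3P[m1 m2 m3] /andP[m4 m5] m6 _].
  split; rewrite eT ?inE ?eqxx ?orbT //= ?eqxx ?(negPf m1) ?(negPf m2) ?(negPf m3) ?(negPf m4) ?(negPf m5) ?(negPf m6);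
    clear; lia.
(* If [c4] is below [c1], it needs the smaller entry, which leads to 3412. Otherwise 2143, where
   [c1] comes before [c4], respects the order. *)
have [b41|nb41] := boolP (below c4 c1).
  apply: (main c3 c4 c1 c2).
  - by apply/permP => p /=; clear; lia.
  - by right; split; [|split].
  - by move: l12 l23 l34 d14; clear; lia.
  move=> a b; rewrite !inE => /or4P[] /eqP -> /or4P[] /eqP ->;
    rewrite ?below_irr ?(negPf n12) ?(negPf n21) ?(negPf n13) ?(negPf n31) ?(negPf n23) ?(negPf n32)
      ?(negPf n24) ?(negPf n42) ?(negPf n34) ?(negPf n43) //.
  by move=> b14; case: (anti _ _ b14 b41).
apply: (main c2 c1 c4 c3).
- by apply/permP => p /=; clear; lia.
- by left; split; [|split].
- by move: l12 l23 l34 d14; clear; lia.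
move=> a b; rewrite !inE => /or4P[] /eqP -> /or4P[] /eqP ->;
  by rewrite ?below_irr ?(negPf n12) ?(negPf n21) ?(negPf n13) ?(negPf n31) ?(negPf n23) ?(negPf n32)
    ?(negPf n24) ?(negPf n42) ?(negPf n34) ?(negPf n43) ?(negPf nb41).
Qed.
End Large.

Theorem theorem4p11 (k : nat) (nu : k.-tuple skew_shape) :
  dual_equivalence_graph (LLT_graph nu) <-> diam nu <= 3.
Proof.
split=> [[_ [H _ _]]|small]; first exact: ax4_diam.
exact: LLT_dual.
Qed.
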